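(* Let $(\mathcal{G},\|\cdot\|)$ be an arithmetical semigroup satisfying Axiom $A$, with set of primes $\mathcal{P}$, and let $S\subseteq\mathcal{P}$ have natural density $\delta(S)$. Let $a\colon\mathcal{G}\to\mathbb{C}$ be an arithmetic function supported on $\mathfrak{D}(\mathcal{G},S)$ with $a(e_{\mathcal{G}})=1$, and assume $$\lim_{x\to\infty}\sum_{\substack{2\le\|g\|\le x\\ g\in\mathfrak{D}(\mathcal{G},S)}}\frac{|a(g)|}{\|g\|}\log\log\|g\|<\infty .$$ Then $$-\lim_{x\to\infty}\sum_{\substack{\|g\|\le x\\ g\in\mathfrak{D}(\mathcal{G},S),\ g\neq e_{\mathcal{G}}}}\frac{(\mu*a)(g)}{\|g\|}=\delta(S).$$ In particular, taking $a$ to be the identity of the Dirichlet convolution ring ($a(e_{\mathcal{G}})=1$, $a(g)=0$ for $g\ne e_{\mathcal{G}}$), $$-\lim_{x\to\infty}\sum_{\substack{\|g\|\le x\\ g\in\mathfrak{D}(\mathcal{G},S),\ g\neq e_{\mathcal{G}}}}\frac{\mu(g)}{\|g\|}=\delta(S).$$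
   Context: An arithmetical semigroup is a commutative monoid $\mathcal{G}$ with identity $e_{\mathcal{G}}$ that is freely generated (as a commutative monoid) by a finite or countable set $\mathcal{P}$ of ''primes'', equipped with a norm $\|\cdot\|\colon\mathcal{G}\to\mathbb{R}$ such that $\|e_{\mathcal{G}}\|=1$, $\|P\|>1$ for all $P\in\mathcal{P}$, $\|gh\|=\|g\|\|h\|$, and $\mathcal{N}(x):=\#\{g\in\mathcal{G}:\|g\|\le x\}$ is finite for every $x>0$. It satisfies Axiom $A$ if $\mathcal{N}(x)=c_{\mathcal{G}}x+O(x^{\eta})$ for constants $c_{\mathcal{G}}>0$ and $0<\eta<1$. For $S\subseteq\mathcal{P}$, the natural density is $\delta(S):=\lim_{x\to\infty}\pi_{\mathcal{G},S}(x)/\pi_{\mathcal{G}}(x)$ (when the limit exists), where $\pi_{\mathcal{G},S}(x)=\#\{P\in S:\|P\|\le x\}$ and $\pi_{\mathcal{G}}(x)=\pi_{\mathcal{G},\mathcal{P}}(x)$. We write $h\mid g$ if $g=hr$ for some $r\in\mathcal{G}$. For $g\ne e_{\mathcal{G}}$ let $\mathrm{N}_-(g)=\min\{\|P\|:P\in\mathcal{P},P\mid g\}$. An element $g$ is distinguishable if $g\neq e_{\mathcal{G}}$ and there is a unique prime $P_{\min}(g)\mid g$ with $\|P_{\min}(g)\|=\mathrm{N}_-(g)$. Set $\mathfrak{D}(\mathcal{G},S)=\{g: g\text{ distinguishable},\ P_{\min}(g)\in S\}\cup\{e_{\mathcal{G}}\}$. The Möbius function is $\mu(e_{\mathcal{G}})=1$,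 $\mu(P_1\cdots P_k)=(-1)^k$ for distinct primes $P_i$, and $\mu(g)=0$ if $P^2\mid g$ for some prime $P$. A function $a$ is supported on $\mathfrak{D}(\mathcal{G},S)$ if $a(g)=0$ for $g\notin\mathfrak{D}(\mathcal{G},S)$. Dirichlet convolution: $(\mu*a)(g)=\sum_{h\mid g}\mu(h)a(g/h)$. *)

(* Defs.v *)
From HB Require Import structures.
From mathcomp Require Import all_boot all_order all_algebra.
From mathcomp Require Import finmap multiset.
From mathcomp Require Import complex.
From mathcomp Require Import all_classical all_reals all_analysis.
Import Order.TTheory GRing.Theory Num.Theory.
Import numFieldNormedType.Exports.

Set Implicit Arguments.
Unset Strict Implicit.
Unset Printing Implicit Defensive.

Local Open Scope ring_scope.
Local Open Scope classical_set_scope.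
Open Scope mset_scope.
Local Open Scope ring_scope.

(* An arithmetical semigroup is (up to isomorphism) the free commutative
   monoid {mset P} on its set of primes P (a countable type), with identity
   mset0, product the multiset sum, and a completely multiplicative norm
   determined by its values N p on the primes.                              *)

Definition asg_norm (R : realType) (P : countType) (N : P -> R) (g : {mset P}) : R :=
  \prod_(p <- finsupp g) N p ^+ g p.

Definition asg_dvd (P : countType) (h g : {mset P}) : bool := (h `<=` g)%mset.

(* g / h  (meaningful when h | g) *)
Definition asg_quo (P : countType) (g h : {mset P}) : {mset P} := (g `\` h)%mset.

Definition asg_mu (R : realType) (P : countType) (g : {mset P}) : R[i] :=
  if all (fun p => g p == 1%N) (finsupp g) then (-1) ^+ size (finsupp g) else 0.

Definition mu_conv (R : realType) (P : countType) (a : {mset P} -> R[i])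
    (g : {mset P}) : R[i] :=
  \sum_(h \in [set h : {mset P} | asg_dvd h g]) asg_mu R h * a (asg_quo g h).

Definition is_Pmin (R : realType) (P : countType) (N : P -> R)
    (g : {mset P}) (p : P) : Prop :=
  (0 < g p)%N /\ forall q : P, (0 < g q)%N -> q <> p -> N p < N q.

Definition inD (R : realType) (P : countType) (N : P -> R) (S : set P)
    (g : {mset P}) : Prop :=
  g = mset0 \/ exists p, is_Pmin N g p /\ S p.

Definition Ncount (R : realType) (P : countType) (N : P -> R) (x : R) : R :=
  \sum_(g \in [set g : {mset P} | asg_norm N g <= x]) (1 : R).

Definition piS (R : realType) (P : countType) (N : P -> R) (S : set P) (x : R) : R :=
  \sum_(p \in [set p : P | S p /\ N p <= x]) (1 : R).

Definition axiomA (R : realType) (P : countType) (N : P -> R) : Prop :=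
  exists (c eta K x0 : R), 0 < c /\ 0 < eta < 1 /\
    forall x : R, x0 <= x -> `|Ncount N x - c * x| <= K * x `^ eta.

(* Main.v *)
(* Write N(x) = #{|g| <= x}, M(x) = sum_{|g| <= x} mu(g).

   (1) M(x) = o(x), elementarily. With L(g) = log |g|, the function c L - 1*1 - b has, for
   a suitable b, a summatory function O(x^s) with s < 1 (Axiom A and the hyperbola
   method). Convolving it, and its product with L, with mu gives the Chebyshev bound and
   Selberg's formula, whence
   c log^2 x |M(x)| <= 2 sum_{|h| <= x} L(h) |M(x/|h|)| + O(x log x).
   Cut the range of |h| into cells (A, e^T A]. As |M(t)|/t varies slowly, in each cell it is
   either small on a fixed proportion or M(x/|h|) keeps its sign, and then its sum is O(x)
   because M summed over an initial segment is O(x). Either way the cell contributes a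
   fixed factor less than limsup |M(t)|/t would, so that this limsup is 0.

   (2) Let mu_D be mu restricted to the elements whose smallest prime is unique and lies
   in S. Splitting off the smallest prime, the sum of mu_D is o(x), by (1) for the small
   primes and by a sieve for the large ones. In the same way
   - sum mu_D(d) N(x/|d|) = sum_{p in S} #{h : |p h| <= x, all primes of h have norm <= |p|}
   (Alladi's duality between smallest and largest primes). The right-hand side is
   c delta x + o(x): partial summation needs only pi_S - delta pi = o(pi) and a Chebyshev
   bound. Since the sum of mu_D is o(x), Axer's argument replaces N(x/|d|) by c x/|d|.

   (3) For general a, sum by the cofactor: the weight of a(k)/|k| tends to 0 for k <> e, and
   is O(log log |k|), so that dominated convergence reduces to (2). *)
Require Import Defs.
From HB Require Import structures.
From mathcomp Require Import all_boot all_order all_algebra.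
From mathcomp Require Import finmap multiset.
From mathcomp Require Import complex.
From mathcomp Require Import all_classical all_reals all_analysis.
From mathcomp Require Import ring lra zify.
Import Order.TTheory GRing.Theory Num.Theory.
Import numFieldNormedType.Exports.
Local Open Scope ring_scope.
Local Open Scope classical_set_scope.
Open Scope mset_scope.
Local Open Scope complex_scope.
Local Open Scope ring_scope.

Set Implicit Arguments.
Unset Strict Implicit.
Unset Printing Implicit Defensive.

(** * Norms and divisors *)

(** The factor 2 in the inequality of (1) is exactly critical. If |M(t)| <= alpha t for large t,
    then, the sum of L(h)/|h| being c log^2 x / 2 to leading order, the right-hand side is alpha c x
    log^2 x: nothing is gained and nothing is lost. Any fixed relative saving in the cells therefore
    lowers alpha, but only errors of order x log x can be afforded. This is why power savings come
    before inversion: mu turns an error O(x^s) with s < 1 into O(x), without a logarithm.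

    Distinct primes may share a norm. The duality of (2) produces counts with non-strict
    inequalities, in which an element with several largest primes occurs several times, whereas the
    comparison with N(x) wants each element once. The difference runs over pairs of primes of equal
    norm, and is o(x) because Axiom A leaves room for only O(t^eta) primes of norm t.

    The log log in (3) is the sum of 1/|q| over the primes q of norm below the smallest prime of k,
    those that can take its place as smallest prime of a product k h. *)

Class arith_semigroup (R : realType) (P : countType) (N : P -> R) : Prop :=
  ArithSemigroup {
    norm_prime_gt1 : forall p : P, 1 < N p;
    finite_norm_le : forall x : R,
      finite_set [set g : {mset P} | asg_norm N g <= x] }.

Section Norm.
Context {R : realType} {P : countType} {N : P -> R} {asgN : arith_semigroup N}.
Local Notation nrm := (asg_norm N).
Implicit Types (x y : R) (g h d k : {mset P}) (p q : P).

Lemma mem_gt0 g p : (p \in finsupp g) = (0 < g p)%N.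
Proof. by rewrite msuppE in_mset. Qed.

Lemma asg_normE g (s : seq P) : uniq s -> {subset finsupp g <= s} ->
  nrm g = \prod_(p <- s) N p ^+ g p.
Proof.
move=> us sub; rewrite [RHS](bigID (fun p => p \in finsupp g)) /=.
rewrite [X in _ * X]big1 ?mulr1; last first.
  by move=> p; rewrite mem_gt0 -eqn0Ngt => /eqP ->; rewrite expr0.
rewrite -[RHS]big_filter; apply: perm_big; apply: uniq_perm.
- exact: fset_uniq.
- exact: filter_uniq.
by move=> p; rewrite mem_filter; case: (boolP (p \in finsupp g)) => //= /sub ->.
Qed.

Lemma asg_norm0 : nrm mset0 = 1.
Proof. by rewrite /asg_norm finsupp0 big_seq_fset0. Qed.

Lemma asg_normD g h : nrm (g `+` h) = nrm g * nrm h.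
Proof.
pose s := undup (finsupp g ++ finsupp h).
have us : uniq s by exact: undup_uniq.
rewrite !(@asg_normE _ s) //.
- rewrite -big_split /=; apply: eq_bigr => p _.
  by rewrite msetE2 exprD.
- by move=> p; rewrite /s mem_undup mem_cat => ->; rewrite orbT.
- by move=> p; rewrite /s mem_undup mem_cat => ->.
- move=> p; rewrite /s mem_undup mem_cat !mem_gt0 msetE2.
  by rewrite addn_gt0.
Qed.

Lemma asg_normn p n : nrm (msetn n p) = N p ^+ n.
Proof.
rewrite (@asg_normE _ [:: p]) //= ?big_seq1 ?msetnxx //.
by move=> q; rewrite mem_gt0 msetnE inE; case: eqP.
Qed.

Lemma asg_norm1 p : nrm [mset p] = N p.
Proof. by rewrite asg_normn expr1. Qed.

Lemma norm_prime_ge1 p : 1 <= N p. Proof. exact/ltW/norm_prime_gt1. Qed.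
Lemma norm_prime_gt0 p : 0 < N p.
Proof. exact: lt_le_trans ltr01 (norm_prime_ge1 p). Qed.

Lemma asg_norm_ge1 g : 1 <= nrm g.
Proof.
rewrite /asg_norm; elim/big_ind : _ => // [x y|p _]; first exact: mulr_ege1.
exact/exprn_ege1/norm_prime_ge1.
Qed.

Lemma asg_norm_gt0 g : 0 < nrm g.
Proof. exact: lt_le_trans ltr01 (asg_norm_ge1 g). Qed.

Lemma asg_norm_ge0 g : 0 <= nrm g. Proof. exact/ltW/asg_norm_gt0. Qed.

Lemma asg_norm_neq0 g : nrm g != 0. Proof. exact/lt0r_neq0/asg_norm_gt0. Qed.

Lemma asg_norm_dvd d g : (d `<=` g)%mset -> nrm d <= nrm g.
Proof.
move=> /msetBDKC <-; rewrite asg_normD ler_peMr ?asg_norm_ge0 //.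
exact: asg_norm_ge1.
Qed.

Definition elts (x : R) : seq {mset P} := fset_set [set g | nrm g <= x].

Lemma mem_elts x g : (g \in elts x) = (nrm g <= x).
Proof.
rewrite /elts in_fset_set; last exact: finite_norm_le.
by apply/idP/idP; rewrite inE.
Qed.

Lemma elts_uniq x : uniq (elts x). Proof. exact: fset_uniq. Qed.

Lemma elts_lt1 x : x < 1 -> elts x = [::].
Proof.
move=> x1; case E: (elts x) => [//|g s].
have : g \in elts x by rewrite E mem_head.
by rewrite mem_elts leNgt (lt_le_trans x1) // asg_norm_ge1.
Qed.

Lemma fsbig_elts (V : nmodType) x (Q : set {mset P}) (F : {mset P} -> V) :
  (forall g, Q g -> nrm g <= x) ->
  \sum_(g \in Q) F g = \sum_(g <- elts x | `[< Q g >]) F g.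
Proof.
move=> sub.
have fQ : finite_set Q by exact: sub_finite_set sub (finite_norm_le x).
rewrite fsbig_finite // -[RHS]big_filter; apply: perm_big; apply: uniq_perm.
- exact: fset_uniq.
- exact/filter_uniq/elts_uniq.
move=> g; rewrite in_fset_set // mem_filter mem_elts.
apply/idP/andP => [/set_mem Qg|[/asboolP Qg _]]; last exact: mem_set.
by split; [exact/asboolP|exact: sub].
Qed.

Lemma sum_multiples (V : nmodType) x d (F : {mset P} -> V) :
  \sum_(g <- elts x | (d `<=` g)%mset) F g =
  \sum_(k <- elts (x / nrm d)) F (d `+` k).
Proof.
rewrite -[LHS]big_filter -(big_map (fun k => d `+` k) xpredT F).
apply: perm_big; apply: uniq_perm.
- exact/filter_uniq/elts_uniq.
- rewrite map_inj_uniq ?elts_uniq // => k k' /(congr1 (msetB^~ d)).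
  by rewrite !(msetDKB d).
move=> g; rewrite mem_filter mem_elts; apply/andP/mapP => [[dg gx]|[k]].
  exists (g `\` d); last by rewrite msetBDKC.
  by rewrite mem_elts ler_pdivlMr ?asg_norm_gt0 // mulrC -asg_normD msetBDKC.
rewrite mem_elts ler_pdivlMr ?asg_norm_gt0 // mulrC -asg_normD => kx ->.
by split=> //; apply/msubsetP => p; rewrite msetE2 leq_addr.
Qed.

Definition divs g : seq {mset P} := [seq d <- elts (nrm g) | (d `<=` g)%mset].

Lemma mem_divs g d : (d \in divs g) = (d `<=` g)%mset.
Proof.
rewrite mem_filter mem_elts.
by case: (boolP (d `<=` g)%mset) => //= /asg_norm_dvd ->.
Qed.

Lemma divs_uniq g : uniq (divs g). Proof. exact/filter_uniq/elts_uniq. Qed.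

(** |d| |k| <= x says that the product lies in [elts x], so the pairs are regrouped by their product
    [g]; a pair is recovered from [g] and its divisor [d]. *)
Lemma sum_pairs (V : nmodType) x (F : {mset P} -> {mset P} -> V) :
  \sum_(d <- elts x) \sum_(k <- elts (x / nrm d)) F d k =
  \sum_(g <- elts x) \sum_(d <- divs g) F d (g `\` d).
Proof.
transitivity (\sum_(d <- elts x) \sum_(g <- elts x | (d `<=` g)%mset) F d (g `\` d)).
  apply: eq_bigr => d _; rewrite sum_multiples; apply: eq_bigr => k _.
  by rewrite msetDKB.
rewrite (exchange_big_dep xpredT) //=.
rewrite big_seq [RHS]big_seq; apply: eq_bigr => g; rewrite mem_elts => gx.
rewrite -[LHS]big_filter; apply: perm_big; apply: uniq_perm.
- exact/filter_uniq/elts_uniq.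
- exact: divs_uniq.
move=> d; rewrite mem_filter mem_divs mem_elts.
by case: (boolP (d `<=` g)%mset) => //= /asg_norm_dvd /le_trans ->.
Qed.

Lemma sum_pairsC (V : nmodType) x (F : {mset P} -> {mset P} -> V) :
  \sum_(d <- elts x) \sum_(k <- elts (x / nrm d)) F d k =
  \sum_(k <- elts x) \sum_(d <- elts (x / nrm k)) F d k.
Proof.
have E (H : {mset P} -> {mset P} -> V) : \sum_(d <- elts x) \sum_(k <- elts (x / nrm d)) H d k =
    \sum_(d <- elts x) \sum_(k <- elts x | nrm d * nrm k <= x) H d k.
  apply: eq_bigr => d _; rewrite -[RHS]big_filter.
  apply: perm_big; apply: uniq_perm.
  - exact: elts_uniq.
  - exact/filter_uniq/elts_uniq.
  move=> k; rewrite mem_filter !mem_elts ler_pdivlMr ?asg_norm_gt0 // mulrC.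
  case: (boolP (nrm d * nrm k <= x)) => //= dkx; symmetry.
  by apply: le_trans dkx; rewrite ler_peMl ?asg_norm_ge0 ?asg_norm_ge1.
rewrite E (exchange_big_dep xpredT) //= (E (fun k d => F d k)).
by apply: eq_bigr => k _; apply: eq_bigl => d; rewrite mulrC.
Qed.

End Norm.
#[global] Arguments elts {R P} N x.
#[global] Arguments divs {R P} N g.

(** * Dirichlet convolution *)

Section Convolution.
Context {R : realType} {P : countType} {N : P -> R} {asgN : arith_semigroup N}.
Local Notation nrm := (asg_norm N).
Local Notation elts := (elts N).
Local Notation divs := (divs N).
Implicit Types (x y : R) (g d k : {mset P}) (p q : P) (f h : {mset P} -> R) (Q : pred P).

(* Arithmetic functions act on functions of a real variable, convolution becoming
   composition and multiplication by [ln] a derivation. *)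
Definition dact f (Phi : R -> R) x : R := \sum_(g <- elts x) f g * Phi (x / nrm g).

Definition dconv f h g : R := \sum_(d <- divs g) f d * h (g `\` d).

Definition logn_norm g : R := ln (nrm g).

Lemma logn_norm_ge0 g : 0 <= logn_norm g.
Proof. exact/ln_ge0/asg_norm_ge1. Qed.

(** [Phi] is evaluated at the points x/|g| with 1 <= |g| <= x, all in [1, x]. Identities known only
    there can thus be substituted under [dact]. *)
Lemma eq_dact f1 f2 (Phi1 Phi2 : R -> R) x :
  f1 =1 f2 -> (forall y, 1 <= y <= x -> Phi1 y = Phi2 y) ->
  dact f1 Phi1 x = dact f2 Phi2 x.
Proof.
move=> ef ePhi; rewrite /dact big_seq [RHS]big_seq; apply: eq_bigr => g.
rewrite mem_elts => gx; rewrite ef ePhi // ler_pdivlMr ?asg_norm_gt0 // mul1r gx /=.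
rewrite ler_pdivrMr ?asg_norm_gt0 // ler_peMr ?asg_norm_ge1 //.
exact: le_trans (asg_norm_ge0 g) gx.
Qed.

Lemma dact_lt1 f Phi x : x < 1 -> dact f Phi x = 0.
Proof. by move=> x1; rewrite /dact elts_lt1 // big_nil. Qed.

Lemma divrD_norm x d k : x / nrm d / nrm k = x / nrm (d `+` k).
Proof. by rewrite asg_normD invfM mulrA. Qed.

Lemma dact_dconv f h Phi x : dact (dconv f h) Phi x = dact f (dact h Phi) x.
Proof.
transitivity (\sum_(d <- elts x) \sum_(k <- elts (x / nrm d)) f d * h k * Phi (x / nrm d / nrm k)).
  rewrite (sum_pairs x (fun d k => f d * h k * Phi (x / nrm d / nrm k))).
  apply: eq_bigr => g _; rewrite mulr_suml [LHS]big_seq [RHS]big_seq.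
  apply: eq_bigr => d; rewrite mem_divs => dg.
  by rewrite divrD_norm msetBDKC.
by apply: eq_bigr => d _; rewrite mulr_sumr; apply: eq_bigr => k _; rewrite mulrA.
Qed.

Lemma dactC f h Phi x : dact f (dact h Phi) x = dact h (dact f Phi) x.
Proof.
rewrite /dact.
transitivity (\sum_(d <- elts x) \sum_(k <- elts (x / nrm d)) f d * h k * Phi (x / nrm d / nrm k)).
  by apply: eq_bigr => d _; rewrite mulr_sumr; apply: eq_bigr => k _; rewrite mulrA.
rewrite (sum_pairsC x (fun d k => f d * h k * Phi (x / nrm d / nrm k))).
apply: eq_bigr => k _; rewrite mulr_sumr; apply: eq_bigr => d _.
by rewrite mulrA [h k * f d]mulrC [x / nrm d / nrm k]mulrAC.
Qed.

Lemma dactDr f Phi Psi x :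
  dact f (fun y => Phi y + Psi y) x = dact f Phi x + dact f Psi x.
Proof. by rewrite /dact -big_split; apply: eq_bigr => g _; rewrite mulrDr. Qed.

Lemma dactZr f (a : R) Phi x : dact f (fun y => a * Phi y) x = a * dact f Phi x.
Proof. by rewrite /dact mulr_sumr; apply: eq_bigr => g _; rewrite mulrCA. Qed.

Lemma dactDl f h Phi x :
  dact (fun g => f g + h g) Phi x = dact f Phi x + dact h Phi x.
Proof. by rewrite /dact -big_split; apply: eq_bigr => g _; rewrite mulrDl. Qed.

Lemma dactZl f (a : R) Phi x : dact (fun g => a * f g) Phi x = a * dact f Phi x.
Proof. by rewrite /dact mulr_sumr; apply: eq_bigr => g _; rewrite mulrA. Qed.

Lemma ln_dact f Phi x : 0 < x ->
  ln x * dact f Phi x =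
  dact (fun g => f g * logn_norm g) Phi x + dact f (fun y => ln y * Phi y) x.
Proof.
move=> x0; rewrite /dact mulr_sumr -big_split; apply: eq_bigr => g _ /=.
rewrite ln_div ?posrE ?asg_norm_gt0 // /logn_norm; ring.
Qed.

Lemma dact_ge0 f Phi x : (forall g, 0 <= f g) -> (forall y, 1 <= y -> 0 <= Phi y) ->
  0 <= dact f Phi x.
Proof.
move=> f0 P0; rewrite /dact big_seq; apply: sumr_ge0 => g; rewrite mem_elts => gx.
by rewrite mulr_ge0 // P0 // ler_pdivlMr ?asg_norm_gt0 // mul1r.
Qed.

Lemma ler_dact f h Phi Psi x :
  (forall g, `|f g| <= h g) -> (forall y, 1 <= y <= x -> `|Phi y| <= Psi y) ->
  `|dact f Phi x| <= dact h Psi x.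
Proof.
move=> fh PP; apply: le_trans (ler_norm_sum _ _ _) _.
rewrite /dact big_seq [leRHS]big_seq; apply: ler_sum => g; rewrite mem_elts => gx.
rewrite normrM ler_pM // PP //.
rewrite ler_pdivlMr ?asg_norm_gt0 // mul1r gx /=.
rewrite ler_pdivrMr ?asg_norm_gt0 // ler_peMr ?asg_norm_ge1 //.
exact: le_trans (asg_norm_ge0 g) gx.
Qed.

Lemma dact_delta f Phi x : (forall g, f g = (g == mset0)%:R) -> 1 <= x ->
  dact f Phi x = Phi x.
Proof.
move=> fE x1; rewrite /dact (bigD1_seq mset0) ?elts_uniq ?mem_elts ?asg_norm0 //=.
rewrite big1 ?addr0 ?fE ?eqxx ?mul1r ?asg_norm0 ?divr1 // => g /negPf g0.
by rewrite fE g0 mul0r.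
Qed.

Definition supp_in Q g := all Q (finsupp g).
Definition ind Q g : R := (supp_in Q g)%:R.
(** The Moebius function of the submonoid generated by the primes in [Q], extended by 0; it is the
    inverse of [ind Q] under convolution. *)
Definition mob Q g : R :=
  if supp_in Q g && all (fun p => g p == 1%N) (finsupp g)
  then (-1) ^+ size (finsupp g) else 0.

Lemma supp_inP Q g : reflect (forall p, (0 < g p)%N -> Q p) (supp_in Q g).
Proof.
apply: (iffP allP) => H p; last by rewrite mem_gt0; exact: H.
by rewrite -mem_gt0; exact: H.
Qed.

Lemma supp_in0 Q : supp_in Q mset0.
Proof. by apply/supp_inP => p; rewrite mset0E. Qed.

Lemma supp_inD Q g k : supp_in Q (g `+` k) = supp_in Q g && supp_in Q k.
Proof.
apply/supp_inP/andP => [H|[/supp_inP Hg /supp_inP Hk] p].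
  by split; apply/supp_inP => p gp; apply: H; rewrite msetE2 addn_gt0 gp ?orbT.
by rewrite msetE2 addn_gt0 => /orP[/Hg|/Hk].
Qed.

Lemma supp_in1 Q p : supp_in Q [mset p] = Q p.
Proof.
apply/supp_inP/idP => [H|Qp q]; first by apply: H; rewrite msetnxx.
by rewrite msetnE; case: eqP => // ->.
Qed.

Lemma supp_in_pred0 g : supp_in pred0 g = (g == mset0).
Proof.
apply/supp_inP/eqP => [H|-> p]; last by rewrite mset0E.
by apply/msetP => p; rewrite mset0E; case E: (g p) => //; have := H p; rewrite E => /(_ isT).
Qed.

Lemma ind_ge0 Q g : 0 <= ind Q g. Proof. exact: ler0n. Qed.

Lemma norm_ind Q g : `|ind Q g| = ind Q g. Proof. by rewrite ger0_norm ?ind_ge0. Qed.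

Lemma norm_mob_ind Q g : `|mob Q g| <= ind Q g.
Proof.
rewrite /mob /ind; case: (supp_in Q g) => /=; last by rewrite normr0.
by case: ifP => _; rewrite ?normrX ?normrN1 ?expr1n ?normr0.
Qed.

Lemma norm_mob Q g : `|mob Q g| <= 1.
Proof. by apply: le_trans (norm_mob_ind Q g) _; rewrite /ind lern1 leq_b1. Qed.

Lemma mob0 Q : mob Q mset0 = 1.
Proof. by rewrite /mob supp_in0 finsupp0. Qed.

Lemma finsuppD1 g p : finsupp (p +` g) = (p |` finsupp g)%fset.
Proof.
by apply/fsetP => q; rewrite in_fset1U !mem_gt0 mset1DE addn_gt0; case: eqP.
Qed.

Lemma mobD1 Q g p :
  mob Q (p +` g) = if (g p == 0%N) && Q p then - mob Q g else 0.
Proof.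
rewrite /mob supp_inD supp_in1 finsuppD1.
have [g0|gp] /= := eqVneq (g p) 0%N; last first.
  case: ifP => // /andP[_ /allP /(_ p)].
  by rewrite in_fset1U eqxx mset1DE eqxx add1n => /(_ isT) /eqP [/eqP]; rewrite (negPf gp).
case: (Q p) => //=.
have pg : p \notin finsupp g by rewrite mem_gt0 g0.
have -> : all (fun q => (p +` g) q == 1%N) (p |` finsupp g)%fset =
          all (fun q => g q == 1%N) (finsupp g).
  apply/allP/allP => H q.
    move=> qg; have := H q; rewrite in_fset1U qg orbT => /(_ isT).
    by rewrite mset1DE; have [qp|//] := eqVneq q p; rewrite qp (negPf pg) in qg.
  rewrite in_fset1U mset1DE => /orP[/eqP ->|qg]; first by rewrite eqxx g0.
  by have [qp|/= _] := eqVneq q p; [rewrite qp (negPf pg) in qg|exact: H].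
have -> : size (p |` finsupp g)%fset = (size (finsupp g)).+1.
  by have := cardfsU1 p (finsupp g); rewrite pg add1n.
by case: ifP => _; rewrite ?oppr0 // exprS mulN1r.
Qed.

Lemma sum_divs_multiples (V : nmodType) g p (F : {mset P} -> V) : (0 < g p)%N ->
  \sum_(d <- divs g | (0 < d p)%N) F d = \sum_(d <- divs (g `\ p)) F (p +` d).
Proof.
move=> gp; rewrite -[LHS]big_filter -(big_map (fun k => p +` k) xpredT F).
apply: perm_big; apply: uniq_perm.
- exact/filter_uniq/divs_uniq.
- rewrite map_inj_uniq ?divs_uniq // => k k' /(congr1 (msetB^~ [mset p])).
  by rewrite !(msetDKB [mset p]).
move=> d; rewrite mem_filter mem_divs; apply/andP/mapP => [[dp dg]|[k]].
  exists (d `\ p); last by rewrite msetB1K // in_mset.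
  by rewrite mem_divs msetSB.
rewrite mem_divs => kg ->; rewrite mset1DE eqxx; split=> //.
by rewrite -(@msetB1K _ p g) ?in_mset // msetDS.
Qed.

(** If some prime p of [g] satisfies [Q], the divisors d and p d, with p not dividing d, cancel in
    pairs; otherwise only the identity contributes. In Euler products, the factors at the primes of
    [Q] are removed from the zeta function. *)
Lemma sum_mob Q g : \sum_(d <- divs g) mob Q d = ind (predC Q) g.
Proof.
have [gQ|/allPn[p]] := boolP (supp_in (predC Q) g).
  rewrite /ind gQ /= (bigD1_seq mset0) ?divs_uniq ?mem_divs ?msub0set //= mob0.
  rewrite big_seq_cond big1 ?addr0 // => d /andP[]; rewrite mem_divs => /msubsetP dg d0.
  rewrite /mob; case: ifP => // /andP[/supp_inP dQ _].
  have : supp_in pred0 d.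
    apply/supp_inP => p dp; have := dQ p dp.
    by have /supp_inP /(_ p (leq_trans dp (dg p))) /negP := gQ.
  by rewrite supp_in_pred0 (negPf d0).
rewrite mem_gt0 /= negbK => gp Qp; rewrite /ind.
have -> : supp_in (predC Q) g = false.
  by apply/supp_inP => /(_ p gp) /=; rewrite Qp.
rewrite (bigID (fun d : {mset P} => (0 < d p)%N)) /= sum_divs_multiples //.
under [X in X + _]eq_bigr => d _ do rewrite mobD1 Qp andbT.
rewrite -big_mkcond sumrN; apply/eqP; rewrite addrC subr_eq0; apply/eqP.
rewrite -[LHS]big_filter -[RHS]big_filter; apply: perm_big; apply: uniq_perm.
- exact/filter_uniq/divs_uniq.
- exact/filter_uniq/divs_uniq.
move=> d; rewrite [LHS]mem_filter [RHS]mem_filter !mem_divs -eqn0Ngt; case: eqP => //= dp.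
apply/msubsetP/msubsetP => dg q; have := dg q; rewrite ?msetB1E.
  by case: eqVneq => [->|_]; rewrite ?dp ?subn0.
by move=> /leq_trans; apply; exact: leq_subr.
Qed.

Lemma dact_mob_one Q Phi x :
  dact (mob Q) (dact (fun=> 1) Phi) x = dact (ind (predC Q)) Phi x.
Proof.
rewrite -dact_dconv; apply: eq_dact => // g; rewrite -sum_mob /dconv.
by apply: eq_bigr => d _; rewrite mulr1.
Qed.

(** Moebius inversion for functions of a real variable. Below 1 every [dact] is 0, hence the
    restriction on [x]. *)
Lemma dact_mob_inv Phi x : 1 <= x ->
  dact (mob xpredT) (dact (fun=> 1) Phi) x = Phi x.
Proof.
move=> x1; rewrite dact_mob_one dact_delta // => g; rewrite /ind -supp_in_pred0.
by congr (_%:R).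
Qed.

(** Von Mangoldt's function: at most one term is nonzero, and one is exactly when [g] is a positive
    power of a single prime. *)
Definition vonM g : R :=
  \sum_(p <- finsupp g) (if g == msetn (g p) p then ln (N p) else 0).

Lemma vonM_ge0 g : 0 <= vonM g.
Proof.
apply: sumr_ge0 => p _; case: ifP => // _.
exact/ln_ge0/norm_prime_ge1.
Qed.

Lemma logn_normE g : logn_norm g = \sum_(p <- finsupp g) (g p)%:R * ln (N p).
Proof.
rewrite /logn_norm /asg_norm; elim: (enum_fset (finsupp g)) => [|p s IH].
  by rewrite !big_nil ln1.
rewrite !big_cons lnM ?posrE ?exprn_gt0 ?norm_prime_gt0 //; last first.
  by apply: prodr_gt0 => q _; rewrite exprn_gt0 ?norm_prime_gt0.
by rewrite IH lnXn ?norm_prime_gt0 // mulr_natl.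
Qed.

(** A prime p of [g] contributes ln (N p) once for each of the divisors p, ..., p^(g p). *)
Lemma sum_vonM g : \sum_(d <- divs g) vonM d = logn_norm g.
Proof.
transitivity (\sum_(d <- divs g) \sum_(p <- finsupp g)
    (if (0 < d p)%N && (d == msetn (d p) p) then ln (N p) else 0)).
  rewrite big_seq [RHS]big_seq; apply: eq_bigr => d; rewrite mem_divs => dg.
  rewrite /vonM [RHS](bigID (fun p => p \in finsupp d)) /= [X in _ + X]big1 ?addr0.
    rewrite -[RHS]big_filter.
    transitivity (\sum_(p <- finsupp d)
       (if (0 < d p)%N && (d == msetn (d p) p) then ln (N p) else 0)).
      by rewrite big_seq [RHS]big_seq; apply: eq_bigr => p; rewrite mem_gt0 => ->.
    apply: perm_big; apply: uniq_perm.
    - exact: fset_uniq.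
    - exact/filter_uniq/fset_uniq.
    move=> p; rewrite mem_filter; case: (boolP (p \in finsupp d)) => //=.
    by rewrite !mem_gt0 => dp; symmetry; exact: leq_trans dp (msubsetP dg p).
  by move=> p; rewrite mem_gt0 => /negPf ->.
rewrite exchange_big /= logn_normE; apply: eq_bigr => p _.
rewrite -big_mkcond -big_filter big_const_seq iter_addr_0 mulr_natl.
congr (_ *+ _); rewrite -[RHS](size_iota 1) -(size_map (fun n => msetn n p)).
apply/perm_size/uniq_perm.
- exact/filter_uniq/divs_uniq.
- rewrite map_inj_uniq ?iota_uniq // => m n /(congr1 (fun g : {mset P} => g p)).
  by rewrite !msetnxx.
move=> d; rewrite mem_filter mem_divs; apply/idP/mapP.
  move=> /andP[/andP[dp /eqP dE] /msubsetP dg]; exists (d p) => //.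
  by rewrite mem_iota dp add1n ltnS dg.
move=> [n]; rewrite mem_iota add1n ltnS => /andP[n0 ng] ->.
rewrite msetnxx n0 eqxx /=; apply/msubsetP => q; rewrite msetnE.
by case: eqP => // ->.
Qed.

Lemma dact_one_vonM Phi x :
  dact (fun=> 1) (dact vonM Phi) x = dact logn_norm Phi x.
Proof.
rewrite dactC -dact_dconv; apply: eq_dact => // g; rewrite -sum_vonM /dconv.
by apply: eq_bigr => d _; rewrite mulr1.
Qed.

End Convolution.

(** * Growth of real functions *)

Section Domination.
Context {R : realType}.
Implicit Types (f g h : R -> R) (x y a b : R).

(** The constant works from 1 on, not just eventually, because [dact] feeds in all the values x/|g|
    down to 1. *)
Definition dominated f g := exists2 C, 0 <= C & forall x, 1 <= x -> `|f x| <= C * g x.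

Definition sublinear f :=
  forall e, 0 < e -> exists2 X, 1 <= X & forall x, X <= x -> `|f x| <= e * x.

Lemma domD f1 f2 g : dominated f1 g -> dominated f2 g -> dominated (fun x => f1 x + f2 x) g.
Proof.
move=> [C1 C10 H1] [C2 C20 H2]; exists (C1 + C2); first exact: addr_ge0.
by move=> x x1; rewrite mulrDl (le_trans (ler_normD _ _)) // lerD ?H1 ?H2.
Qed.

Lemma domZ a f g : dominated f g -> dominated (fun x => a * f x) g.
Proof.
move=> [C C0 H]; exists (`|a| * C); first exact: mulr_ge0.
by move=> x x1; rewrite normrM -mulrA ler_wpM2l ?H.
Qed.

Lemma domB f1 f2 g : dominated f1 g -> dominated f2 g -> dominated (fun x => f1 x - f2 x) g.
Proof.
move=> H1 /(domZ (-1)) H2; have [C C0 H] := domD H1 H2.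
by exists C => // x /H; rewrite mulN1r.
Qed.

Lemma dom_trans f g h : (forall x, 1 <= x -> 0 <= g x) ->
  dominated f g -> dominated g h -> dominated f h.
Proof.
move=> g0 [C1 C10 H1] [C2 C20 H2]; exists (C1 * C2); first exact: mulr_ge0.
move=> x x1; apply: le_trans (H1 x x1) _; rewrite -mulrA ler_wpM2l //.
by apply: le_trans (H2 x x1); exact: ler_norm.
Qed.

Lemma eq_dom f1 f2 g : (forall x, 1 <= x -> f1 x = f2 x) -> dominated f1 g -> dominated f2 g.
Proof. by move=> e [C C0 H]; exists C => // x x1; rewrite -e ?H. Qed.

Lemma eq_ler x y : x = y -> x <= y. Proof. by move=> ->. Qed.
Lemma ge1_gt0 x : 1 <= x -> 0 < x. Proof. exact: lt_le_trans. Qed.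
Lemma ge1_ge0 x : 1 <= x -> 0 <= x. Proof. exact: le_trans. Qed.

Lemma lnB1 x : 0 < x -> ln x <= x - 1.
Proof.
move=> x0; have -> : ln x = ln (1 + (x - 1)) by congr ln; ring.
by apply: le_ln1Dx; rewrite ltrBrDr addrC subrr.
Qed.

Lemma ln_le_powR a x : 0 < a -> 0 < x -> ln x <= x `^ a / a.
Proof.
move=> a0 x0; rewrite ler_pdivlMr // mulrC -ln_powR.
apply: le_trans (lnB1 _) _; first exact: powR_gt0.
by rewrite gerBl.
Qed.

Lemma powR_ge1 a x : 0 <= a -> 1 <= x -> 1 <= x `^ a.
Proof. by move=> a0 x1; rewrite -{1}(powRr0 x) ler_powR. Qed.

Lemma ltr_powR x a b : 1 < x -> a < b -> x `^ a < x `^ b.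
Proof.
move=> x1 ab; have x0 : 0 < x := lt_trans ltr01 x1.
by rewrite /powR !(gt_eqF x0) ltr_expR ltr_pM2r // ln_gt0.
Qed.

Lemma dom_powR_ln a b : a < b ->
  dominated (fun x => x `^ a * ln x) (fun x => x `^ b).
Proof.
move=> ab; have d0 : 0 < b - a by rewrite subr_gt0.
exists (b - a)^-1; first by rewrite invr_ge0 ltW.
move=> x x1; rewrite ger0_norm ?mulr_ge0 ?powR_ge0 ?ln_ge0 //.
have x0 := ge1_gt0 x1.
have -> : (b - a)^-1 * x `^ b = x `^ a * (x `^ (b - a) / (b - a)).
  rewrite mulrA -powRD ?lt0r_neq0 ?implybT //.
  by rewrite mulrC; congr (_ `^ _ * _); ring.
by rewrite ler_wpM2l ?powR_ge0 // ln_le_powR.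
Qed.

Lemma dom_powR a b : a <= b -> dominated (fun x => x `^ a) (fun x => x `^ b).
Proof.
move=> ab; exists 1 => // x x1; rewrite mul1r ger0_norm ?powR_ge0 //.
exact: ler_powR.
Qed.

Lemma halving_ind (T : R -> Prop) : (forall x, x < 1 -> T x) ->
  (forall x, 1 <= x -> T (x / 2) -> T x) -> forall x, T x.
Proof.
move=> T0 TS x.
have [n] : exists n : nat, x < 2 ^+ n.
  exists (Num.trunc x).+1; apply: lt_le_trans (truncnS_gt x) _.
  by rewrite -natrX ler_nat ltnW // ltn_expl.
elim: n x => [|n IH] x; first by rewrite expr0; exact: T0.
have [x1 _|x1 xn] := ltP x 1; first exact: T0.
by apply: TS => //; apply: IH; rewrite ltr_pdivrMr // -exprSr.
Qed.

Lemma sublinD f1 f2 : sublinear f1 -> sublinear f2 -> sublinear (fun x => f1 x + f2 x).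
Proof.
move=> H1 H2 e e0; have e2 : 0 < e / 2 by rewrite divr_gt0.
have [X1 X11 H1'] := H1 _ e2; have [X2 X21 H2'] := H2 _ e2.
exists (Num.max X1 X2); first by rewrite le_max X11.
move=> x; rewrite ge_max => /andP[xX1 xX2].
apply: le_trans (ler_normD _ _) _.
by have := lerD (H1' x xX1) (H2' x xX2); rewrite -mulrDl -splitr.
Qed.

Lemma sublinZ a f : sublinear f -> sublinear (fun x => a * f x).
Proof.
move=> H e e0; have a0 : 0 < `|a| + 1 by rewrite ltr_wpDl.
have [X X1 HX] := H (e / (`|a| + 1)) (divr_gt0 e0 a0).
exists X => // x /[dup] Xx /HX; rewrite normrM => Hx.
apply: (@le_trans _ _ ((`|a| + 1) * `|f x|)).
  by rewrite ler_wpM2r // lerDl.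
by rewrite -ler_pdivlMl // mulrA [_^-1 * e]mulrC.
Qed.

Lemma sublinB f1 f2 : sublinear f1 -> sublinear f2 -> sublinear (fun x => f1 x - f2 x).
Proof.
move=> H1 /(sublinZ (-1)) H2 e /(sublinD H1 H2)[X X1 H].
by exists X => // x /H; rewrite mulN1r.
Qed.

Lemma eq_sublin f1 f2 : (forall x, 1 <= x -> f1 x = f2 x) -> sublinear f1 -> sublinear f2.
Proof.
by move=> E H e /H[X X1 HX]; exists X => // x Xx; rewrite -E ?HX // (le_trans X1).
Qed.

Lemma le_sublin f1 f2 : (forall x, 1 <= x -> `|f1 x| <= `|f2 x|) -> sublinear f2 -> sublinear f1.
Proof.
move=> E H e /H[X X1 HX]; exists X => // x Xx.
by apply: le_trans (HX x Xx); apply: E; exact: le_trans Xx.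
Qed.

Lemma sublin_const a : sublinear (fun=> a).
Proof.
move=> e e0; exists (1 + `|a| / e); first by rewrite lerDl divr_ge0 // ltW.
move=> x Xx; rewrite mulrC -ler_pdivrMr //; apply: le_trans Xx.
by rewrite lerDr.
Qed.

Lemma sublin_powR a : a < 1 -> sublinear (fun x => x `^ a).
Proof.
move=> a1 e e0; have d0 : 0 < 1 - a by rewrite subr_gt0.
exists (1 + e^-1 `^ (1 - a)^-1); first by rewrite lerDl powR_ge0.
move=> x Xx; have x1 : 1 <= x by apply: le_trans Xx; rewrite lerDl powR_ge0.
have x0 := ge1_gt0 x1; rewrite ger0_norm ?powR_ge0 //.
have h : e^-1 <= x `^ (1 - a).
  have : (e^-1 `^ (1 - a)^-1) `^ (1 - a) <= x `^ (1 - a).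
    rewrite ge0_ler_powR ?nnegrE ?powR_ge0 // ?ltW //.
    by apply: lt_le_trans Xx; rewrite ltrDr.
  by rewrite -powRrM mulVf ?lt0r_neq0 // powRr1 // invr_ge0 ltW.
rewrite mulrC -ler_pdivrMr //.
apply: le_trans (_ : x `^ a * x `^ (1 - a) <= _); first by rewrite ler_wpM2l ?powR_ge0.
rewrite -powRD ?lt0r_neq0 ?implybT //.
by rewrite [X in _ `^ X]addrC subrK powRr1 // ltW.
Qed.

Lemma sublin_scale f a : 1 <= a -> sublinear f -> sublinear (fun x => f (x / a)).
Proof.
move=> a1 Hf e e0; have [X X1 HX] := Hf e e0; have a0 := ge1_gt0 a1.
exists (X * a); first by rewrite mulr_ege1.
move=> x Xx; have xX : X <= x / a by rewrite ler_pdivlMr.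
apply: le_trans (HX _ xX) _; rewrite ler_wpM2l ?(ltW e0) //.
rewrite ler_pdivrMr // ler_peMr //.
by apply: le_trans Xx; rewrite mulr_ge0 ?(ltW a0) ?(ge1_ge0 X1).
Qed.

Lemma dom_sublin f a : a < 1 -> dominated f (fun x => x `^ a) -> sublinear f.
Proof.
move=> a1 [C C0 H]; have := sublinZ C (sublin_powR a1); apply: le_sublin => x x1.
rewrite [leRHS]ger0_norm ?mulr_ge0 ?powR_ge0 //; exact: H.
Qed.

Lemma sublin_mul_invln f : dominated f (fun x => x) -> sublinear (fun x => f x / ln x).
Proof.
move=> [C C0 H] e e0.
exists (expR (1 + C / e)); first by rewrite -expR0 ler_expR addr_ge0 // divr_ge0 // ltW.
move=> x Xx; have x1 : 1 <= x.
  by apply: le_trans Xx; rewrite -expR0 ler_expR addr_ge0 // divr_ge0 // ltW.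
have lx : 1 + C / e <= ln x by rewrite -(expRK (1 + C / e)) ler_ln ?posrE ?expR_gt0 ?ge1_gt0.
have l0 : 0 < ln x by apply: lt_le_trans lx; rewrite ltr_pwDl // divr_ge0 // ltW.
rewrite normrM normfV (gtr0_norm l0) ler_pdivrMr //.
apply: le_trans (H x x1) _; rewrite mulrAC ler_wpM2r ?ge1_ge0 //.
by rewrite mulrC -ler_pdivrMr //; apply: le_trans lx; rewrite lerDr.
Qed.

End Domination.

(** * Counting under Axiom A *)

(* Unlike in [axiomA], the bound holds from 1 on: enlarging [K] absorbs the bounded range. *)
Class axiom_A (R : realType) (P : countType) (N : P -> R) (c eta K : R) : Prop :=
  AxiomA {
    density_gt0 : 0 < c;
    exponent_gt0 : 0 < eta;
    exponent_lt1 : eta < 1;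
    error_ge0 : 0 <= K;
    count_approx : forall x, 1 <= x ->
      `|\sum_(g <- elts N x) 1 - c * x| <= K * x `^ eta }.

Section AxiomA.
Context {R : realType} {P : countType} {N : P -> R} {asgN : arith_semigroup N}.
Context {c eta K : R} {axA : axiom_A N c eta K}.
Local Notation nrm := (asg_norm N).
Local Notation elts := (elts N).
Local Notation dact := (dact (N := N)).
Local Notation one := (fun=> 1).
Implicit Types (x y s t A B : R) (g h d k : {mset P}) (p q : P).

Definition cnt x : R := \sum_(g <- elts x) 1.

Lemma cntE x : dact one one x = cnt x.
Proof. by apply: eq_bigr => g _; rewrite mulr1. Qed.

Lemma cnt_ge0 x : 0 <= cnt x. Proof. exact: sumr_ge0. Qed.

Lemma sum_elts_split (V : nmodType) x y (F : {mset P} -> V) : x <= y ->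
  \sum_(g <- elts y) F g = \sum_(g <- elts x) F g + \sum_(g <- elts y | x < nrm g) F g.
Proof.
move=> xy; rewrite (bigID (fun g => nrm g <= x)) /=; congr (_ + _).
  rewrite -[LHS]big_filter; apply: perm_big; apply: uniq_perm.
  - exact/filter_uniq/elts_uniq.
  - exact: elts_uniq.
  by move=> g; rewrite mem_filter !mem_elts; case: (leP (nrm g) x) => //= /le_trans ->.
by apply: eq_bigl => g; rewrite -ltNge.
Qed.

Lemma sum_elts_split_gt (V : nmodType) w x y (F : {mset P} -> V) : w <= x -> x <= y ->
  \sum_(g <- elts y | w < nrm g) F g =
  \sum_(g <- elts x | w < nrm g) F g + \sum_(g <- elts y | x < nrm g) F g.
Proof.
move=> wx xy; rewrite big_mkcond (sum_elts_split _ xy) -big_mkcond; congr (_ + _).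
rewrite -big_mkcondr; apply: eq_bigl => g.
by case: (ltP x (nrm g)) => //= /(le_lt_trans wx).
Qed.

Lemma le_sum_elts x y (F : {mset P} -> R) : x <= y -> (forall g, 0 <= F g) ->
  \sum_(g <- elts x) F g <= \sum_(g <- elts y) F g.
Proof. by move=> /sum_elts_split -> F0; rewrite lerDl sumr_ge0. Qed.

Lemma le_cnt x y : x <= y -> cnt x <= cnt y.
Proof. by move=> xy; apply: le_sum_elts. Qed.

Lemma cnt_le x : 0 <= x -> cnt x <= (c + K) * x.
Proof.
move=> x0; have C0 : 0 <= c + K by rewrite addr_ge0 ?error_ge0 // ltW // density_gt0.
have [x1|x1] := ltP x 1; first by rewrite /cnt elts_lt1 // big_nil mulr_ge0.
rewrite mulrDl -lerBlDl; apply: le_trans (ler_norm _) _.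
apply: le_trans (count_approx x1) _.
by rewrite ler_wpM2l ?error_ge0 // ler1_powR // ltW // exponent_lt1.
Qed.

Lemma cnt_ge1 x : 1 <= x -> 1 <= cnt x.
Proof.
move=> x1; rewrite /cnt (bigD1_seq mset0) ?elts_uniq ?mem_elts ?asg_norm0 //=.
by rewrite lerDl sumr_ge0.
Qed.

(** Beyond [X] the error in Axiom A is at most half the main term; below [X] the identity element
    alone gives 1 >= x/X. *)
Lemma cnt_ge : exists2 b, 0 < b & forall x, 1 <= x -> b * x <= cnt x.
Proof.
have c0 := density_gt0 (axiom_A := axA).
have [X X1 HX] := dom_sublin exponent_lt1
  (ex_intro2 _ _ K error_ge0 count_approx : dominated (fun x => cnt x - c * x) _) (divr_gt0 c0 (ltr0Sn _ 1)).
exists (Num.min (c / 2) X^-1) => [|x x1].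
  by rewrite lt_min invr_gt0 (ge1_gt0 X1) andbT divr_gt0.
have x0 := ge1_gt0 x1; have [xX|/ltW/HX] := leP x X.
  apply: le_trans (cnt_ge1 x1); apply: le_trans (_ : X^-1 * x <= _).
    by rewrite ler_wpM2r ?(ltW x0) // ge_min lexx ?orbT.
  by rewrite ler_pdivrMl ?mulr1 ?ge1_gt0.
rewrite ler_norml => /andP[+ _]; rewrite lerBrDl => H; apply: le_trans H.
apply: le_trans (_ : c / 2 * x <= _).
  by rewrite ler_wpM2r ?(ltW x0) // ge_min lexx.
by rewrite {2}(splitr c) mulrDl addrK.
Qed.

Lemma cnt_diff s t : 1 <= s -> s <= t ->
  `|cnt t - cnt s - c * (t - s)| <= 2 * K * t `^ eta.
Proof.
move=> s1 st; have t1 := le_trans s1 st.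
have -> : cnt t - cnt s - c * (t - s) = (cnt t - c * t) - (cnt s - c * s) by ring.
apply: le_trans (ler_normB _ _) _; rewrite mulrDl mul1r mulrDl.
apply: lerD; first exact: count_approx.
apply: le_trans (count_approx s1) _; rewrite ler_wpM2l ?error_ge0 //.
by rewrite ge0_ler_powR ?nnegrE ?(ltW exponent_gt0) // ge1_ge0.
Qed.

(* Splitting at x/2 gives T(x) <= 2^s T(x/2) + O(x), and 2^s < 2. *)
Lemma dom_sum_powR (s : R) : 0 <= s -> s < 1 ->
  dominated (dact one (fun y => y `^ s)) (fun x => x).
Proof.
move=> s0 s1; set T := dact _ _.
have C0 : 0 <= c + K by rewrite addr_ge0 ?error_ge0 // ltW // density_gt0.
have r0 : 0 < 1 - 2 `^ s / 2.
  by rewrite subr_gt0 ltr_pdivrMr // mul1r -{2}(@powRr1 _ 2) // ltr_powR // ltr1n.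
(* The fixed point of the recursion C = 2^s (C/2) + 2^s (c + K) that the splitting produces. *)
pose C := 2 `^ s * (c + K) / (1 - 2 `^ s / 2).
have C0' : 0 <= C by rewrite divr_ge0 ?mulr_ge0 ?powR_ge0 // ltW.
have CE : 2 `^ s * (C / 2) + 2 `^ s * (c + K) = C.
  by rewrite /C; field; rewrite gt_eqF //; move: r0; lra.
exists C => // x x1; rewrite ger0_norm; last first.
  by apply: dact_ge0 => // y _; exact: powR_ge0.
have := ge1_ge0 x1; move: x {x1}; apply: halving_ind => x.
  by move=> x1 x0; rewrite /T dact_lt1 // mulr_ge0.
move=> x1 IH x0; have h0 : 0 <= x / 2 by rewrite divr_ge0.
rewrite /T /dact (sum_elts_split _ (_ : x / 2 <= x)); last by move: x1; lra.
rewrite -CE mulrDl; apply: lerD.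
  have := ler_wpM2l (powR_ge0 2 s) (IH h0).
  have -> : 2 `^ s * (C * (x / 2)) = 2 `^ s * (C / 2) * x by ring.
  apply: le_trans; rewrite /T /dact mulr_sumr; apply: eq_ler.
  apply: eq_bigr => g _; rewrite !mul1r -powRM ?divr_ge0 ?asg_norm_ge0 //.
  by congr (_ `^ _); field; rewrite asg_norm_neq0.
apply: le_trans (_ : 2 `^ s * cnt x <= _); last first.
  by rewrite -mulrA ler_wpM2l ?powR_ge0 // cnt_le.
rewrite /cnt mulr_sumr [leRHS](sum_elts_split _ (_ : x / 2 <= x)); last by move: x1; lra.
rewrite ler_wpDl //; first by apply: sumr_ge0 => g _; rewrite mulr1 powR_ge0.
apply: ler_sum => g xg; rewrite mul1r mulr1 ge0_ler_powR ?nnegrE ?divr_ge0 ?asg_norm_ge0 //.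
by rewrite ler_pdivrMr ?asg_norm_gt0 // mulrC -ler_pdivrMr // ltW.
Qed.

Lemma dom_dact_powR (f : {mset P} -> R) Phi (s : R) : (forall g, `|f g| <= 1) -> 0 <= s -> s < 1 ->
  dominated Phi (fun x => x `^ s) -> dominated (dact f Phi) (fun x => x).
Proof.
move=> f1 s0 s1 [C C0 HC]; have [C' C'0 HC'] := dom_sum_powR s0 s1.
exists (C * C') => [|x x1]; first exact: mulr_ge0.
apply: le_trans (@ler_dact _ _ _ _ _ one _ (fun y => C * y `^ s) _ _ _) _ => //.
  by move=> y /andP[y1 _]; exact: HC.
rewrite dactZr -mulrA ler_wpM2l //; apply: le_trans (HC' x x1); exact: ler_norm.
Qed.

Lemma dom_dact_ln (f : {mset P} -> R) : (forall g, `|f g| <= 1) ->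
  dominated (dact f (@ln R)) (fun x => x).
Proof.
move=> f1; apply: (@dom_dact_powR _ _ 2^-1) => //; try lra.
apply: (@eq_dom _ (fun x => x `^ 0 * ln x)) => [x x1|]; first by rewrite powRr0 mul1r.
by apply: dom_powR_ln; lra.
Qed.

Definition harm x : R := \sum_(g <- elts x) (nrm g)^-1.

Lemma harm_ge0 x : 0 <= harm x.
Proof. by apply: sumr_ge0 => g _; rewrite invr_ge0 asg_norm_ge0. Qed.

Lemma le_harm x y : x <= y -> harm x <= harm y.
Proof. by move=> xy; apply: le_sum_elts => // g; rewrite invr_ge0 asg_norm_ge0. Qed.

Lemma dact_id (f : {mset P} -> R) x : dact f (fun y => y) x = x * \sum_(g <- elts x) f g / nrm g.
Proof. by rewrite mulr_sumr; apply: eq_bigr => g _; rewrite mulrCA. Qed.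

(** * Sums over norms compared with integrals *)

Section StieltjesSum.
Variables (A B eps : R) (f F : R -> R).
Hypotheses (A1 : 1 <= A)
  (f_noninc : forall s t, A <= s -> s <= t -> t <= B -> 0 <= f t /\ f t <= f s)
  (F_prim : forall s t, A <= s -> s <= t -> t <= B ->
     f t * (t - s) <= F t - F s /\ F t - F s <= f s * (t - s))
  (cnt_lin : forall t, A <= t -> t <= B -> `|cnt t - cnt A - c * (t - A)| <= eps).

Let V t := \sum_(g <- elts t | A < nrm g) f (nrm g) - c * (F t - F A).
Let U t := cnt t - cnt A - c * (t - A).
Let inv t := (V t - f t * U t + (c + eps) * f t <= (c + eps) * f A) /\
  (- ((c + eps) * f A) <= V t - f t * U t - (c + eps) * f t).

(* [inv] is what Abel summation along a partition of mesh at most 1 preserves. *)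
Let inv_step s t : A <= s -> s <= t -> t <= s + 1 -> t <= B -> inv s -> inv t.
Proof.
move=> As st ts tB [h1 h2].
have sB := le_trans st tB; have At := le_trans As st.
have [ft0 fts] := f_noninc As st tB.
have [F1 F2] := F_prim As st tB.
have US := cnt_lin As sB; have UT := cnt_lin At tB.
have c0 := density_gt0 (axiom_A := axA).
set dV := \sum_(g <- elts t | s < nrm g) f (nrm g).
have VE : V t = V s + dV - c * (F t - F s).
  rewrite /V (sum_elts_split_gt _ As st) -/dV; ring.
have dN : cnt t - cnt s = \sum_(g <- elts t | s < nrm g) 1.
  by rewrite /cnt (sum_elts_split _ st) addrAC subrr add0r.
have dU : U t - U s = (cnt t - cnt s) - c * (t - s) by rewrite /U; ring.
have bnd g : (g \in elts t) && (s < nrm g) -> f t <= f (nrm g) <= f s.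
  rewrite mem_elts => /andP[gt sg]; have := f_noninc (le_trans As (ltW sg)) gt tB.
  have := f_noninc As (ltW sg) (le_trans gt tB).
  by case=> _ -> [_ ->].
have d1 : dV <= f s * (cnt t - cnt s).
  rewrite dN mulr_sumr /dV big_seq_cond [leRHS]big_seq_cond; apply: ler_sum => g /bnd.
  by rewrite mulr1 => /andP[].
have d2 : f t * (cnt t - cnt s) <= dV.
  rewrite dN mulr_sumr /dV big_seq_cond [leRHS]big_seq_cond; apply: ler_sum => g /bnd.
  by rewrite mulr1 => /andP[].
have ts1 : (f s - f t) * (t - s) <= f s - f t.
  by rewrite ler_piMr ?subr_ge0 // lerBlDl.
have ts1c : c * ((f s - f t) * (t - s)) <= c * (f s - f t) by rewrite ler_wpM2l ?(ltW c0).
have cF1 : c * (f t * (t - s)) <= c * (F t - F s) by rewrite ler_wpM2l ?(ltW c0).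
have cF2 : c * (F t - F s) <= c * (f s * (t - s)) by rewrite ler_wpM2l ?(ltW c0).
move: US UT; rewrite !ler_norml => /andP[US1 US2] /andP[UT1 UT2].
have fU1 : (f s - f t) * U t <= (f s - f t) * eps by rewrite ler_wpM2l ?subr_ge0.
have fU2 : (f s - f t) * - eps <= (f s - f t) * U s by rewrite ler_wpM2l ?subr_ge0.
have {}dN : cnt t - cnt s = U t - U s + c * (t - s) by rewrite dU; ring.
rewrite dN in d1 d2; clear dN dU bnd.
move: h1 h2; rewrite /inv VE {VE}; clearbody dV.
move: (U t) (U s) (V s) (F t) (F s) (f t) (f s) (f A) dV d1 d2 ts1c cF1 cF2 fU1 fU2.
move=> ut us vs Ft Fs f1 f2 f3 dV d1 d2 ts1c cF1 cF2 fU1 fU2 h1 h2.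
split; rewrite ?(mulrBl,mulrBr,mulrDl,mulrDr,mulrN,mulNr) in d1 d2 ts1c cF1 cF2 fU1 fU2 h1 h2 *; lra.
Qed.

(** The comparison is with c times the integral of [f]; the primitive [F] enters only through bounds
    on its increments. A step of length at most 1 costs c (f s - f t), which telescopes to at most c
    f(A); the term with [eps] is the usual error of Abel summation. *)
Lemma stieltjes_sum : A <= B ->
  `|\sum_(g <- elts B | A < nrm g) f (nrm g) - c * (F B - F A)| <= (c + eps) * f A.
Proof.
move=> AB; have invA : inv A.
  rewrite /inv /V /U big1_seq; last first.
    by move=> g /andP[Ag]; rewrite mem_elts leNgt Ag.
  by rewrite !(subrr, mulr0); split; [rewrite add0r|rewrite sub0r].
suff [n1 n2] : inv B.
  have [fB _] := f_noninc AB (lexx B) (lexx B).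
  have := cnt_lin AB (lexx B); rewrite ler_norml => /andP[u1 u2].
  have c0 := density_gt0 (axiom_A := axA).
  have m1 : f B * U B <= f B * (c + eps) by rewrite ler_wpM2l // (le_trans u2) // lerDr ltW.
  have m2 : f B * - (c + eps) <= f B * U B.
    by rewrite ler_wpM2l // (le_trans _ u1) // lerN2 lerDr ltW.
  rewrite ler_norml -/(V B); apply/andP; split; lra.
have [n Bn] : exists n : nat, B <= A + n%:R.
  exists (Num.trunc B).+1; apply: ltW; apply: lt_le_trans (truncnS_gt B) _.
  by rewrite lerDr ge1_ge0.
have main : forall m t, A <= t -> t <= B -> t <= A + m%:R -> inv t.
  elim=> [|m IH] t At tB.
    by rewrite addr0 => tA; rewrite (_ : t = A) //; apply/eqP; rewrite eq_le tA.
  move=> tm; have [tA1|tA1] := leP t (A + 1).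
    exact: (inv_step (lexx A)).
  apply: (@inv_step (t - 1)) => //; try lra.
  by apply: IH; [lra|lra|rewrite -natr1 in tm; lra].
exact: main AB (lexx B) Bn.
Qed.

End StieltjesSum.

End AxiomA.
#[global] Arguments cnt {R P} N x.
#[global] Arguments harm {R P} N x.

(** * Harmonic sums and the divisor function *)

Section Asymptotics.
Context {R : realType} {P : countType} {N : P -> R} {asgN : arith_semigroup N}.
Context {c eta K : R} {axA : axiom_A N c eta K}.
Local Notation nrm := (asg_norm N).
Local Notation elts := (elts N).
Local Notation dact := (dact (N := N)).
Local Notation cnt := (cnt N).
Local Notation harm := (harm N).
Local Notation one := (fun=> 1).
Implicit Types (x y s t A B : R) (g h d k : {mset P}) (p q : P).

Let c0 : 0 < c. Proof. exact: density_gt0. Qed.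
Let K0 : 0 <= K. Proof. exact: error_ge0. Qed.
Let eta0 : 0 < eta. Proof. exact: exponent_gt0. Qed.
Let eta1 : eta < 1. Proof. exact: exponent_lt1. Qed.

Lemma harm_diff_short A B : 1 <= A -> A <= B -> B <= 2 * A ->
  `|harm B - harm A - c * ln (B / A)| <= (c + 4 * K) * A `^ (eta - 1).
Proof.
move=> A1 AB B2A; have A0 := ge1_gt0 A1; have B0 := lt_le_trans A0 AB.
have -> : harm B - harm A = \sum_(g <- elts B | A < nrm g) (nrm g)^-1.
  by rewrite /harm (sum_elts_split _ AB) addrAC subrr add0r.
rewrite ln_div ?posrE //.
(* The error is 2 K t^eta by [cnt_diff], and t <= B <= 2 A costs another factor 2^eta <= 2. *)
apply: le_trans (@stieltjes_sum _ _ _ _ c eta K _ A B (4 * K * A `^ eta) GRing.inv (@ln R) A1 _ _ _ AB) _.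
- move=> s t As st tB; have s0 := lt_le_trans A0 As; have t0 := lt_le_trans s0 st.
  by rewrite invr_ge0 ltW // lef_pV2.
- move=> s t As st tB; have s0 := lt_le_trans A0 As; have t0 := lt_le_trans s0 st.
  rewrite -ln_div ?posrE //; split.
    have := lnB1 (divr_gt0 s0 t0); rewrite !ln_div ?posrE // => h.
    have -> : t^-1 * (t - s) = 1 - s / t by field; rewrite gt_eqF.
    by move: h; lra.
  apply: le_trans (lnB1 (divr_gt0 t0 s0)) _.
  by rewrite mulrBr mulVf ?gt_eqF // mulrC.
- move=> t At tB; apply: le_trans (cnt_diff A1 At) _.
  have -> : 4 * K * A `^ eta = 2 * K * (2 * A `^ eta) by ring.
  rewrite ler_wpM2l ?mulr_ge0 //; apply: le_trans (_ : (2 * A) `^ eta <= _).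
    by rewrite ge0_ler_powR ?nnegrE ?(ltW eta0) ?mulr_ge0 ?(ltW A0) ?(le_trans tB) ?(le_trans (ltW A0) At).
  rewrite powRM ?(ltW A0) // ler_wpM2r ?powR_ge0 //.
  by rewrite ler1_powR ?(ltW eta1) // ler1n.
rewrite powRD ?(gt_eqF A0) ?implybT // powR_inv1 ?(ltW A0) // mulrA ler_wpM2r ?invr_ge0 ?(ltW A0) //.
rewrite [leRHS]mulrDl lerD2r -{1}[c]mulr1 ler_wpM2l ?(ltW c0) //.
exact: powR_ge1 (ltW eta0) A1.
Qed.

(** Double [A] until [B] is reached: the errors form a geometric series of ratio 2^(eta - 1) < 1,
    and [C] comes from its sum. *)
Lemma harm_diff : exists2 C, 0 <= C & forall A B, 1 <= A -> A <= B ->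
  `|harm B - harm A - c * ln (B / A)| <= C * A `^ (eta - 1).
Proof.
pose r := 2 `^ (eta - 1).
have r1 : r < 1.
  by rewrite /r -[ltRHS](powRr0 2) ltr_powR ?ltr1n // subr_lt0.
pose C := (c + 4 * K) / (1 - r).
have C0 : 0 <= C by rewrite divr_ge0 ?subr_ge0 ?(ltW r1) // addr_ge0 ?mulr_ge0 // ltW.
have CE : c + 4 * K + C * r = C by rewrite /C; field; rewrite gt_eqF // subr_gt0.
exists C => // A B A1 AB.
have [n] : exists n : nat, B <= 2 ^+ n * A.
  exists (Num.trunc B).+1; apply: ltW; apply: lt_le_trans (truncnS_gt B) _.
  rewrite -[leLHS]mulr1 ler_pM // -natrX ler_nat ltnW // ltn_expl //.
elim: n A A1 AB => [|n IH] A A1 AB.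
  rewrite expr0 mul1r => BA; have -> : B = A by apply/eqP; rewrite eq_le BA.
  by rewrite divff ?gt_eqF ?ge1_gt0 // ln1 mulr0 !subrr normr0 mulr_ge0 // powR_ge0.
move=> Bn; have A0 := ge1_gt0 A1.
have [B2A|B2A] := leP B (2 * A).
  apply: le_trans (harm_diff_short A1 AB B2A) _.
  by rewrite ler_wpM2r ?powR_ge0 // -[leRHS]CE lerDl mulr_ge0 // powR_ge0.
have A21 : 1 <= 2 * A by lra.
have h1 := IH (2 * A) A21 (ltW B2A) _.
have {}h1 : `|harm B - harm (2 * A) - c * ln (B / (2 * A))| <= C * (2 * A) `^ (eta - 1).
  by apply: h1; rewrite mulrA -exprSr.
have h2 := harm_diff_short A1 (_ : A <= 2 * A) (lexx _).
have {}h2 := h2 ltac:(lra).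
have -> : harm B - harm A - c * ln (B / A) = (harm B - harm (2 * A) - c * ln (B / (2 * A)))
    + (harm (2 * A) - harm A - c * ln (2 * A / A)).
  have B0 := lt_le_trans A0 AB; have A20 : 0 < 2 * A by rewrite mulr_gt0.
  by rewrite !ln_div ?posrE //; ring.
apply: le_trans (ler_normD _ _) _.
rewrite powRM ?(ltW A0) // in h1.
apply: le_trans (lerD h1 h2) _.
by rewrite -/r mulrA -mulrDl ler_wpM2r ?powR_ge0 // addrC CE.
Qed.

(** [gam] is the analogue of Euler's constant. With G = harm - c ln, the intervals of centre G(A)
    and radius C A^(eta - 1) meet pairwise by [harm_diff], so the supremum of their left ends lies
    in all of them. *)
Lemma harm_asymp : exists gam, exists2 C, 0 <= C & forall x, 1 <= x ->
  `|harm x - c * ln x - gam| <= C * x `^ (eta - 1).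
Proof.
have [C C0 HC] := harm_diff; pose G x := harm x - c * ln x.
have GE A B : 1 <= A -> 1 <= B -> G A - C * A `^ (eta - 1) <= G B + C * B `^ (eta - 1).
  have aux A' B' : 1 <= A' -> A' <= B' -> `|G B' - G A'| <= C * A' `^ (eta - 1).
    move=> A1 AB; have := HC _ _ A1 AB.
    rewrite ln_div ?posrE ?ge1_gt0 ?(le_trans A1) // /G.
    by apply: le_trans; apply: eq_ler; congr `|_|; ring.
  move=> A1 B1; have [AB|/ltW BA] := leP A B.
    have := aux _ _ A1 AB; rewrite ler_norml => /andP[h _].
    have : 0 <= C * B `^ (eta - 1) by rewrite mulr_ge0 ?powR_ge0.
    lra.
  have := aux _ _ B1 BA; rewrite ler_norml => /andP[_ h].
  have : 0 <= C * A `^ (eta - 1) by rewrite mulr_ge0 ?powR_ge0.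
  lra.
pose E := [set G A - C * A `^ (eta - 1) | A in [set A | 1 <= A]]%classic.
have E0 : (E !=set0)%classic by exists (G 1 - C * 1 `^ (eta - 1)); exists 1 => //=.
have ubE x : 1 <= x -> (ubound E (G x + C * x `^ (eta - 1)))%classic.
  by move=> x1 _ [A A1 <-]; exact: GE.
have hE : has_sup E by split=> //; exists (G 1 + C * 1 `^ (eta - 1)); exact: ubE.
exists (sup E); exists C => // x x1; rewrite -/(G x) ler_norml; apply/andP; split.
  by have := ge_sup E0 (ubE x x1); lra.
have : E (G x - C * x `^ (eta - 1)) by exists x.
move=> /(ub_le_sup hE.2); lra.
Qed.

Lemma harm_le : exists2 C, 0 <= C & forall x, 1 <= x -> harm x <= C * (1 + ln x).
Proof.
have [g [C C0 H]] := harm_asymp.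
exists (C + `|g| + c); first by rewrite !addr_ge0 // ltW.
move=> x x1; have := H x x1; rewrite ler_norml => /andP[_ h].
have : x `^ (eta - 1) <= 1 by rewrite -[leRHS](powRr0 x) ler_powR // subr_le0 ltW.
have := ln_ge0 x1; have := ler_norm g; set l := ln x in h *; set e := _ `^ _ in h *.
move=> g1 l0 e1; have : C * e <= C by rewrite -[leRHS]mulr1 ler_wpM2l.
have : 0 <= (C + `|g|) * l by rewrite mulr_ge0 ?addr_ge0.
have := ltW c0; rewrite !mulrDr !mulrDl !mulr1; lra.
Qed.

Lemma dom_sum_ln s : eta < s ->
  dominated (fun x => dact one (@ln R) x - c * x) (fun x => x `^ s).
Proof.
move=> es; have s0 : 0 < s by exact: lt_trans es.
pose D := (c + K) + c + c + (c + 2 * K).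
have D0 : 0 <= D by rewrite /D !addr_ge0 ?mulr_ge0 // ltW.
have key : dominated (fun x => dact one (@ln R) x - c * x) (fun x => 1 + ln x + x `^ eta * ln x).
  exists D => // x x1; have x0 := ge1_gt0 x1.
  (* t ln (x/t) + t is a primitive of ln (x/t). This covers the norms beyond 1; [elts 1] is treated
     separately below. *)
  have st := @stieltjes_sum _ _ _ _ c eta K _ 1 x (2 * K * x `^ eta) (fun t => ln (x / t))
     (fun t => t * ln (x / t) + t) (lexx 1) _ _ _ x1.
  have {}st := st _ _ _.
  rewrite /dact (sum_elts_split _ x1).
  set S2 := \sum_(g <- elts x | 1 < nrm g) 1 * ln (x / nrm g).
  have S2E : S2 = \sum_(g <- elts x | 1 < nrm g) ln (x / nrm g).
    by apply: eq_bigr => g _; rewrite mul1r.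
  have : `|S2 - c * ((x * ln (x / x) + x) - (1 * ln (x / 1) + 1))| <= (c + 2 * K * x `^ eta) * ln (x / 1).
    rewrite S2E; apply: st.
    - move=> s' t' s1 st' tx; have s'0 := ge1_gt0 s1; have t'0 := lt_le_trans s'0 st'.
      split; first by rewrite ln_ge0 // ler_pdivlMr // mul1r.
      by rewrite ler_ln ?posrE ?divr_gt0 // ler_wpM2l ?(ltW x0) // lef_pV2.
    - move=> s' t' s1 st' tx; have s'0 := ge1_gt0 s1; have t'0 := lt_le_trans s'0 st'.
      have := lnB1 (divr_gt0 s'0 t'0); have := lnB1 (divr_gt0 t'0 s'0).
      rewrite !ln_div ?posrE //.
      move: (ln x) (ln s') (ln t') => lx ls lt h1 h2.
      have {}h1 : s' * (lt - ls) <= t' - s'.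
        have := ler_wpM2l (ltW s'0) h1; congr (_ <= _); field; by rewrite gt_eqF.
      have {}h2 : t' * (ls - lt) <= s' - t'.
        have := ler_wpM2l (ltW t'0) h2; congr (_ <= _); field; by rewrite gt_eqF.
      by rewrite !(mulrBr, mulrBl) in h1 h2 *; split; lra.
    - move=> t' t1 tx; apply: le_trans (cnt_diff (lexx 1) t1) _.
      rewrite ler_wpM2l ?mulr_ge0 //.
      by rewrite ge0_ler_powR ?nnegrE ?(ltW eta0) ?(ltW x0) // (le_trans ler01).
  rewrite divff ?gt_eqF // ln1 mulr0 add0r divr1 mul1r.
  have -> : \sum_(g <- elts 1) 1 * ln (x / nrm g) = cnt 1 * ln x.
    rewrite /cnt mulr_suml big_seq [RHS]big_seq; apply: eq_bigr => g.
    rewrite mem_elts => g1; have -> : nrm g = 1 by apply/eqP; rewrite eq_le g1 asg_norm_ge1.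
    by rewrite divr1.
  move=> hS2; have lx0 := ln_ge0 x1.
  have cl : cnt 1 * ln x <= (c + K) * ln x.
    by rewrite ler_wpM2r // (le_trans (cnt_le ler01)) ?mulr1.
  have cl0 : 0 <= cnt 1 * ln x by rewrite mulr_ge0 // cnt_ge0.
  have xe1 : 0 <= x `^ eta * ln x by rewrite mulr_ge0 // powR_ge0.
  move: hS2 cl cl0 xe1; rewrite /D ler_norml => /andP[].
  move: (cnt 1 * ln x) (ln x) lx0 (x `^ eta) => a l l0 e.
  rewrite !(mulrDl, mulrDr, mulrBl, mulrBr, mulr1, mulrA) ler_norml => h1 h2 h3 h4 h5.
  have k1 : 0 <= c * l by rewrite mulr_ge0 // ltW.
  have k2 : 0 <= K * l by rewrite mulr_ge0.
  have k3 : 0 <= c * (e * l) by rewrite mulr_ge0 // ltW.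
  have k4 : 0 <= K * (e * l) by rewrite mulr_ge0.
  rewrite mulrA in k3; rewrite mulrA in k4; have := ltW c0; have := K0; move=> ? ?; apply/andP; split; lra.
apply: dom_trans key _ => [x x1|]; first by rewrite !addr_ge0 ?mulr_ge0 ?powR_ge0 ?ln_ge0.
apply: domD; last exact: dom_powR_ln.
apply: domD.
  by apply: (@eq_dom _ (fun x => x `^ 0)) => [x _|]; [rewrite powRr0|exact/dom_powR/ltW].
apply: (@eq_dom _ (fun x => x `^ 0 * ln x)) => [x _|]; first by rewrite powRr0 mul1r.
exact: dom_powR_ln.
Qed.

Lemma ln_cnt x : 0 < x -> ln x * cnt x = dact (logn_norm (N := N)) one x + dact one (@ln R) x.
Proof.
move=> x0; rewrite -cntE (ln_dact _ _ x0); congr (_ + _); apply: eq_bigr => g _.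
  by rewrite mul1r.
by rewrite mulr1.
Qed.

Lemma dom_sum_logn_norm s : eta < s ->
  dominated (fun x => dact (logn_norm (N := N)) one x - c * x * ln x + c * x) (fun x => x `^ s).
Proof.
move=> es; have h1 := dom_sum_ln es; have h2 := dom_powR_ln es.
have h3 : dominated (fun x => (cnt x - c * x) * ln x) (fun x => x `^ s).
  apply: dom_trans h2 => [x x1|]; first by rewrite mulr_ge0 ?powR_ge0 ?ln_ge0.
  exists K => // x x1; rewrite normrM (ger0_norm (ln_ge0 x1)) mulrA ler_wpM2r ?ln_ge0 //.
  exact: count_approx.
apply: eq_dom (domB h3 h1) => x x1.
have -> : dact (logn_norm (N := N)) one x = ln x * cnt x - dact one (@ln R) x.
  by rewrite (ln_cnt (ge1_gt0 x1)) addrK.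
ring.
Qed.

(** The summatory function of the divisor function: the number of pairs with |h| |k| <= x. *)
Definition sum_cnt x : R := \sum_(h <- elts x) cnt (x / nrm h).

(** With z the square root of x, a pair with |h| > z has |k| < z and is counted through k. Doing
    this on both sides counts the square |h|, |k| <= z twice. *)
Lemma hyperbola x : 1 <= x ->
  sum_cnt x = 2 * (\sum_(h <- elts (Num.sqrt x)) cnt (x / nrm h)) - cnt (Num.sqrt x) ^+ 2.
Proof.
move=> x1; set z := Num.sqrt x; have x0 := ge1_ge0 x1.
have zz : z * z = x by rewrite -expr2 sqr_sqrtr.
have z1 : 1 <= z by rewrite -(@sqrtr1 R) ler_wsqrtr.
have zx : z <= x by rewrite -zz ler_peMr // ge1_ge0.
rewrite /sum_cnt (sum_elts_split _ zx).
suff -> : \sum_(h <- elts x | z < nrm h) cnt (x / nrm h) =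
    \sum_(h <- elts z) (cnt (x / nrm h) - cnt z).
  rewrite sumrB.
  have -> : \sum_(i <- elts z) cnt z = cnt z ^+ 2.
    by rewrite expr2 /cnt mulr_suml; apply: eq_bigr => g _; rewrite mul1r.
  ring.
pose F h k : R := (z < nrm h)%R%:R.
transitivity (\sum_(h <- elts x) \sum_(k <- elts (x / nrm h)) F h k).
  rewrite big_mkcond; apply: eq_bigr => h _; rewrite /F.
  by case: ltP => _ /=; [|rewrite big1].
rewrite sum_pairsC (sum_elts_split _ zx) [X in _ + X]big1 ?addr0 => [|k zk].
  rewrite big_seq [RHS]big_seq; apply: eq_bigr => k; rewrite mem_elts => kz.
  have zk : z <= x / nrm k.
    by rewrite ler_pdivlMr ?asg_norm_gt0 // -zz ler_wpM2l // ge1_ge0.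
  have -> : cnt (x / nrm k) = cnt z + \sum_(h <- elts (x / nrm k) | z < nrm h) 1.
    exact: sum_elts_split.
  rewrite addrAC subrr add0r [RHS]big_mkcond.
  by apply: eq_bigr => h _; rewrite /F; case: ltP.
rewrite big_seq big1 // => h; rewrite mem_elts /F => hk.
rewrite ltNge (_ : nrm h <= z) //; apply: le_trans hk _.
by rewrite ler_pdivrMr ?asg_norm_gt0 // -zz ler_wpM2l ?ge1_ge0 // ltW.
Qed.

(** At z = sqrt x, [hyperbola] and [harm_asymp] give 2 c x (c ln z + gam) - c^2 z^2; every error is
    O(z z^eta), whence the exponent (1 + eta)/2. *)
Lemma dom_sum_cnt : exists b, dominated
  (fun x => sum_cnt x - c ^+ 2 * x * ln x - b * x) (fun x => x `^ ((1 + eta) / 2)).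
Proof.
have [gam [C C0 HC]] := harm_asymp.
have [C' C'0 HC'] := @dom_sum_powR _ _ _ _ c eta K _ eta (ltW eta0) eta1.
exists (2 * c * gam - c ^+ 2), (2 * K * C' + 2 * c * C + (2 * c + K) * K).
  by rewrite !addr_ge0 ?mulr_ge0 ?addr_ge0 ?mulr_ge0 // ltW.
move=> x x1; set z := Num.sqrt x; have x0 := ge1_gt0 x1.
have zz : x = z * z by rewrite -expr2 sqr_sqrtr ?(ltW x0).
have z1 : 1 <= z by rewrite -(@sqrtr1 R) ler_wsqrtr.
have z0 := ge1_gt0 z1.
have -> : x `^ ((1 + eta) / 2) = z * z `^ eta.
  rewrite -{1}(powRr1 (ltW z0)) -powRD ?(gt_eqF z0) ?implybT //.
  by rewrite /z -powR12_sqrt ?(ltW x0) // -powRrM mulrC.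
have lnx : ln x = 2 * ln z by rewrite {1}zz lnM ?posrE //; ring.
rewrite hyperbola // -/z.
set Sg := \sum_(h <- elts z) _.
have h1 : `|Sg - c * x * harm z| <= K * C' * (z * z `^ eta).
  rewrite /Sg /harm mulr_sumr -sumrB; apply: le_trans (ler_norm_sum _ _ _) _.
  apply: le_trans (_ : \sum_(h <- elts z) K * z `^ eta * (z / nrm h) `^ eta <= _).
    rewrite big_seq [leRHS]big_seq; apply: ler_sum => h; rewrite mem_elts => hz.
    have zh : 1 <= z / nrm h by rewrite ler_pdivlMr ?asg_norm_gt0 // mul1r.
    have xh : 1 <= x / nrm h by rewrite zz -mulrA mulr_ege1.
    rewrite -mulrA; apply: le_trans (count_approx xh) _.
    by rewrite -mulrA ler_wpM2l // zz -mulrA powRM ?(ltW z0) ?(le_trans ler01 zh).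
  rewrite -mulr_sumr -!mulrA ler_wpM2l // [leRHS]mulrA [leRHS]mulrC.
  rewrite ler_wpM2l ?powR_ge0 //.
  have := HC' z z1; rewrite ger0_norm; last by apply: dact_ge0 => // y _; exact: powR_ge0.
  apply: le_trans; apply: eq_ler.
  by apply: eq_bigr => g _; rewrite mul1r.
have h2 : `|c * x * (harm z - c * ln z - gam)| <= c * C * (z * z `^ eta).
  rewrite normrM ger0_norm ?mulr_ge0 ?(ltW c0) ?(ltW x0) //.
  apply: le_trans (ler_wpM2l _ (HC z z1)) _; first by rewrite mulr_ge0 ?(ltW c0) ?(ltW x0).
  apply: eq_ler.
  rewrite powRD ?(gt_eqF z0) ?implybT // powR_inv1 ?(ltW z0) // zz.
  by field; rewrite gt_eqF.
have h3 : `|cnt z ^+ 2 - (c * z) ^+ 2| <= (2 * c + K) * K * (z * z `^ eta).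
  rewrite subr_sqr normrM mulrC [leRHS](_ : _ = ((2 * c + K) * z) * (K * z `^ eta)); last by ring.
  rewrite ler_pM // ; last exact: count_approx.
  have cz : 0 <= c * z by rewrite mulr_ge0 ?(ltW c0) ?(ltW z0).
  rewrite ger0_norm ?addr_ge0 ?cnt_ge0 //.
  apply: le_trans (lerD (cnt_le (ltW z0)) (lexx (c * z))) _.
  by apply: eq_ler; ring.
move: h1 h2 h3; rewrite lnx; move: (harm z) (ln z) (cnt z) Sg (z `^ eta) => H l n Sg e.
have -> : c * x = c * (z * z) by rewrite -zz.
have -> : (2 * c * gam - c ^+ 2) * x = (2 * c * gam - c ^+ 2) * (z * z) by rewrite -zz.
have -> : c ^+ 2 * x = c ^+ 2 * (z * z) by rewrite -zz.
move=> h1 h2 h3.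
have -> : 2 * Sg - n ^+ 2 - c ^+ 2 * (z * z) * (2 * l) - (2 * c * gam - c ^+ 2) * (z * z) =
  2 * (Sg - c * (z * z) * H) + 2 * (c * (z * z) * (H - c * l - gam)) - (n ^+ 2 - (c * z) ^+ 2) by ring.
apply: le_trans (ler_normB _ _) _; rewrite [leRHS]mulrDl; apply: lerD => //.
apply: le_trans (ler_normD _ _) _; rewrite [leRHS]mulrDl; apply: lerD => //.
  rewrite normrM ger0_norm //; apply: le_trans (ler_wpM2l (ler0n _ 2) h1) _.
  by apply: eq_ler; ring.
rewrite normrM ger0_norm //; apply: le_trans (ler_wpM2l (ler0n _ 2) h2) _.
by apply: eq_ler; ring.
Qed.

End Asymptotics.

(** * Abel summation *)

Section AbelSummation.
Context {R : realType} {P : countType} {N : P -> R} {asgN : arith_semigroup N}.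
Local Notation nrm := (asg_norm N).
Local Notation elts := (elts N).
Implicit Types (x y s t A B : R) (g h d k : {mset P}).

Lemma exists_max_seq (T : eqType) (l : seq T) (phi : T -> R) : l != [::] ->
  exists2 m, m \in l & {in l, forall a, phi a <= phi m}.
Proof.
elim: l => // a l IH _; case: l IH => [_|b l /(_ isT)[m ml mP]].
  by exists a => [|g]; rewrite mem_seq1 // => /eqP ->.
have [am|ma] := leP (phi a) (phi m).
  by exists m => [|g]; rewrite in_cons ?ml ?orbT // => /orP[/eqP ->//|/mP].
exists a; first exact: mem_head.
by move=> g; rewrite in_cons => /orP[/eqP ->//|/mP/le_trans]; apply; exact: ltW.
Qed.

Variables (f : {mset P} -> R) (w E : R -> R) (x : R).
Let F t := \sum_(g <- elts t) f g.
Let D t := \sum_(g <- elts t) f g * w (nrm g) - F t * w t.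
Hypothesis F_w : forall s t, 1 <= s -> s <= t -> t <= x ->
  `|F s * (w s - w t)| <= E t - E s.

Let abel_step s t : s <= t -> (forall g, s < nrm g -> nrm g <= t -> nrm g = t) ->
  D t = D s + F s * (w s - w t).
Proof.
move=> st H; rewrite /D /F !(sum_elts_split _ st).
rewrite (_ : \sum_(g <- elts t | s < nrm g) f g * w (nrm g) =
    (\sum_(g <- elts t | s < nrm g) f g) * w t); first by ring.
rewrite mulr_suml big_seq_cond [RHS]big_seq_cond; apply: eq_bigr => g.
by rewrite mem_elts => /andP[gt sg]; rewrite (H g).
Qed.

Let abel_induction n t : 1 <= t -> t <= x -> (size (elts t) <= n)%N -> `|D t| <= E t - E 1.
Proof.
elim: n t => [|n IH] t t1 tx.
  rewrite leqn0 size_eq0 => /eqP te.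
  by have : mset0 \in elts t; [rewrite mem_elts asg_norm0|rewrite te].
move=> tn; have e_t : mset0 \in elts t by rewrite mem_elts asg_norm0.
(* Move from [t] to the largest norm not exceeding it, then to the next smaller norm, which has
   fewer elements below it. *)
have [|g0 g0t g0P] := @exists_max_seq _ (elts t) nrm; first by case: (elts t) e_t.
have g01 : 1 <= nrm g0 by exact: asg_norm_ge1.
have g0_t : nrm g0 <= t by rewrite -mem_elts.
have DtE : D t = D (nrm g0) + F (nrm g0) * (w (nrm g0) - w t).
  apply: abel_step => // g g0g gt.
  by have := g0P g; rewrite mem_elts gt => /(_ isT); rewrite leNgt g0g.
rewrite DtE; apply: le_trans (ler_normD _ _) _.
have := F_w g01 g0_t tx.
suff : `|D (nrm g0)| <= E (nrm g0) - E 1 by lra.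
have [g0e|g0n] := eqVneq (nrm g0) 1.
  rewrite g0e subrr normr_le0 /D /F mulr_suml subr_eq0; apply/eqP.
  rewrite big_seq [RHS]big_seq; apply: eq_bigr => g; rewrite mem_elts => g1.
  by have -> : nrm g = 1 by apply/eqP; rewrite eq_le g1 asg_norm_ge1.
have g0gt : 1 < nrm g0 by rewrite lt_neqAle eq_sym g0n.
pose l := [seq g <- elts t | nrm g < nrm g0].
have e_l : mset0 \in l by rewrite mem_filter e_t asg_norm0 g0gt.
have [|s sl sP] := @exists_max_seq _ l nrm; first by case: l e_l.
move: (sl); rewrite mem_filter mem_elts => /andP[sg0 s_t].
have s1 : 1 <= nrm s by exact: asg_norm_ge1.
have -> : D (nrm g0) = D (nrm s) + F (nrm s) * (w (nrm s) - w (nrm g0)).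
  apply: abel_step => [|g sg gg0]; first exact: ltW.
  have [|gg0'] := eqVneq (nrm g) (nrm g0) => //.
  have : g \in l by rewrite mem_filter lt_neqAle gg0' gg0 mem_elts (le_trans gg0).
  by move/sP; rewrite leNgt sg.
apply: le_trans (ler_normD _ _) _.
have := F_w s1 (ltW sg0) (le_trans g0_t tx).
suff : `|D (nrm s)| <= E (nrm s) - E 1 by lra.
apply: IH => //; first exact: le_trans s_t tx.
rewrite -ltnS; apply: leq_trans tn.
have sub : {subset g0 :: elts (nrm s) <= elts t}.
  move=> g; rewrite in_cons => /orP[/eqP ->//|]; rewrite !mem_elts => gs.
  exact: le_trans gs s_t.
have := @uniq_leq_size _ (g0 :: elts (nrm s)) (elts t).
by rewrite /= elts_uniq mem_elts -ltNge sg0 /= => /(_ isT sub).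
Qed.

(** [E] majorizes the integral of |F| |dw|. Between consecutive norms [D] changes only through the
    variation of [w], so induction over the finitely many elements up to [x] replaces
    integration. *)
Lemma abel : 1 <= x ->
  `|\sum_(g <- elts x) f g * w (nrm g) - F x * w x| <= E x - E 1.
Proof. by move=> x1; exact: (@abel_induction (size (elts x))). Qed.

End AbelSummation.

Section AbelCorollaries.
Context {R : realType} {P : countType} {N : P -> R} {asgN : arith_semigroup N}.
Local Notation nrm := (asg_norm N).
Local Notation elts := (elts N).
Local Notation cnt := (cnt N).
Local Notation harm := (harm N).
Implicit Types (x y s t A B : R) (g h d k : {mset P}).

Lemma abel_mono (f : {mset P} -> R) (w : R -> R) x B : 1 <= x ->
  (forall t, 1 <= t -> t <= x -> `|\sum_(g <- elts t) f g| <= B) ->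
  (forall s t, 1 <= s -> s <= t -> t <= x -> 0 <= w t /\ w t <= w s) ->
  `|\sum_(g <- elts x) f g * w (nrm g)| <= B * w 1.
Proof.
move=> x1 HB Hw; have := @abel _ _ _ _ f w (fun t => - (B * w t)) x _ x1.
set S := \sum_(g <- elts x) _ * _; set T := \sum_(g <- elts x) f g => H.
have {}H : `|S - T * w x| <= - (B * w x) - - (B * w 1).
  apply: H => s t s1 st tx; have [w0 wts] := Hw _ _ s1 st tx.
  rewrite normrM [X in _ * X <= _]ger0_norm ?subr_ge0 //.
  apply: le_trans (ler_wpM2r _ (HB s s1 (le_trans st tx))) _; first by rewrite subr_ge0.
  by rewrite mulrBr; lra.
have [w0 _] := Hw _ _ x1 (lexx x) (lexx x).
have TB : `|T * w x| <= B * w x by rewrite normrM (ger0_norm w0) ler_wpM2r // HB.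
have -> : S = (S - T * w x) + T * w x by ring.
apply: le_trans (ler_normD _ _) _; lra.
Qed.

(** Meant for w(t) = |M(x/t)|, which varies no faster than cnt(x/t). An element counted between x/t
    and x/s satisfies s <= x/|g|, which converts C s times this variation into an increment of C x
    [harm]. *)
Lemma abel_linear (f : {mset P} -> R) (w : R -> R) x C : 1 <= x -> 0 <= C ->
  (forall t, 1 <= t -> `|\sum_(g <- elts t) f g| <= C * t) ->
  (forall s t, 1 <= s -> s <= t -> t <= x -> `|w s - w t| <= cnt (x / s) - cnt (x / t)) ->
  `|\sum_(g <- elts x) f g * w (nrm g)| <= C * x * (harm x + `|w x|).
Proof.
move=> x1 C0 HC Hw; have x0 := ge1_gt0 x1.
have := @abel _ _ _ _ f w (fun t => - (C * (x * harm (x / t)))) x _ x1.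
set S := \sum_(g <- elts x) _ * _; set T := \sum_(g <- elts x) f g => H.
have {}H : `|S - T * w x| <= - (C * (x * harm (x / x))) - - (C * (x * harm (x / 1))).
  apply: H => s t s1 st tx; have s0 := ge1_gt0 s1; have t0 := lt_le_trans s0 st.
  rewrite normrM opprK [leRHS]addrC -mulrBr -mulrBr.
  apply: le_trans (_ : C * s * (cnt (x / s) - cnt (x / t)) <= _).
    by rewrite ler_pM // ?HC // Hw.
  rewrite -mulrA ler_wpM2l // /cnt /harm.
  have xts : x / t <= x / s by rewrite ler_wpM2l ?(ltW x0) // lef_pV2.
  rewrite !(sum_elts_split _ xts) ![_ + _ - _]addrAC !subrr !add0r !mulr_sumr.
  rewrite big_seq_cond [leRHS]big_seq_cond; apply: ler_sum => g; rewrite mem_elts mulr1.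
  move=> /andP[gxs _]; rewrite ler_pdivlMr ?asg_norm_gt0 //.
  by rewrite mulrC -ler_pdivlMr.
rewrite divff ?gt_eqF // divr1 in H.
have TB : `|T * w x| <= C * x * `|w x| by rewrite normrM ler_wpM2r // HC.
have h1 : 0 <= C * (x * harm 1) by rewrite !mulr_ge0 ?harm_ge0 // ltW.
have -> : S = (S - T * w x) + T * w x by ring.
apply: le_trans (ler_normD _ _) _; rewrite mulrDr -[C * x * harm x]mulrA; lra.
Qed.

End AbelCorollaries.

(** * Selberg's formula *)

Section Selberg.
Context {R : realType} {P : countType} {N : P -> R} {asgN : arith_semigroup N}.
Context {c eta K : R} {axA : axiom_A N c eta K}.
Local Notation nrm := (asg_norm N).
Local Notation elts := (elts N).
Local Notation dact := (dact (N := N)).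
Local Notation cnt := (cnt N).
Local Notation harm := (harm N).
Local Notation one := (fun=> 1).
Local Notation sum_cnt := (sum_cnt (N := N)).
Local Notation L := (logn_norm (N := N)).
Local Notation Lam := (vonM (N := N)).
Local Notation mu := (mob xpredT).
Implicit Types (x y s t A B : R) (g h d k : {mset P}) (p q : P) (Phi : R -> R).

Let c0 : 0 < c. Proof. exact: density_gt0. Qed.
Let K0 : 0 <= K. Proof. exact: error_ge0. Qed.
Let eta0 : 0 < eta. Proof. exact: exponent_gt0. Qed.
Let eta1 : eta < 1. Proof. exact: exponent_lt1. Qed.

(** Selberg's function, the convolution of mu with L^2 by [dact_logn2]. *)
Definition vonM2 g : R := dconv (N := N) Lam Lam g + Lam g * L g.
Definition tau g : R := dconv (N := N) one one g.

Lemma eq_dactl (f h : {mset P} -> R) Phi x : f =1 h -> dact f Phi x = dact h Phi x.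
Proof. by move=> fh; apply: eq_bigr => g _; rewrite fh. Qed.

(** Writing * for convolution, the derivation given by ln, applied to L = 1 * Lam, yields L^2 = L *
    Lam + 1 * (Lam L), and L is again 1 * Lam. *)
Lemma dact_logn2 Phi x : 0 < x ->
  dact (fun g => L g * L g) Phi x = dact one (dact vonM2 Phi) x.
Proof.
move=> x0.
have h1 := ln_dact (N := N) L Phi x0.
have h2 := ln_dact (N := N) one (dact Lam Phi) x0.
have h3 : dact one (fun y => ln y * dact Lam Phi y) x =
    dact one (dact (fun g => Lam g * L g) Phi) x + dact one (dact Lam (fun y => ln y * Phi y)) x.
  rewrite -dactDr; apply: eq_dact => // y /andP[y1 _].
  by rewrite (ln_dact _ _ (ge1_gt0 y1)).
have h4 : dact one (dact vonM2 Phi) x = dact one (dact Lam (dact Lam Phi)) x +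
    dact one (dact (fun g => Lam g * L g) Phi) x.
  by rewrite -dactDr; apply: eq_dact => // y _; rewrite /vonM2 dactDl dact_dconv.
rewrite !dact_one_vonM in h2 h3 h4.
have h5 : dact (fun g => one g * L g) (dact Lam Phi) x = dact L (dact Lam Phi) x.
  by apply: eq_dactl => g; rewrite mul1r.
rewrite h5 h3 in h2; rewrite h1 in h2; rewrite h4.
by apply: (addIr (dact L (fun y => ln y * Phi y) x)); rewrite h2 addrA.
Qed.

Lemma dact_tau_logn Phi x : 0 < x ->
  dact (fun g => tau g * L g) Phi x = 2 * dact one (dact L Phi) x.
Proof.
move=> x0.
have h1 := ln_dact (N := N) tau Phi x0.
have h2 := ln_dact (N := N) one (dact one Phi) x0.
have h3 : dact one (fun y => ln y * dact one Phi y) x =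
    dact one (dact L Phi) x + dact one (dact one (fun y => ln y * Phi y)) x.
  rewrite -dactDr; apply: eq_dact => // y /andP[y1 _].
  rewrite (ln_dact _ _ (ge1_gt0 y1)); congr (_ + _).
  by apply: eq_dactl => g; rewrite mul1r.
have h5 : dact (fun g => one g * L g) (dact one Phi) x = dact one (dact L Phi) x.
  by rewrite [RHS]dactC; apply: eq_dactl => g; rewrite mul1r.
rewrite -!dact_dconv -/tau in h2 h3 *.
rewrite -!dact_dconv in h5.
rewrite h5 h3 in h2; rewrite h1 in h2.
apply: (addIr (dact tau (fun y => ln y * Phi y) x)); rewrite h2; ring.
Qed.

(** The derivation kills mu * 1 = delta, so that (mu L) * 1 = - mu * L = - Lam; then convolve with
    mu. *)
Lemma dact_mu_logn Phi x : 1 <= x ->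
  dact (fun g => mu g * L g) Phi x = - dact Lam (dact mu Phi) x.
Proof.
move=> x1; have x0 := ge1_gt0 x1.
have key (Psi : R -> R) : dact (fun g => mu g * L g) (dact one Psi) x = - dact Lam Psi x.
  have h1 := ln_dact (N := N) mu (dact one Psi) x0.
  rewrite dact_mob_inv // in h1.
  have h2 : dact mu (fun y => ln y * dact one Psi y) x =
      dact mu (dact one (dact Lam Psi)) x + dact mu (dact one (fun y => ln y * Psi y)) x.
    rewrite -dactDr; apply: eq_dact => // y /andP[y1 _].
    rewrite (ln_dact _ _ (ge1_gt0 y1)) dact_one_vonM; congr (_ + _).
    by apply: eq_dactl => g; rewrite mul1r.
  rewrite !dact_mob_inv // in h2; rewrite h2 in h1.
  apply/eqP; rewrite -addr_eq0; apply/eqP.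
  by apply: (addIr (ln x * Psi x)); rewrite -addrA -h1 add0r.
rewrite -key; apply: eq_dact => // y /andP[y1 _].
by rewrite dactC dact_mob_inv.
Qed.

(* [resid] is chosen so that its summatory function has a power-saving bound; applying
   the Moebius inversion to it and to [resid * L] yields the Chebyshev and Selberg bounds. *)
Definition resid b g : R := c * L g - tau g - b.

Lemma dact_residE b x : dact (resid b) one x = c * dact L one x - sum_cnt x - b * cnt x.
Proof.
rewrite -cntE -!dactZl.
have -> : sum_cnt x = dact tau one x.
  rewrite dact_dconv; apply: eq_bigr => g _; by rewrite mul1r cntE.
rewrite /dact -!sumrB; apply: eq_bigr => g _; rewrite /resid; ring.
Qed.

Lemma dom_resid : exists b, exists2 s, (0 < s) && (s < 1) &
  dominated (dact (resid b) one) (fun x => x `^ s).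
Proof.
have [b0 H0] := dom_sum_cnt (asgN := asgN) (axA := axA).
pose s := (1 + eta) / 2; have es : eta < s by rewrite /s; have := eta1; lra.
have H1 := dom_sum_logn_norm (asgN := asgN) (axA := axA) es.
have H2 : dominated (fun x => cnt x - c * x) (fun x => x `^ s).
  apply: dom_trans (dom_powR (ltW es)) => [x _|]; first exact: powR_ge0.
  by exists K => // x x1; exact: count_approx.
(* [b] cancels the linear terms: - c^2 from c L, - b0 from [tau], - b c from the constant. *)
pose b := - (c ^+ 2 + b0) / c.
exists b; exists s; first by rewrite /s; apply/andP; have := eta0; have := eta1; split; lra.
have H3 := domB (domB (domZ c H1) H0) (domZ b H2).
apply: eq_dom H3 => x x1.
by rewrite dact_residE /b; field; rewrite gt_eqF.
Qed.

(** L(g) = ln x - ln (x/|g|): the first part is the known sum times ln x, the second is summed by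
    parts against a nonincreasing weight. *)
Lemma dom_resid_logn b s : 0 < s -> dominated (dact (resid b) one) (fun x => x `^ s) ->
  dominated (dact (fun g => resid b g * L g) one) (fun x => x `^ s * ln x).
Proof.
move=> s0 [C C0 H]; exists (C + C); first exact: addr_ge0.
move=> x x1; have x0 := ge1_gt0 x1.
have -> : dact (fun g => resid b g * L g) one x =
    ln x * dact (resid b) one x - dact (resid b) (@ln R) x.
  rewrite (ln_dact _ _ x0) -addrA [X in _ + X](_ : _ = 0) ?addr0 //.
  by apply/eqP; rewrite subr_eq0; apply/eqP; apply: eq_bigr => g _; rewrite mulr1.
apply: le_trans (ler_normB _ _) _; rewrite mulrDl; apply: lerD.
  by rewrite normrM (ger0_norm (ln_ge0 x1)) mulrC mulrA ler_wpM2r ?ln_ge0 ?H.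
rewrite mulrA -[X in _ * ln X](divr1 x).
apply: (@abel_mono _ _ _ _ (resid b) (fun t => ln (x / t)) x (C * x `^ s)) => //.
  move=> t t1 tx; have := H t t1.
  have -> : dact (resid b) one t = \sum_(g <- elts t) resid b g.
    by apply: eq_bigr => g _; rewrite mulr1.
  move=> h; apply: le_trans h _.
  by rewrite ler_wpM2l // ge0_ler_powR ?nnegrE ?(ltW s0) ?(ltW x0) // (le_trans ler01).
move=> u t u1 ut tx; have u0 := ge1_gt0 u1; have t0 := lt_le_trans u0 ut.
split; first by rewrite ln_ge0 // ler_pdivlMr // mul1r.
by rewrite ler_ln ?posrE ?divr_gt0 // ler_wpM2l ?(ltW x0) // lef_pV2.
Qed.

(** [f] is recovered by summing mu(g) Phi(x/|g|), and the sum of (x/|g|)^s is O(x) because s < 1. *)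
Lemma dom_mob_inv (f : R -> R) Phi s : 0 <= s -> s < 1 ->
  (forall x, 1 <= x -> Phi x = dact one f x) -> dominated Phi (fun x => x `^ s) ->
  dominated f (fun x => x).
Proof.
move=> s0 s1 E H.
have := dom_dact_powR (asgN := asgN) (axA := axA) (@norm_mob R P xpredT) s0 s1 H.
apply: eq_dom => x x1; rewrite -(@dact_mob_inv _ _ _ _ f x x1).
by apply: eq_dact => // y /andP[y1 _]; exact: E.
Qed.

Definition psi x := dact Lam one x.

Lemma psiE x : psi x = \sum_(g <- elts x) Lam g.
Proof. by apply: eq_bigr => g _; rewrite mulr1. Qed.

Lemma dom_cnt : dominated cnt (fun x => x).
Proof.
exists (c + K); first by rewrite addr_ge0 // ltW.
move=> x x1; rewrite ger0_norm ?cnt_ge0 //; apply: cnt_le; exact: ge1_ge0.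
Qed.

(** [resid b] is the convolution of 1 with c Lam - 1 - b delta, so inversion bounds c psi - cnt -
    b. *)
Lemma dom_psi : dominated psi (fun x => x).
Proof.
have [b [s /andP[s0 s1] H]] := dom_resid.
have H1 := @dom_mob_inv (fun x => c * psi x - cnt x - b) _ s (ltW s0) s1 _ H.
have {}H1 := H1 _.
have H2 : dominated (fun=> b) (fun x : R => x).
  by exists `|b| => // x x1; rewrite ler_peMr.
have H3 : dominated (fun x => c * psi x - cnt x - b) (fun x => x).
  apply: H1 => x x1; rewrite dact_residE.
  transitivity (dact one (fun y => c * psi y + (-1) * (cnt y + b)) x); last first.
    apply: eq_dact => // y _; ring.
  rewrite dactDr !dactZr dactDr /psi dact_one_vonM.
  have -> : dact one (fun=> b) x = b * cnt x.
    by rewrite -cntE -dactZr; apply: eq_dact => // y _; rewrite mulr1.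
  have -> : dact one cnt x = sum_cnt x by apply: eq_bigr => g _; rewrite mul1r.
  ring.
apply: eq_dom (domZ c^-1 (domD (domD H3 dom_cnt) H2)) => x x1.
by field; rewrite gt_eqF.
Qed.

(** By the identities above, [resid b] times L is the convolution of 1 with c vonM2 - 2 L - b Lam;
    the part b Lam is O(x) by [dom_psi]. *)
Lemma dom_selberg :
  dominated (fun x => \sum_(g <- elts x) (c * vonM2 g - 2 * L g)) (fun x => x).
Proof.
have [b [s /andP[s0 s1] H]] := dom_resid.
pose s' := (1 + s) / 2; have ss : s < s' by rewrite /s'; lra.
have s'0 : 0 <= s' by rewrite /s'; lra.
have s'1 : s' < 1 by rewrite /s'; lra.
have {H} H : dominated (dact (fun g => resid b g * L g) one) (fun x => x `^ s').
  apply: dom_trans (dom_powR_ln ss); last exact: dom_resid_logn.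
  by move=> x x1; rewrite mulr_ge0 ?powR_ge0 ?ln_ge0.
have := @dom_mob_inv (fun x => c * dact vonM2 one x - 2 * dact L one x - b * psi x) _ s' s'0 s'1 _ H.
move=> {}H; have {}H : dominated (fun x => c * dact vonM2 one x - 2 * dact L one x - b * psi x) (fun x => x).
  apply: H => x x1; have x0 := ge1_gt0 x1.
  transitivity (c * dact (fun g => L g * L g) one x - dact (fun g => tau g * L g) one x - b * dact L one x).
    rewrite -!dactZl /dact -!sumrB; apply: eq_bigr => g _; rewrite /resid; ring.
  rewrite dact_logn2 // dact_tau_logn // -(dact_one_vonM one).
  transitivity (dact one (fun y => c * dact vonM2 one y + (- 2 * dact L one y + (- b) * psi y)) x); last first.
    apply: eq_dact => // y _; ring.
  rewrite !dactDr !dactZr /psi; ring.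
apply: eq_dom (domD H (domZ b dom_psi)) => x x1.
by rewrite subrK /dact !mulr_sumr -sumrB; apply: eq_bigr => g _; rewrite !mulr1.
Qed.

(** The sum of L is the sum of Lam(g) cnt(x/|g|). It is at most cnt(x) ln x, while each cnt(x/|g|)
    is at least a fixed multiple of x/|g|. *)
Lemma dom_mertens : exists2 C, 0 <= C & forall x, 1 <= x ->
  \sum_(g <- elts x) Lam g / nrm g <= C * ln x.
Proof.
have [b b0 Hb] := cnt_ge (asgN := asgN) (axA := axA).
exists ((c + K) / b); first by rewrite divr_ge0 ?addr_ge0 // ltW.
move=> x x1; have x0 := ge1_gt0 x1.
have h1 : dact one (dact Lam one) x <= (c + K) * x * ln x.
  rewrite dact_one_vonM; apply: le_trans (_ : cnt x * ln x <= _); last first.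
    by rewrite ler_wpM2r ?ln_ge0 // cnt_le ?ltW.
  rewrite /cnt mulr_suml /dact big_seq [leRHS]big_seq; apply: ler_sum => g.
  rewrite mem_elts mul1r mulr1 => gx.
  by rewrite /logn_norm ler_ln ?posrE ?asg_norm_gt0.
rewrite dactC in h1.
have h2 : b * x * (\sum_(g <- elts x) Lam g / nrm g) <= dact Lam (dact one one) x.
  have -> : dact Lam (dact one one) x = \sum_(g <- elts x) Lam g * cnt (x / nrm g).
    by apply: eq_bigr => g _; rewrite cntE.
  rewrite mulr_sumr big_seq [leRHS]big_seq; apply: ler_sum => g; rewrite mem_elts => gx.
  have -> : b * x * (Lam g / nrm g) = Lam g * (b * (x / nrm g)) by ring.
  by rewrite ler_wpM2l ?vonM_ge0 // Hb // ler_pdivlMr ?asg_norm_gt0 // mul1r.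
rewrite -(@ler_pM2l _ (b * x)) ?mulr_gt0 //; apply: le_trans h2 _; apply: le_trans h1 _.
by apply: eq_ler; field; rewrite gt_eqF.
Qed.

Definition mertens x : R := dact mu one x.

Lemma mertensE x : mertens x = \sum_(g <- elts x) mu g.
Proof. by apply: eq_bigr => g _; rewrite mulr1. Qed.

Lemma mertens_diff s t : s <= t -> `|mertens s - mertens t| <= cnt t - cnt s.
Proof.
move=> st; rewrite distrC !mertensE /cnt !(sum_elts_split _ st) ![_ + _ - _]addrAC !subrr !add0r.
by apply: le_trans (ler_norm_sum _ _ _) _; apply: ler_sum => g _; exact: norm_mob.
Qed.

Lemma norm_mertens x : `|mertens x| <= cnt x.
Proof.
rewrite mertensE; apply: le_trans (ler_norm_sum _ _ _) _.
by apply: ler_sum => g _; exact: norm_mob.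
Qed.

(** The relation [ln1M], coming from mu L = - Lam * mu, is used twice. Lam * Lam and Lam L appear
    with opposite signs; only after taking absolute values do they combine into [vonM2]. *)
Lemma mertens_ln2 x : 1 <= x -> ln x ^+ 2 * mertens x =
  dact Lam (dact Lam mertens) x - dact (fun g => Lam g * L g) mertens x
  - dact Lam (dact mu (@ln R)) x + ln x * dact mu (@ln R) x.
Proof.
have ln1M y : 1 <= y -> ln y * mertens y = dact mu (@ln R) y - dact Lam mertens y.
  move=> y1; rewrite /mertens (ln_dact _ _ (ge1_gt0 y1)) dact_mu_logn // addrC.
  by congr (_ - _); apply: eq_bigr => g _; rewrite mulr1.
move=> x1; rewrite expr2 -mulrA ln1M // mulrBr (ln_dact Lam _ (ge1_gt0 x1)).
have -> : dact Lam (fun y => ln y * mertens y) x =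
    dact Lam (dact mu (@ln R)) x - dact Lam (dact Lam mertens) x.
  transitivity (dact Lam (fun y => dact mu (@ln R) y + (-1) * dact Lam mertens y) x).
    by apply: eq_dact => // y /andP[y1 _]; rewrite ln1M // mulN1r.
  by rewrite dactDr dactZr mulN1r.
ring.
Qed.

(** On average c [vonM2] may be replaced by 2 L. The sums of the difference are O(x), and
    [abel_linear] transfers this to the weights |M(x/|g|)| at the cost of one logarithm. *)
Lemma mertens_ineq : exists2 C, 0 <= C & forall x, 1 <= x ->
  c * (ln x ^+ 2 * `|mertens x|) <=
  2 * \sum_(g <- elts x) L g * `|mertens (x / nrm g)| + C * (x * (1 + ln x)).
Proof.
have [C1 C10 H1] := dom_dact_ln (asgN := asgN) (axA := axA) (@norm_mob R P xpredT).
have [C2 C20 H2] := dom_mertens.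
have [C3 C30 H3] := dom_selberg.
have [C4 C40 H4] := harm_le (asgN := asgN) (axA := axA).
exists (c * (C1 * C2 + C1) + C3 * (C4 + c + K)).
  by rewrite !(addr_ge0, mulr_ge0) // ltW.
move=> x x1; have x0 := ge1_gt0 x1; have l0 := ln_ge0 x1.
pose W := \sum_(g <- elts x) vonM2 g * `|mertens (x / nrm g)|.
have s1 : `|dact Lam (dact Lam mertens) x - dact (fun g => Lam g * L g) mertens x| <= W.
  rewrite -dact_dconv /dact -sumrB; apply: le_trans (ler_norm_sum _ _ _) _.
  apply: ler_sum => g _; rewrite -mulrBl normrM ler_wpM2r // /vonM2.
  apply: le_trans (ler_normB _ _) _; rewrite !ger0_norm //.
    by rewrite mulr_ge0 ?vonM_ge0 ?logn_norm_ge0.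
  by apply: sumr_ge0 => d _; rewrite mulr_ge0 ?vonM_ge0.
have s2 : `|dact Lam (dact mu (@ln R)) x| <= C1 * C2 * (x * ln x).
  apply: le_trans (@ler_dact _ _ _ _ _ Lam _ (fun y => C1 * y) _ _ _) _.
  - by move=> g; rewrite ger0_norm ?vonM_ge0.
  - by move=> y /andP[y1 _]; exact: H1.
  rewrite dactZr dact_id -!mulrA ler_wpM2l // mulrCA ler_wpM2l ?(ltW x0) //.
  exact: H2.
have s3 : `|ln x * dact mu (@ln R) x| <= C1 * (x * ln x).
  by rewrite normrM (ger0_norm l0) mulrC mulrA ler_wpM2r // H1.
have s4 : `|\sum_(g <- elts x) (c * vonM2 g - 2 * L g) * `|mertens (x / nrm g)| | <=
    C3 * (C4 + c + K) * (x * (1 + ln x)).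
  apply: le_trans (@abel_linear _ _ _ _ _ (fun t => `|mertens (x / t)|) x C3 x1 C30 _ _) _.
  - exact: H3.
  - move=> s t s1' st tx; apply: le_trans (ler_dist_dist _ _) _.
    rewrite distrC; apply: mertens_diff.
    by rewrite ler_wpM2l ?(ltW x0) // lef_pV2 // posrE ?(lt_le_trans _ st) ?ge1_gt0.
  rewrite divff ?gt_eqF // -mulrA mulrCA [leRHS]mulrA [leRHS]mulrAC.
  rewrite [leRHS]mulrC ler_wpM2l ?(ltW x0) // [leRHS]mulrAC -mulrA ler_wpM2l //.
  have m1 : `|mertens 1| <= c + K.
    by apply: le_trans (norm_mertens _) _; apply: le_trans (cnt_le ler01) _; rewrite mulr1.
  have ck : 0 <= (c + K) * ln x by rewrite mulr_ge0 // addr_ge0 // ltW.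
  have := H4 x x1; move: (harm x) ck m1 => hx.
  by rewrite normr_id !(mulrDl, mulrDr, mulr1); lra.
have s5 : c * W = 2 * (\sum_(g <- elts x) L g * `|mertens (x / nrm g)|) +
   \sum_(g <- elts x) (c * vonM2 g - 2 * L g) * `|mertens (x / nrm g)|.
  by rewrite /W !mulr_sumr -big_split /=; apply: eq_bigr => g _; ring.
have s6 : ln x ^+ 2 * `|mertens x| <= W + (C1 * C2 + C1) * (x * ln x).
  rewrite -[ln x ^+ 2]ger0_norm ?sqr_ge0 // -normrM mertens_ln2 // mulrDl addrA.
  apply: le_trans (ler_normD _ _) _; apply: lerD => //.
  by apply: le_trans (ler_normB _ _) _; apply: lerD.
have s7 : (C1 * C2 + C1) * (x * ln x) <= (C1 * C2 + C1) * (x * (1 + ln x)).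
  by rewrite ler_wpM2l ?(addr_ge0, mulr_ge0) // ler_wpM2l ?(ltW x0) // lerDr.
apply: le_trans (ler_wpM2l (ltW c0) (le_trans s6 (lerD (lexx _) s7))) _.
rewrite mulrDr s5 -addrA lerD2l [leRHS]mulrDl [leRHS]addrC mulrA lerD2r.
exact: le_trans (ler_norm _) s4.
Qed.

End Selberg.

(** * The summatory Moebius function *)

Section MertensCells.
Context {R : realType} {P : countType} {N : P -> R} {asgN : arith_semigroup N}.
Context {c eta K : R} {axA : axiom_A N c eta K}.
Local Notation nrm := (asg_norm N).
Local Notation elts := (elts N).
Local Notation dact := (dact (N := N)).
Local Notation cnt := (cnt N).
Local Notation harm := (harm N).
Local Notation one := (fun=> 1).
Local Notation mertens := (mertens (N := N)).
Implicit Types (x y s t A B : R) (g h d k : {mset P}) (p q : P).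

Let c0 : 0 < c. Proof. exact: density_gt0. Qed.
Let K0 : 0 <= K. Proof. exact: error_ge0. Qed.
Let eta0 : 0 < eta. Proof. exact: exponent_gt0. Qed.
Let eta1 : eta < 1. Proof. exact: exponent_lt1. Qed.

Definition mobsum (Q : pred P) x : R := \sum_(g <- elts x) mob Q g / nrm g.

Lemma mobsum_lt1 Q x : x < 1 -> mobsum Q x = 0.
Proof. by move=> x1; rewrite /mobsum elts_lt1 // big_nil. Qed.

Lemma dact_mob_cnt Q x : dact (mob Q) cnt x = dact (ind (predC Q)) one x.
Proof.
rewrite -dact_mob_one; apply: eq_dact => // y _.
by rewrite cntE.
Qed.

Lemma mob_count_error : exists2 C, 0 <= C & forall (f : {mset P} -> R) x, 1 <= x ->
  (forall g, `|f g| <= 1) -> `|\sum_(g <- elts x) f g * (cnt (x / nrm g) - c * (x / nrm g))| <= C * x.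
Proof.
have [C C0 H] := @dom_sum_powR _ _ _ asgN c eta K axA eta (ltW eta0) eta1.
exists (K * C) => [|f x x1 f1]; first exact: mulr_ge0.
apply: le_trans (@ler_dact _ _ _ _ f one (fun y => cnt y - c * y) (fun y => K * y `^ eta) x f1 _) _.
  by move=> y /andP[y1 _]; exact: count_approx.
rewrite dactZr -mulrA ler_wpM2l //; apply: le_trans (H x x1); exact: ler_norm.
Qed.

(* The bound is uniform in [Q] because the convolution of [mob Q] with 1 is an indicator. *)
Lemma mobsum_bounded : exists2 C, 0 <= C & forall Q x, `|mobsum Q x| <= C.
Proof.
have [C C0 H] := mob_count_error.
exists ((c + K + C) / c); first by rewrite divr_ge0 ?addr_ge0 // ltW.
move=> Q x; have [x1|x1] := ltP x 1.
  by rewrite mobsum_lt1 // normr0 divr_ge0 ?addr_ge0 // ltW.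
have x0 := ge1_gt0 x1.
rewrite ler_pdivlMr // -(@ler_pM2l _ x) //.
have -> : x * (`|mobsum Q x| * c) = `|c * x * mobsum Q x|.
  by rewrite normrM (gtr0_norm (mulr_gt0 c0 x0)); ring.
have -> : c * x * mobsum Q x = dact (mob Q) cnt x -
   \sum_(g <- elts x) mob Q g * (cnt (x / nrm g) - c * (x / nrm g)).
  rewrite /mobsum mulr_sumr /dact -sumrB; apply: eq_bigr => g _; ring.
apply: le_trans (ler_normB _ _) _; rewrite mulrC mulrDl; apply: lerD; last first.
  by apply: H => // g; exact: norm_mob.
rewrite dact_mob_cnt; apply: le_trans (cnt_le (ltW x0)); rewrite -cntE.
apply: ler_dact => [g|y _]; last by rewrite normr1.
by rewrite norm_ind /ind lern1 leq_b1.
Qed.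

(** The double sum of mu(g) over |g| |h| <= x and |h| <= B is reordered by g. The g up to x/B give
    M(x/B) cnt(B); the others give a sum of mu(g) cnt(x/|g|), which is O(x) by [mobsum_bounded] and
    [mob_count_error]. *)
Lemma sum_mertens_bounded : exists2 C, 0 <= C & forall x B, 1 <= x -> 1 <= B -> B <= x ->
  `|\sum_(h <- elts B) mertens (x / nrm h)| <= C * x.
Proof.
have [C C0 H] := mob_count_error; have [C' C'0 H'] := mobsum_bounded.
exists ((c + K) * (c + K) + c * (2 * C') + C).
  by rewrite !(addr_ge0, mulr_ge0) // ltW.
move=> x B x1 B1 Bx; have x0 := ge1_gt0 x1; have B0 := ge1_gt0 B1.
have xB1 : 1 <= x / B by rewrite ler_pdivlMr // mul1r.
have xBx : x / B <= x by rewrite ler_pdivrMr // ler_peMr // ltW.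
pose f g : R := if x / B < nrm g then mob xpredT g else 0.
have E : \sum_(h <- elts B) mertens (x / nrm h) =
    mertens (x / B) * cnt B + \sum_(g <- elts x) f g * cnt (x / nrm g).
  pose F h g : R := if nrm h <= B then mob xpredT g else 0.
  transitivity (\sum_(h <- elts x) \sum_(g <- elts (x / nrm h)) F h g).
    rewrite (sum_elts_split _ Bx) [X in _ = _ + X]big1 ?addr0 => [|h hB].
      rewrite big_seq [RHS]big_seq; apply: eq_bigr => h; rewrite mem_elts => hB.
      by rewrite mertensE; apply: eq_bigr => g _; rewrite /F hB.
    by rewrite big1 // => g _; rewrite /F leNgt hB.
  rewrite sum_pairsC (sum_elts_split _ xBx); congr (_ + _).
    rewrite mertensE mulr_suml big_seq [RHS]big_seq; apply: eq_bigr => g; rewrite mem_elts => gxB.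
    have Bxg : B <= x / nrm g.
      by rewrite ler_pdivlMr ?asg_norm_gt0 // mulrC -ler_pdivlMr.
    rewrite (sum_elts_split _ Bxg) [X in _ + X = _]big1 ?addr0 => [|h hB]; last first.
      by rewrite /F leNgt hB.
    rewrite /cnt mulr_sumr big_seq [RHS]big_seq; apply: eq_bigr => h.
    by rewrite mem_elts /F => ->; rewrite mulr1.
  rewrite [RHS](sum_elts_split _ xBx) [X in _ = X + _]big_seq [X in _ = X + _]big1 ?add0r; last first.
    by move=> g; rewrite mem_elts /f ltNge => ->; rewrite mul0r.
  apply: eq_bigr => g xBg; rewrite /f xBg /cnt mulr_sumr big_seq [RHS]big_seq.
  apply: eq_bigr => h; rewrite mem_elts /F mulr1 => hxg.
  rewrite (le_trans hxg) // ler_pdivrMr ?asg_norm_gt0 // mulrC -ler_pdivrMr //.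
  exact: ltW.
have E2 : \sum_(g <- elts x) f g * cnt (x / nrm g) =
    c * x * (mobsum xpredT x - mobsum xpredT (x / B)) +
    \sum_(g <- elts x) f g * (cnt (x / nrm g) - c * (x / nrm g)).
  have -> : mobsum xpredT x - mobsum xpredT (x / B) = \sum_(g <- elts x) f g / nrm g.
    rewrite /mobsum (sum_elts_split _ xBx) addrAC subrr add0r big_mkcond.
    by apply: eq_bigr => g _; rewrite /f; case: ifP => // _; rewrite mul0r.
  rewrite mulr_sumr -big_split /=; apply: eq_bigr => g _; ring.
rewrite E E2; apply: le_trans (ler_normD _ _) _; rewrite -addrA [leRHS]mulrDl.
apply: lerD.
  rewrite normrM (ger0_norm (cnt_ge0 _)).
  apply: le_trans (ler_pM _ (cnt_ge0 _) (norm_mertens _) (cnt_le (ltW B0))) _ => //.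
  apply: le_trans (ler_wpM2r _ (cnt_le _)) _.
  - by rewrite mulr_ge0 ?addr_ge0 // ltW.
  - by rewrite divr_ge0 // ltW.
  by apply: eq_ler; field; rewrite gt_eqF.
apply: le_trans (ler_normD _ _) _; rewrite [leRHS]mulrDl; apply: lerD; last first.
  apply: H => // g; rewrite /f; case: ifP => _; [exact: norm_mob|by rewrite normr0].
rewrite normrM (gtr0_norm (mulr_gt0 c0 x0)) (_ : c * (2 * C') * x = c * x * (2 * C')); last by ring.
rewrite ler_wpM2l ?mulr_ge0 ?(ltW c0) ?(ltW x0) //.
by apply: le_trans (ler_normB _ _) _; rewrite mulrDl !mul1r; apply: lerD; exact: H'.
Qed.

(** A discrete substitute for the intermediate value theorem, [V] being discontinuous in the
    application: from one grid point to the next it moves by at most [a], too little to change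
    sign. *)
Lemma grid_sign (V : R -> R) (s0 rho a : R) (m : nat) : 0 < s0 -> 0 <= rho -> (0 < m)%N ->
  (forall s t, s0 <= s -> s <= t -> t <= expR rho * s -> `|V t - V s| <= a) ->
  (forall i : nat, (i < m)%N -> a < `|V (expR (rho * i%:R) * s0)|) ->
  (forall t, s0 <= t -> t <= expR (rho * m%:R) * s0 -> 0 <= V t) \/
  (forall t, s0 <= t -> t <= expR (rho * m%:R) * s0 -> V t <= 0).
Proof.
move=> s00 rho0 m0.
wlog V0 : V / 0 <= V s0 => [wl|Lip far].
  move=> Lip far; have [V0|V0] := leP 0 (V s0); first exact: wl.
  case: (wl (fun t => - V t)) => [|s t s0s st ts|i im|H|H].
  - by rewrite oppr_ge0 ltW.
  - by rewrite -opprD normrN Lip.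
  - by rewrite normrN; exact: far.
  - by right=> t t0 tm; rewrite -oppr_ge0; exact: H.
  - by left=> t t0 tm; rewrite -oppr_le0; exact: H.
left; have a0 : 0 <= a.
  apply: le_trans (Lip s0 s0 (lexx _) (lexx _) _); first exact: normr_ge0.
  by rewrite ler_peMl ?(ltW s00) // -expR0 ler_expR.
have grid_ge i : s0 <= expR (rho * i%:R) * s0.
  by rewrite ler_peMl ?(ltW s00) // -expR0 ler_expR mulr_ge0.
have gridS i : expR (rho * i.+1%:R) * s0 = expR rho * (expR (rho * i%:R) * s0).
  by rewrite mulrA -expRD -natr1; congr (expR _ * _); ring.
have main j : (j <= m)%N -> (forall t, s0 <= t -> t <= expR (rho * j%:R) * s0 -> 0 <= V t).
  elim: j => [|j IH] jm t t0.
    by rewrite mulr0 expR0 mul1r => t0'; rewrite (_ : t = s0) //; apply/eqP; rewrite eq_le t0'.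
  have {}IH := IH (ltnW jm).
  have [tj|/ltW jt] := leP t (expR (rho * j%:R) * s0); first by move=> _; exact: IH.
  rewrite gridS => tj1.
  have Vj : a < V (expR (rho * j%:R) * s0).
    by have := far j jm; rewrite ger0_norm // IH.
  have := Lip _ _ (grid_ge j) jt tj1; rewrite ler_norml => /andP[h _].
  by lra.
exact: main (leqnn m).
Qed.

Let V t : R := mertens t / t.

Let norm_V t : 1 <= t -> `|V t| <= c + K.
Proof.
move=> t1; have t0 := ge1_gt0 t1.
rewrite normrM normfV (gtr0_norm t0) ler_pdivrMr //.
exact: le_trans (norm_mertens _) (cnt_le (ltW t0)).
Qed.

(** The increment of M is at most that of cnt, and 1 - s/t <= rho, so [V] is Lipschitz in the scale
    ln t up to the error term of Axiom A. *)
Let V_lipschitz rho s t : 1 <= s -> s <= t -> t <= expR rho * s ->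
  `|V t - V s| <= (c + (c + K)) * rho + 2 * K * s `^ (eta - 1).
Proof.
move=> s1 st tr; have s0 := ge1_gt0 s1; have t0 := lt_le_trans s0 st.
have t1 := le_trans s1 st.
have -> : V t - V s = (mertens t - mertens s) / t - V s * (1 - s / t).
  by rewrite /V; field; rewrite !gt_eqF.
have st1 : 1 - s / t <= rho.
  have : expR (- rho) <= s / t.
    by rewrite expRN ler_pdivlMr // mulrC ler_pdivrMr ?expR_gt0 // mulrC.
  by have := expR_ge1Dx (- rho); lra.
have st0 : 0 <= 1 - s / t by rewrite subr_ge0 ler_pdivrMr // mul1r.
apply: le_trans (ler_normB _ _) _.
have h1 : `|(mertens t - mertens s) / t| <= c * rho + 2 * K * s `^ (eta - 1).
  rewrite normrM normfV (gtr0_norm t0) distrC.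
  apply: le_trans (_ : (c * (t - s) + 2 * K * t `^ eta) / t <= _).
    rewrite ler_wpM2r ?invr_ge0 ?(ltW t0) //.
    apply: le_trans (mertens_diff st) _.
    rewrite -lerBlDl; apply: le_trans (ler_norm _) (cnt_diff s1 st).
  rewrite mulrDl; apply: lerD.
    rewrite -mulrA ler_wpM2l ?(ltW c0) //; apply: le_trans st1.
    by apply: eq_ler; field; rewrite gt_eqF.
  rewrite -mulrA ler_wpM2l ?mulr_ge0 //.
  rewrite -(powR_inv1 (ltW t0)) -powRD ?(gt_eqF t0) ?implybT //.
  rewrite -(opprB 1 eta) !powRN lef_pV2 ?posrE ?powR_gt0 //.
  by rewrite ge0_ler_powR ?nnegrE ?subr_ge0 ?(ltW eta1) ?(ltW s0) ?(ltW t0).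
have h2 : `|V s * (1 - s / t)| <= (c + K) * rho.
  rewrite normrM (ger0_norm st0); apply: ler_pM => //; exact: norm_V.
rewrite [in leRHS]mulrDl addrAC; exact: lerD.
Qed.

Lemma powR_small a e : a < 0 -> 0 < e ->
  exists2 X : R, 1 <= X & forall x, X <= x -> x `^ a <= e.
Proof.
move=> a0 e0; have a1 : a + 1 < 1 by lra.
have [X X1 H] := sublin_powR a1 e0; exists X => // x Xx.
have x1 := le_trans X1 Xx; have x0 := ge1_gt0 x1.
have := H x Xx; rewrite ger0_norm ?powR_ge0 // powRD ?(gt_eqF x0) ?implybT //.
by rewrite powRr1 ?(ltW x0) // ler_pM2r.
Qed.

Let ratio_harm : exists2 C, 0 <= C & forall A B, 1 <= A -> A <= B ->
  `|harm B - harm A - c * ln (B / A)| <= C * A `^ (eta - 1).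
Proof. exact: harm_diff. Qed.

(* Sample [V] along a geometric grid of ratio [expR rho]. If it is small at a grid point, it
   is small up to the next one; otherwise it keeps its sign on the whole cell, and
   [sum_mertens_bounded] applies. *)
Lemma cell_bound alpha : 0 < alpha ->
  (forall e, 0 < e -> exists2 X, 1 <= X & forall x, X <= x -> `|mertens x| <= (alpha + e) * x) ->
  exists T kap A0 X0, [/\ 0 < T, 0 < kap & 2 * kap <= alpha] /\ [/\ 1 <= A0, 1 <= X0 &
   forall A x, A0 <= A -> X0 * (expR T * A) <= x ->
    \sum_(h <- elts (expR T * A) | A < nrm h) `|mertens (x / nrm h)| <=
      c * T * (alpha - 2 * kap) * x].
Proof.
move=> al0 Hal.
have [C1 C10 HC1] := sum_mertens_bounded; have [CH CH0 HH] := ratio_harm.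
(* [T] makes the cell so long that the bound 2 C1 x of the constant-sign case is at most half of the
   trivial c T alpha x. *)
pose T := 4 * C1 / (c * alpha) + 1.
have ca0 : 0 < c * alpha by rewrite mulr_gt0.
have T0 : 0 < T by rewrite /T ltr_wpDl // divr_ge0 ?mulr_ge0 // ltW.
have TC : 4 * C1 <= c * T * alpha.
  have -> : c * T * alpha = 4 * C1 + c * alpha by rewrite /T; field; rewrite !gt_eqF.
  by rewrite lerDl ltW.
pose D := c + (c + K).
have D0 : 0 < D by rewrite /D ltr_wpDr // addr_ge0 // ltW.
(* The cell has [m] grid steps of logarithmic length [rho]; over one step [V] moves by at most
   alpha/8, plus alpha/8 from the error term. *)
pose m := (Num.trunc (8 * D * T / alpha)).+1.
have mP : 8 * D * T / alpha < m%:R by exact: truncnS_gt.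
have m0 : 0 < m%:R :> R by rewrite ltr0n.
pose rho := T / m%:R.
have rho0 : 0 < rho by rewrite divr_gt0.
have rhom : rho * m%:R = T by rewrite /rho divfK // gt_eqF.
have rhoT : rho <= T by rewrite /rho ler_pdivrMr // ler_peMr ?(ltW T0) // ler1n.
have Drho : D * rho <= alpha / 8.
  rewrite /rho mulrA ler_pdivrMr // mulrAC ler_pdivlMr // mulrC.
  by move: mP; rewrite ltr_pdivrMr // => /ltW; rewrite !mulrA [alpha * _]mulrC.
pose ep := alpha * rho / (8 * T).
have ep0 : 0 < ep by exact: divr_gt0 (mulr_gt0 al0 rho0) (mulr_gt0 (ltr0Sn _ 7) T0).
have [X1 X11 HX1] := Hal ep ep0.
have em : eta - 1 < 0 by rewrite subr_lt0.
have [X2 X21 HX2] : exists2 X : R, 1 <= X & forall x, X <= x -> (2 * K + 1) * x `^ (eta - 1) <= alpha / 8.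
  have k0 : 0 < 2 * K + 1 by rewrite ltr_wpDl ?mulr_ge0.
  have [X X1' H] := @powR_small (eta - 1) (alpha / 8 / (2 * K + 1)) em (divr_gt0 (divr_gt0 al0 (ltr0Sn _ 7)) k0).
  by exists X => // x Xx; rewrite mulrC -ler_pdivlMr // H.
have [A0 A01 HA0] : exists2 X : R, 1 <= X & forall x, X <= x -> CH * x `^ (eta - 1) <= c * rho / 16.
  have k0 : 0 < CH + 1 by rewrite ltr_wpDl.
  have [X X1' H] := @powR_small (eta - 1) (c * rho / 16 / (CH + 1)) em (divr_gt0 (divr_gt0 (mulr_gt0 c0 rho0) (ltr0Sn _ 15)) k0).
  exists X => // x Xx; apply: le_trans (_ : (CH + 1) * x `^ (eta - 1) <= _).
    by rewrite ler_wpM2r ?powR_ge0 // lerDl.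
  by rewrite mulrC -ler_pdivlMr // H.
(* A step on which |V| <= alpha/2 saves about c alpha rho / 2 out of c T alpha. The approximation
   errors take up to half of that; the remaining c alpha rho / 4 is 2 kap c T. *)
pose kap := alpha * rho / (8 * T).
have kapE : c * T * (alpha - 2 * kap) = c * T * alpha - c * alpha * rho / 4.
  by rewrite /kap; field; rewrite gt_eqF.
have kap0 : 0 < kap by [].
have kapal : 2 * kap <= alpha.
  have : kap <= alpha / 8.
    rewrite /kap ler_pdivrMr ?mulr_gt0 //.
    have -> : alpha / 8 * (8 * T) = alpha * T by field.
    by rewrite ler_pM2l.
  by move: al0; lra.
exists T, kap, A0, (Num.max X1 X2); split=> //; split=> //; first by rewrite le_max X11.
move=> A x A0A Xx.
have A1 := le_trans A01 A0A; have Ap := ge1_gt0 A1.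
have eT1 : 1 <= expR T by rewrite -expR0 ler_expR ltW.
set B := expR T * A in Xx *.
have AB : A <= B by rewrite /B ler_peMl // ltW.
have B1 := le_trans A1 AB; have B0 := ge1_gt0 B1.
pose s0 := x / B.
have X0s0 : Num.max X1 X2 <= s0 by rewrite /s0 ler_pdivlMr.
have [Xs1 Xs2] : X1 <= s0 /\ X2 <= s0 by move: X0s0; rewrite ge_max => /andP.
have s01 := le_trans X11 Xs1; have s0p := ge1_gt0 s01.
have xE : x = s0 * B by rewrite /s0 divfK // gt_eqF.
have x1 : 1 <= x by rewrite xE mulr_ege1.
have xp := ge1_gt0 x1.
have Bx : B <= x by rewrite xE ler_peMl // ltW.
have Lip s t : s0 <= s -> s <= t -> t <= expR rho * s -> `|V t - V s| <= alpha / 4.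
  move=> ss st ts; apply: le_trans (V_lipschitz (le_trans s01 ss) st ts) _.
  have h1 := HX2 s (le_trans Xs2 ss).
  have h2 : 2 * K * s `^ (eta - 1) <= (2 * K + 1) * s `^ (eta - 1).
    by rewrite ler_wpM2r ?powR_ge0 // lerDl.
  by rewrite -/D; lra.
have V_of h : A < nrm h -> nrm h <= B -> [/\ `|mertens (x / nrm h)| = `|V (x / nrm h)| * (x / nrm h),
    s0 <= x / nrm h & x / nrm h <= expR T * s0].
  move=> Ah hB; have h0 : 0 < nrm h by exact: asg_norm_gt0.
  have xh0 : 0 < x / nrm h by rewrite divr_gt0.
  split; first by rewrite /V normrM normfV (gtr0_norm xh0) divfK // gt_eqF.
    by rewrite /s0 ler_wpM2l ?(ltW xp) // lef_pV2.
  rewrite ler_pdivrMr //; apply: le_trans (_ : expR T * s0 * A <= _).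
    by apply: eq_ler; rewrite {1}xE /B; ring.
  by apply: ler_wpM2l (ltW Ah); exact: mulr_ge0 (expR_ge0 _) (ltW s0p).
have harmAB : \sum_(h <- elts B | A < nrm h) (nrm h)^-1 = harm B - harm A.
  by rewrite /harm (sum_elts_split _ AB) addrAC subrr add0r.
have [/existsP[i Hi]|/existsPn far] := boolP [exists i : 'I_m, `|V (expR (rho * (i : nat)%:R) * s0)| <= alpha / 4].
  pose si := expR (rho * (i : nat)%:R) * s0.
  have si0 : s0 <= si by rewrite /si ler_peMl ?(ltW s0p) // -expR0 ler_expR mulr_ge0 ?(ltW rho0).
  have sip := lt_le_trans s0p si0.
  (* The points t = x/|h| lie in [si, e^rho si] exactly when |h| lies in [a, b]. *)
  pose b := x / si; pose a := expR (- rho) * b.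
  have b0 : 0 < b by rewrite divr_gt0.
  have bB : b <= B by rewrite /b ler_pdivrMr // mulrC {1}xE ler_wpM2r ?(ltW B0).
  have Aa : A <= a.
    rewrite /a /b mulrA ler_pdivlMr // xE /B /si.
    have -> : A * (expR (rho * (i : nat)%:R) * s0) = expR (rho * (i : nat)%:R) * (s0 * A) by ring.
    have -> : expR (- rho) * (s0 * (expR T * A)) = (expR (- rho) * expR T) * (s0 * A) by ring.
    apply: ler_wpM2r; first exact: mulr_ge0 (ltW s0p) (ltW Ap).
    rewrite -expRD ler_expR -rhom.
    have : (i : nat).+1%:R <= m%:R :> R by rewrite ler_nat.
    rewrite -natr1 -(ler_pM2l rho0) mulrDr mulr1; lra.
  have a1 := le_trans A1 Aa; have a0 := ge1_gt0 a1.
  have abE : b = expR rho * a by rewrite /a mulrA -expRD subrr expR0 mul1r.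
  have ab : a <= b by rewrite abE ler_peMl ?(ltW a0) // -expR0 ler_expR ltW.
  have rough h : A < nrm h -> nrm h <= B -> `|mertens (x / nrm h)| <= (alpha + ep) * x * (nrm h)^-1.
    move=> Ah hB; have [_ s0h _] := V_of h Ah hB.
    by rewrite -mulrA; apply: HX1; exact: le_trans Xs1 s0h.
  have fine h : a < nrm h -> nrm h <= b -> `|mertens (x / nrm h)| <= alpha / 2 * x * (nrm h)^-1.
    move=> ah hb; have [-> s0h _] := V_of h (le_lt_trans Aa ah) (le_trans hb bB).
    have h0 : 0 < nrm h by exact: asg_norm_gt0.
    rewrite -[leRHS]mulrA ler_wpM2r ?divr_ge0 ?(ltW xp) ?(ltW h0) //.
    have sih : si <= x / nrm h.
      by rewrite ler_pdivlMr // mulrC -ler_pdivlMr.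
    have hsi : x / nrm h <= expR rho * si.
      rewrite ler_pdivrMr // mulrAC -ler_pdivrMr // -/b abE.
      by rewrite ler_wpM2l ?expR_ge0 // ltW.
    have := Lip _ _ si0 sih hsi => Lp.
    have -> : V (x / nrm h) = (V (x / nrm h) - V si) + V si by ring.
    apply: le_trans (ler_normD _ _) _; apply: le_trans (lerD Lp Hi) _.
    by apply: eq_ler; field.
  rewrite (sum_elts_split_gt _ Aa (le_trans ab bB)) (sum_elts_split_gt _ ab bB).
  have d1 : \sum_(h <- elts a | A < nrm h) `|mertens (x / nrm h)| <= (alpha + ep) * x * (harm a - harm A).
    rewrite /harm (sum_elts_split _ Aa) addrAC subrr add0r mulr_sumr.
    rewrite big_seq_cond [leRHS]big_seq_cond; apply: ler_sum => h; rewrite mem_elts => /andP[ha Ah].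
    by apply: rough => //; apply: le_trans ha _; exact: le_trans ab bB.
  have d2 : \sum_(h <- elts b | a < nrm h) `|mertens (x / nrm h)| <= alpha / 2 * x * (harm b - harm a).
    rewrite /harm (sum_elts_split _ ab) addrAC subrr add0r mulr_sumr.
    rewrite big_seq_cond [leRHS]big_seq_cond; apply: ler_sum => h; rewrite mem_elts => /andP[hb ah].
    exact: fine.
  have d3 : \sum_(h <- elts B | b < nrm h) `|mertens (x / nrm h)| <= (alpha + ep) * x * (harm B - harm b).
    rewrite /harm (sum_elts_split _ bB) addrAC subrr add0r mulr_sumr.
    rewrite big_seq_cond [leRHS]big_seq_cond; apply: ler_sum => h; rewrite mem_elts => /andP[hB bh].
    by apply: rough => //; apply: le_lt_trans (le_trans Aa ab) bh.
  have e1 := HH A B A1 AB; have e2 := HH a b a1 ab.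
  have lnAB : ln (B / A) = T by rewrite /B mulfK ?gt_eqF // expRK.
  have lnab : ln (b / a) = rho by rewrite abE mulfK ?gt_eqF // expRK.
  rewrite lnAB in e1; rewrite lnab in e2.
  have {}e1 := le_trans e1 (HA0 A A0A).
  have {}e2 := le_trans e2 (HA0 a (le_trans A0A Aa)).
  rewrite kapE; apply: le_trans (lerD d1 (lerD d2 d3)) _.
  have -> : (alpha + ep) * x * (harm a - harm A) + (alpha / 2 * x * (harm b - harm a) + (alpha + ep) * x * (harm B - harm b))
     = ((alpha + ep) * (harm B - harm A) - (alpha / 2 + ep) * (harm b - harm a)) * x by field.
  rewrite ler_wpM2r ?(ltW xp) //.
  set H1 := harm B - harm A in e1 *; set H2 := harm b - harm a in e2 *.
  have H20 : 0 <= H2 by rewrite subr_ge0 le_harm.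
  move: e1 e2; rewrite !ler_norml => /andP[_ e1] /andP[e2 _].
  have f1 : (alpha + ep) * H1 <= (alpha + ep) * (c * T + c * rho / 16).
    apply: ler_wpM2l; first by rewrite addr_ge0 // ltW.
    by rewrite -lerBlDl.
  have f2 : alpha / 2 * (c * rho - c * rho / 16) <= alpha / 2 * H2.
    apply: ler_wpM2l; first by rewrite divr_ge0 // ltW.
    by rewrite addrC -lerBrDr.
  have f3 : 0 <= ep * H2 by rewrite mulr_ge0 // ltW.
  have f4 : ep * (c * T) = alpha * (c * rho) / 8 by rewrite /ep; field; rewrite gt_eqF.
  have f5 : ep <= alpha / 8.
    rewrite /ep ler_pdivrMr ?mulr_gt0 //.
    have -> : alpha / 8 * (8 * T) = alpha * T by field.
    by rewrite ler_pM2l.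
  have f6 : ep * (c * rho) <= alpha / 8 * (c * rho) by rewrite ler_wpM2r // mulr_ge0 // ltW.
  have f7 : 0 <= alpha * (c * rho) by rewrite !mulr_ge0 // ltW.
  move: f1 f2 f3 f4 f6 f7; clear.
  rewrite !(mulrDl, mulrDr, mulrBr, mulrBl) !mulrA [alpha * c]mulrC [ep * c]mulrC; lra.
have Lm : (0 < m)%N by [].
have far' i : (i < m)%N -> alpha / 4 < `|V (expR (rho * i%:R) * s0)|.
  by move=> im; have := far (Ordinal im); rewrite -ltNge.
have sgn := @grid_sign V s0 rho (alpha / 4) m s0p (ltW rho0) Lm Lip far'.
have W2 : \sum_(h <- elts B | A < nrm h) `|mertens (x / nrm h)| =
   `|\sum_(h <- elts B | A < nrm h) mertens (x / nrm h)|.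
  case: sgn => sgn.
    rewrite big_seq_cond [in RHS]big_seq_cond ger0_norm; last first.
      apply: sumr_ge0 => h /andP[]; rewrite mem_elts => hB Ah; have [_ h1 h2] := V_of h Ah hB.
      rewrite -rhom in h2; have := sgn _ h1 h2.
      by rewrite /V pmulr_lge0 // invr_gt0 divr_gt0 // asg_norm_gt0.
    apply: eq_bigr => h /andP[]; rewrite mem_elts => hB Ah; have [_ h1 h2] := V_of h Ah hB.
    rewrite -rhom in h2; have := sgn _ h1 h2.
    rewrite /V pmulr_lge0; first by move=> ?; rewrite ger0_norm.
    by rewrite invr_gt0 divr_gt0 // asg_norm_gt0.
  rewrite big_seq_cond [in RHS]big_seq_cond ler0_norm; last first.
    apply: sumr_le0 => h /andP[]; rewrite mem_elts => hB Ah; have [_ h1 h2] := V_of h Ah hB.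
    rewrite -rhom in h2; have := sgn _ h1 h2.
    by rewrite /V pmulr_lle0 // invr_gt0 divr_gt0 // asg_norm_gt0.
  rewrite -sumrN; apply: eq_bigr => h /andP[]; rewrite mem_elts => hB Ah; have [_ h1 h2] := V_of h Ah hB.
  rewrite -rhom in h2; have := sgn _ h1 h2.
  rewrite /V pmulr_lle0; first by move=> ?; rewrite ler0_norm.
  by rewrite invr_gt0 divr_gt0 // asg_norm_gt0.
rewrite W2.
have -> : \sum_(h <- elts B | A < nrm h) mertens (x / nrm h) =
    \sum_(h <- elts B) mertens (x / nrm h) - \sum_(h <- elts A) mertens (x / nrm h).
  by rewrite (sum_elts_split _ AB) addrAC subrr add0r.
apply: le_trans (ler_normB _ _) _.
apply: le_trans (lerD (HC1 x B x1 B1 Bx) (HC1 x A x1 A1 (le_trans AB Bx))) _.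
rewrite -mulrDl ler_wpM2r ?(ltW xp) // kapE.
have : c * alpha * rho <= c * alpha * T by rewrite ler_wpM2l // ltW.
have : c * alpha * T = c * T * alpha by ring.
move: TC C10; lra.
Qed.

End MertensCells.

(** * Descent on the upper limit of |M(x)|/x *)

Section MertensSublinear.
Context {R : realType} {P : countType} {N : P -> R} {asgN : arith_semigroup N}.
Context {c eta K : R} {axA : axiom_A N c eta K}.
Local Notation nrm := (asg_norm N).
Local Notation elts := (elts N).
Local Notation harm := (harm N).
Local Notation L := (logn_norm (N := N)).
Local Notation mertens := (mertens (N := N)).
Implicit Types (x y s t A B : R) (g h d k : {mset P}) (p q : P).

Let c0 : 0 < c. Proof. exact: density_gt0. Qed.
Let K0 : 0 <= K. Proof. exact: error_ge0. Qed.
Let eta1 : eta < 1. Proof. exact: exponent_lt1. Qed.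

Let norm_mertens_quot x h : nrm h <= x -> `|mertens (x / nrm h)| <= (c + K) * x * (nrm h)^-1.
Proof.
move=> hx; have h0 : 0 < nrm h by exact: asg_norm_gt0.
apply: le_trans (norm_mertens _) _; rewrite -mulrA; apply: cnt_le.
by rewrite divr_ge0 ?(ltW h0) // (le_trans (ltW h0)).
Qed.

(** In the cell from e^(Tj) to e^(T(j+1)) the weight L is at most T(j+1), so the cells add up to c
    (alpha - 2 kap) x ln^2 x / 2 to leading order. The 2 of [mertens_ineq] restores alpha - 2 kap,
    and one [kap] is spent on the terms of order x ln x. *)
Lemma mertens_descent alpha : 0 < alpha ->
  (forall e, 0 < e -> exists2 X, 1 <= X & forall x, X <= x -> `|mertens x| <= (alpha + e) * x) ->
  exists2 kap, 0 < kap &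
    exists2 X, 1 <= X & forall x, X <= x -> `|mertens x| <= (alpha - kap) * x.
Proof.
move=> al0 /(cell_bound al0)[T [kap [A0 [X0 [[T0 kap0 kapal] [A01 X01 Hcell]]]]]].
have [C C0 HC] := mertens_ineq (asgN := asgN) (axA := axA).
have [CH CH0 HH] := harm_diff (asgN := asgN) (axA := axA).
have ck0 : 0 <= c + K by rewrite addr_ge0 // ltW.
(* [cell_bound] starts at A0; what lies below e^(T j0) is bounded by Q x. *)
pose j0 : nat := (Num.trunc (ln A0 / T)).+1.
have Aj0 : A0 <= expR (T * j0%:R).
  rewrite -[leLHS]lnK ?posrE ?ge1_gt0 // ler_expR mulrC -ler_pdivrMr //.
  exact/ltW/truncnS_gt.
pose Q := (c + K) * \sum_(h <- elts (expR (T * j0%:R))) L h / nrm h.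
have Q0 : 0 <= Q.
  by rewrite mulr_ge0 //; apply: sumr_ge0 => h _; rewrite divr_ge0 ?logn_norm_ge0 ?asg_norm_ge0.
pose b := c * (alpha - 2 * kap).
have b0 : 0 <= b by rewrite mulr_ge0 ?(ltW c0) ?subr_ge0.
pose Z x y := \sum_(h <- elts y) L h * `|mertens (x / nrm h)|.
have Z0 x : expR (T * j0%:R) <= x -> Z x (expR (T * j0%:R)) <= Q * x.
  move=> ex; rewrite /Z /Q mulrAC mulr_sumr big_seq [leRHS]big_seq.
  apply: ler_sum => h; rewrite mem_elts => hx.
  apply: le_trans (_ : L h * ((c + K) * x * (nrm h)^-1) <= _); last by apply: eq_ler; ring.
  apply: ler_wpM2l; first exact: logn_norm_ge0.
  by rewrite norm_mertens_quot // (le_trans hx).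
have ZS x j : X0 * expR (T * (j0 + j)%:R) <= x ->
    Z x (expR (T * (j0 + j)%:R)) <= (Q + b * T ^+ 2 * ((j0 + j)%:R * ((j0 + j)%:R + 1) / 2)) * x.
  have X0p := ge1_gt0 X01.
  elim: j => [|j IH] Xx.
    have ex : expR (T * (j0 + 0)%:R) <= x.
      by apply: le_trans Xx; rewrite ler_peMl // expR_ge0.
    have xp : 0 < x by apply: lt_le_trans ex; exact: expR_gt0.
    rewrite addn0 in ex *; apply: le_trans (Z0 x ex) _.
    apply: ler_wpM2r; first exact: ltW.
    rewrite lerDl; apply: mulr_ge0; first exact: mulr_ge0 b0 (sqr_ge0 _).
    by apply: divr_ge0 => //; apply: mulr_ge0 => //; apply: addr_ge0.
  pose A := expR (T * (j0 + j)%:R).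
  have AS : expR (T * (j0 + j.+1)%:R) = expR T * A.
    by rewrite /A -expRD addnS -natr1; congr expR; ring.
  have eT1 : 1 <= expR T by rewrite -expR0 ler_expR ltW.
  have AB : A <= expR T * A by rewrite ler_peMl // expR_ge0.
  rewrite AS in Xx *.
  have XA : X0 * A <= x by apply: le_trans Xx; rewrite ler_wpM2l // ltW.
  have xp : 0 < x by apply: lt_le_trans XA; rewrite mulr_gt0 // expR_gt0.
  rewrite /Z (sum_elts_split _ AB) -/(Z x A).
  have A0A : A0 <= A.
    by apply: le_trans Aj0 _; rewrite ler_expR ler_wpM2l ?(ltW T0) // ler_nat leq_addr.
  have cell : \sum_(h <- elts (expR T * A) | A < nrm h) L h * `|mertens (x / nrm h)| <=
      T * ((j0 + j)%:R + 1) * (c * T * (alpha - 2 * kap) * x).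
    apply: le_trans (_ : T * ((j0 + j)%:R + 1) * \sum_(h <- elts (expR T * A) | A < nrm h) `|mertens (x / nrm h)| <= _); last first.
      apply: ler_wpM2l; first by rewrite mulr_ge0 ?(ltW T0) // addr_ge0.
      exact: Hcell.
    rewrite mulr_sumr big_seq_cond [leRHS]big_seq_cond; apply: ler_sum => h.
    rewrite mem_elts => /andP[hB _]; apply: ler_wpM2r => //.
    rewrite /logn_norm -[leRHS]expRK ler_ln ?posrE ?asg_norm_gt0 ?expR_gt0 //.
    by apply: le_trans hB _; rewrite /A -expRD ler_expR mulrDr mulr1 addrC.
  apply: le_trans (lerD (IH XA) cell) _.
  by apply: eq_ler; rewrite addnS -natr1 /b; field.
(* A cell must end below x/X0, so the logarithmic length from the last full cell to [x] is at most T
   + ln X0; there |M(t)| <= (c + K) t is enough. *)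
pose C' := (c + K) * (c * (T + ln X0) + CH).
have C'0 : 0 <= C' by rewrite mulr_ge0 // addr_ge0 // mulr_ge0 ?(ltW c0) // addr_ge0 ?(ltW T0) ?ln_ge0.
pose X1 := X0 * expR (T * j0%:R).
have X11 : 1 <= X1 by rewrite /X1 mulr_ege1 // -expR0 ler_expR mulr_ge0 ?(ltW T0).
have bound x : X1 <= x -> \sum_(h <- elts x) L h * `|mertens (x / nrm h)| <=
    (Q + b * (ln x ^+ 2 + T * ln x) / 2 + C' * ln x) * x.
  move=> X1x; have x1 := le_trans X11 X1x; have x0 := ge1_gt0 x1.
  have X0p := ge1_gt0 X01.
  pose l := ln (x / X0).
  have lE : l = ln x - ln X0 by rewrite /l ln_div ?posrE.
  have lj : T * j0%:R <= l.
    rewrite -[leLHS]expRK ler_ln ?posrE ?expR_gt0 ?divr_gt0 // ler_pdivlMr // mulrC //.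
  have l0 : 0 <= l by apply: le_trans lj; rewrite mulr_ge0 ?(ltW T0).
  pose J := Num.trunc (l / T).
  have /andP[J1 J2] := trunc_itv (divr_ge0 l0 (ltW T0)).
  rewrite -/J in J1 J2.
  have J1' : T * J%:R <= l by rewrite mulrC -ler_pdivlMr.
  have J2' : l <= T * J.+1%:R by rewrite mulrC -ler_pdivrMr // ltW.
  have j0J : (j0 <= J)%N.
    rewrite /J truncn_ge_nat ?divr_ge0 ?(ltW T0) //.
    by rewrite ler_pdivlMr // mulrC.
  have := ZS x (J - j0)%N; rewrite subnKC // => ZJ.
  pose A := expR (T * J%:R).
  have XA : X0 * A <= x.
    rewrite mulrC -ler_pdivlMr // -[leRHS]lnK ?posrE ?divr_gt0 //.
    by rewrite ler_expR.
  have A1 : 1 <= A by rewrite -expR0 ler_expR mulr_ge0 ?(ltW T0).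
  have Ap := ge1_gt0 A1.
  have Ax : A <= x by apply: le_trans XA; rewrite ler_peMl // ltW.
  rewrite (sum_elts_split _ Ax) mulrDl; apply: lerD.
    apply: le_trans (ZJ XA) _; apply: ler_wpM2r; first exact: ltW.
    have TJ : T * J%:R <= ln x by rewrite (le_trans J1') // lE lerBlDr lerDl ln_ge0.
    rewrite lerD2l (_ : b * T ^+ 2 * _ = b / 2 * ((T * J%:R) ^+ 2 + T * (T * J%:R))); last by field.
    rewrite [leRHS](_ : _ = b / 2 * (ln x ^+ 2 + T * ln x)); last by field.
    apply: ler_wpM2l; first by rewrite divr_ge0.
    apply: lerD; last by apply: ler_wpM2l => //; exact: ltW.
    by rewrite lerXn2r ?nnegrE ?ln_ge0 // mulr_ge0 // ltW.
  have lx0 := ln_ge0 x1.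
  apply: le_trans (_ : ln x * ((c + K) * x * (harm x - harm A)) <= _).
    rewrite /harm (sum_elts_split _ Ax) addrAC subrr add0r !mulr_sumr.
    rewrite big_seq_cond [leRHS]big_seq_cond; apply: ler_sum => h.
    rewrite mem_elts => /andP[hx _]; apply: ler_pM => //; first exact: logn_norm_ge0.
      by rewrite /logn_norm ler_ln ?posrE ?asg_norm_gt0.
    exact: norm_mertens_quot.
  have -> : C' * ln x * x = ln x * ((c + K) * x * (c * (T + ln X0) + CH)) by rewrite /C'; ring.
  apply: ler_wpM2l => //; apply: ler_wpM2l; first by rewrite mulr_ge0 // ltW.
  have := HH A x A1 Ax; rewrite ler_norml => /andP[_ h1].
  have h2 : CH * A `^ (eta - 1) <= CH.
    rewrite -[leRHS]mulr1 ler_wpM2l //.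
    by rewrite -[leRHS](powRr0 A) ler_powR // subr_le0 ltW.
  have h3 : c * ln (x / A) <= c * (T + ln X0).
    apply: ler_wpM2l; first exact: ltW.
    rewrite ln_div ?posrE // /A expRK; move: J2'; rewrite lE -natr1 mulrDr mulr1; lra.
  by move: h1 h2 h3; lra.
pose C'' := 2 * Q + b * T + 2 * C' + C.
have bT0 : 0 <= b * T by rewrite mulr_ge0 // ltW.
have C''0 : 0 <= C'' by move: Q0 bT0 C'0 C0; rewrite /C''; lra.
(* From ln x = l1 on, the lower-order terms C'' (1 + ln x) are at most c kap ln^2 x. *)
exists kap => //; pose l1 := 1 + 2 * C'' / (c * kap).
have ckap : 0 < c * kap by rewrite mulr_gt0.
exists (Num.max X1 (expR l1)); first by rewrite le_max X11.
move=> x; rewrite ge_max => /andP[X1x lx].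
have x1 := le_trans X11 X1x; have x0 := ge1_gt0 x1.
have {}lx : l1 <= ln x by rewrite -[leLHS]expRK ler_ln ?posrE ?expR_gt0.
have l11 : 1 <= l1 by rewrite lerDl divr_ge0 ?mulr_ge0 // ltW.
have lx1 := le_trans l11 lx; have lx0 := ge1_gt0 lx1.
have key : c * (ln x ^+ 2 * `|mertens x|) <= (b * ln x ^+ 2 + C'' * (1 + ln x)) * x.
  apply: le_trans (HC x x1) _; have := bound x X1x.
  set W := \sum_(h <- _) _; move=> hW.
  have {}hW : 2 * W <= 2 * ((Q + b * (ln x ^+ 2 + T * ln x) / 2 + C' * ln x) * x) by rewrite ler_wpM2l.
  apply: le_trans (lerD hW (lexx _)) _.
  have -> : 2 * ((Q + b * (ln x ^+ 2 + T * ln x) / 2 + C' * ln x) * x) + C * (x * (1 + ln x)) =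
    (b * ln x ^+ 2 + (2 * Q + (b * T) * ln x + 2 * C' * ln x + C * (1 + ln x))) * x by field.
  rewrite ler_wpM2r ?(ltW x0) // lerD2l /C''.
  have m1 : 0 <= Q * ln x by rewrite mulr_ge0 // ltW.
  rewrite -subr_ge0 (_ : _ - _ = 2 * (Q * ln x) + b * T + 2 * C'); last by ring.
  by move: m1 bT0 C'0; lra.
have key2 : C'' * (1 + ln x) <= c * kap * ln x ^+ 2.
  apply: le_trans (_ : C'' * (2 * ln x) <= _); first by rewrite ler_wpM2l //; lra.
  have -> : c * kap * ln x ^+ 2 = (c * kap * ln x) * ln x by ring.
  rewrite mulrA ler_wpM2r ?(ltW lx0) //.
  apply: le_trans (_ : c * kap * l1 <= _); last by rewrite ler_wpM2l // ltW.
  have -> : c * kap * l1 = c * kap + C'' * 2.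
    by rewrite /l1; field; rewrite !gt_eqF.
  by rewrite lerDr ltW.
have lx2 : 0 < ln x ^+ 2 by rewrite exprn_gt0.
rewrite -(ler_pM2l (mulr_gt0 c0 lx2)) -mulrA; apply: le_trans key _.
have -> : c * ln x ^+ 2 * ((alpha - kap) * x) = (b * ln x ^+ 2 + c * kap * ln x ^+ 2) * x.
  by rewrite /b; ring.
by rewrite ler_wpM2r ?(ltW x0) // lerD2l.
Qed.

(** [alpha] is the upper limit of |M(x)|/x, taken as the infimum of the eventual bounds; were it
    positive, [mertens_descent] would undercut it. *)
Theorem mertens_sublinear : sublinear mertens.
Proof.
pose E := [set a : R | exists2 X, 1 <= X & forall x, X <= x -> `|mertens x| <= a * x]%classic.
have lbE : lbound E 0.
  move=> a [X X1 H]; have := le_trans (normr_ge0 _) (H X (lexx _)).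
  by rewrite pmulr_lge0 // ge1_gt0.
have E0 : (E !=set0)%classic.
  exists (c + K); exists 1 => // x x1.
  exact: le_trans (norm_mertens _) (cnt_le (ge1_ge0 x1)).
have hE : has_inf E by split=> //; exists 0.
pose alpha := inf E.
have close e : 0 < e -> exists2 X, 1 <= X & forall x, X <= x -> `|mertens x| <= (alpha + e) * x.
  move=> e0; have [a [X X1 H] ae] := inf_adherent e0 hE.
  exists X => // x Xx; apply: le_trans (H x Xx) _.
  by rewrite ler_wpM2r ?(ltW ae) // ge1_ge0 // (le_trans X1).
have [al0|al0] := leP alpha 0.
  move=> e /close[X X1 H]; exists X => // x Xx; apply: le_trans (H x Xx) _.
  by rewrite ler_wpM2r ?gerDr // ge1_ge0 // (le_trans X1).
have [kap kap0 Hk] := mertens_descent al0 close.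
have : alpha <= alpha - kap by apply: ge_inf => //; exists 0.
by move=> ?; exfalso; lra.
Qed.

End MertensSublinear.

(** * Smooth and rough elements *)

Section Sieve.
Context {R : realType} {P : countType} {N : P -> R} {asgN : arith_semigroup N}.
Context {c eta K : R} {axA : axiom_A N c eta K}.
Local Notation nrm := (asg_norm N).
Local Notation elts := (elts N).
Local Notation dact := (dact (N := N)).
Local Notation cnt := (cnt N).
Local Notation harm := (harm N).
Local Notation one := (fun=> 1).
Local Notation L := (logn_norm (N := N)).
Local Notation Lam := (vonM (N := N)).
Local Notation mertens := (mertens (N := N)).
Implicit Types (x y s t A B : R) (g h d k : {mset P}) (p q : P) (Q : pred P).

Let c0 : 0 < c. Proof. exact: density_gt0. Qed.
Let K0 : 0 <= K. Proof. exact: error_ge0. Qed.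
Let eta1 : eta < 1. Proof. exact: exponent_lt1. Qed.

Lemma finite_primes_le x : finite_set [set p | N p <= x].
Proof.
have -> : [set p | N p <= x] = (fun p => [mset p]) @^-1` [set g : {mset P} | nrm g <= x].
  by apply/seteqP; split=> p /=; rewrite asg_norm1.
apply: finite_preimage; last exact: finite_norm_le.
by move=> p q _ _; exact: msetn_inj.
Qed.

Definition primes_le x : seq P := fset_set [set p | N p <= x].

Lemma mem_primes_le x p : (p \in primes_le x) = (N p <= x).
Proof.
rewrite /primes_le in_fset_set; last exact: finite_primes_le.
by apply/idP/idP; rewrite inE.
Qed.

Lemma primes_le_uniq x : uniq (primes_le x). Proof. exact: fset_uniq. Qed.

Lemma le_sum_primes x (F : P -> R) (F' : {mset P} -> R) :
  (forall p, F p <= F' [mset p]) -> (forall g, 0 <= F' g) ->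
  \sum_(p <- primes_le x) F p <= \sum_(g <- elts x) F' g.
Proof.
move=> FF F'0.
apply: le_trans (_ : \sum_(g <- [seq [mset p] | p <- primes_le x]) F' g <= _).
  by rewrite big_map; apply: ler_sum => p _; exact: FF.
pose l := [seq g <- elts x | g \in [seq [mset p] | p <- primes_le x]].
have -> : \sum_(g <- [seq [mset p] | p <- primes_le x]) F' g = \sum_(g <- l) F' g.
  apply: perm_big; apply: uniq_perm.
  - by rewrite map_inj_uniq ?primes_le_uniq // => p q; exact: msetn_inj.
  - exact/filter_uniq/elts_uniq.
  move=> g; rewrite mem_filter; case: (boolP (g \in _)) => //= /mapP[p].
  by rewrite mem_primes_le => px ->; rewrite mem_elts asg_norm1 px.
rewrite big_filter [leRHS](bigID (fun g => g \in [seq [mset p] | p <- primes_le x])) /=.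
by rewrite lerDl sumr_ge0.
Qed.

Lemma vonM1 p : Lam [mset p] = ln (N p).
Proof.
rewrite /vonM finsupp_msetn /= big_seq_fset1 msetnxx eqxx //.
Qed.

Lemma dvd1E p g : ([mset p] `<=` g)%mset = (0 < g p)%N.
Proof.
apply/msubsetP/idP => [/(_ p)|gp q]; first by rewrite msetnxx.
by rewrite msetnE; case: eqP => // ->.
Qed.

Lemma sum_split_prime (V : nmodType) x p (F : {mset P} -> V) :
  \sum_(g <- elts x) F g =
  \sum_(g <- elts x | g p == 0%N) F g + \sum_(k <- elts (x / N p)) F (p +` k).
Proof.
rewrite (bigID (fun g : {mset P} => g p == 0%N)) /=; congr (_ + _).
rewrite -(asg_norm1 p) -sum_multiples; apply: eq_bigl => g.
by rewrite dvd1E lt0n.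
Qed.

Lemma eq_ind Q1 Q2 g : Q1 =1 Q2 -> ind (R := R) Q1 g = ind Q2 g.
Proof. by move=> E; rewrite /ind /supp_in (eq_all E). Qed.

Lemma ind0 Q : ind (R := R) Q mset0 = 1.
Proof. by rewrite /ind supp_in0. Qed.

Lemma indD1 Q p g : ind (R := R) Q (p +` g) = (Q p)%:R * ind Q g.
Proof. by rewrite /ind supp_inD supp_in1; case: (Q p); rewrite ?mul1r ?mul0r. Qed.

(* The powers of [p]: T = (1 + T(x/p)) / p <= (1 + T) / p. *)
Lemma sum_prime_powers p x :
  \sum_(d <- elts x | (0 < d p)%N && (d == msetn (d p) p)) (nrm d)^-1 <= (N p - 1)^-1.
Proof.
set T := \sum_(d <- _ | _) _.
have p1 : 1 < N p by exact: norm_prime_gt1.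
have [x1|x1] := ltP x 1.
  by rewrite /T elts_lt1 // big_nil invr_ge0 subr_ge0 ltW.
have p0 : 0 < N p by exact: norm_prime_gt0.
have TE y : \sum_(d <- elts y | (0 < d p)%N && (d == msetn (d p) p)) (nrm d)^-1 =
    (N p)^-1 * \sum_(d <- elts (y / N p) | d == msetn (d p) p) (nrm d)^-1.
  rewrite big_mkcondr /= (eq_bigl (fun d => ([mset p] `<=` d)%mset)); last by move=> d; rewrite dvd1E.
  rewrite sum_multiples asg_norm1 [in RHS]big_mkcond mulr_sumr; apply: eq_bigr => d _.
  rewrite mset1DE eqxx asg_normD asg_norm1 invfM.
  have -> : (p +` d == msetn (true + d p)%N p) = (d == msetn (d p) p).
    apply/eqP/eqP => [/(congr1 (msetB^~ [mset p]))|dE].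
      rewrite msetD1K => dE; apply/msetP => q; rewrite {1}dE msetB1E !msetnE.
      by case: eqP => _; rewrite ?subn0 // add1n subn1.
    rewrite {1}dE; apply/msetP => q; rewrite mset1DE !msetnE.
    by case: eqP.
  by case: ifP => _; rewrite ?mulr0.
have Tx : \sum_(d <- elts (x / N p) | d == msetn (d p) p) (nrm d)^-1 <= 1 + T.
  rewrite (bigID (fun d : {mset P} => (0 < d p)%N)) /= addrC; apply: lerD.
    rewrite -big_filter; set l := [seq _ <- _ | _].
    apply: le_trans (_ : \sum_(d <- l) 1 <= _).
      by apply: ler_sum => d _; rewrite invf_le1 ?asg_norm_gt0 ?asg_norm_ge1.
    rewrite big_const_seq count_predT iter_addr_0 lern1.
    have lu : uniq l by exact/filter_uniq/elts_uniq.
    apply: (@uniq_leq_size _ l [:: mset0] lu) => d.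
    rewrite mem_filter => /andP[/andP[/eqP dE]]; rewrite -eqn0Ngt => /eqP d0 _.
    by rewrite mem_seq1 dE d0 msetn0.
  pose F (d : {mset P}) := if (0 < d p)%N && (d == msetn (d p) p) then (nrm d)^-1 else 0.
  apply: le_trans (_ : \sum_(d <- elts (x / N p)) F d <= _).
    by rewrite big_mkcond; apply: ler_sum => d _; rewrite /F andbC.
  rewrite /T [leRHS]big_mkcond; apply: le_sum_elts.
    by rewrite ler_pdivrMr // ler_peMr ?(ge1_ge0 x1) // ltW.
  by move=> g; rewrite /F; case: ifP => // _; rewrite invr_ge0 asg_norm_ge0.
have : N p * T <= 1 + T by rewrite {1}/T TE mulrA divff ?mul1r ?gt_eqF.
rewrite -[(N p - 1)^-1]mul1r ler_pdivlMr ?subr_gt0 //; lra.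
Qed.

(** Summing the powers of each prime leaves the sum of ln (N p)/(N p - 1) over N p <= y, uniformly
    in [x]; [dom_mertens] at y bounds it. *)
Lemma dom_sum_smooth_vonM : exists2 C, 0 <= C & forall x y, 1 <= y ->
  \sum_(d <- elts x) ind (fun q => N q <= y) d * Lam d / nrm d <= C * (1 + ln y).
Proof.
have [C C0 HC] := dom_mertens (asgN := asgN) (axA := axA).
exists (cnt 2 + 2 * C); first by rewrite addr_ge0 ?cnt_ge0 ?mulr_ge0.
move=> x y y1.
apply: le_trans (_ : \sum_(p <- primes_le y) ln (N p) / (N p - 1) <= _).
  apply: le_trans (_ : \sum_(d <- elts x) \sum_(p <- primes_le y)
     (if (0 < d p)%N && (d == msetn (d p) p) then ln (N p) / nrm d else 0) <= _).
    apply: ler_sum => d _; rewrite /ind; case: (boolP (supp_in _ d)) => [/supp_inP dy|_]; last first.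
      rewrite !mul0r; apply: sumr_ge0 => p _; case: ifP => // _.
      by rewrite divr_ge0 ?asg_norm_ge0 // ln_ge0 // norm_prime_ge1.
    rewrite mul1r /vonM mulr_suml.
    pose F p := if d == msetn (d p) p then ln (N p) / nrm d else 0.
    rewrite (eq_bigr F); last by move=> p _; rewrite /F; case: ifP => // _; rewrite mul0r.
    rewrite [leRHS](eq_bigr (fun p => if (0 < d p)%N then F p else 0)); last first.
      by move=> p _; rewrite /F; case: (0 < d p)%N.
    rewrite -[leRHS]big_mkcond -[leRHS]big_filter; apply: eq_ler; apply: perm_big.
    apply: uniq_perm; first exact: fset_uniq.
      exact/filter_uniq/primes_le_uniq.
    move=> p; rewrite mem_filter mem_primes_le mem_gt0.
    by case: (boolP (0 < d p)%N) => //= /dy.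
  rewrite exchange_big /=; apply: ler_sum => p _; rewrite -big_mkcond.
  rewrite -mulr_sumr ler_wpM2l ?sum_prime_powers //.
  exact/ln_ge0/norm_prime_ge1.
(* Norms may be close to 1, where 1/(N p - 1) is large. There ln (N p) <= N p - 1 is used, and at
   most [cnt 2] primes are concerned. *)
have small p : ln (N p) / (N p - 1) <= (if N p <= 2 then 1 else 0) + 2 * (Lam [mset p] / nrm [mset p]).
  have p1 : 1 < N p by exact: norm_prime_gt1.
  have p0 : 0 < N p by exact: norm_prime_gt0.
  have l0 : 0 <= ln (N p) by rewrite ln_ge0 // ltW.
  rewrite vonM1 asg_norm1; case: (leP (N p) 2) => p2.
    apply: (@le_trans _ _ 1); last by rewrite lerDl mulr_ge0 // divr_ge0 // ltW.
    by rewrite ler_pdivrMr ?subr_gt0 // mul1r lnB1.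
  rewrite add0r mulrCA ler_wpM2l // -[2]invrK -invfM lef_pV2 ?posrE ?mulr_gt0 ?subr_gt0 //.
  by lra.
apply: le_trans (ler_sum _ (fun p _ => small p)) _.
rewrite big_split /= mulrDl; apply: lerD.
  apply: (@le_trans _ _ (cnt 2)).
    rewrite -big_mkcond -big_filter; set l := [seq _ <- _ | _].
    apply: (@le_trans _ _ (\sum_(p <- primes_le 2) (1 : R))).
      rewrite !big_const_seq !count_predT !iter_addr_0 ler_nat.
      apply: uniq_leq_size; first exact/filter_uniq/primes_le_uniq.
      by move=> p; rewrite mem_filter !mem_primes_le => /andP[].
    exact: (@le_sum_primes 2 (fun=> 1) (fun=> 1)).
  by rewrite ler_peMr ?cnt_ge0 // lerDl ln_ge0.
rewrite -mulr_sumr -mulrA ler_wpM2l //.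
apply: le_trans (_ : \sum_(g <- elts y) Lam g / nrm g <= _).
  by apply: (@le_sum_primes y _ (fun g => Lam g / nrm g)) => // g; rewrite divr_ge0 ?vonM_ge0 ?asg_norm_ge0.
by apply: le_trans (HC y y1) _; rewrite ler_wpM2l // lerDr.
Qed.

Definition smooth y : pred P := fun q => N q <= y.
Definition rough y : pred P := fun q => y < N q.

Lemma predC_rough y : predC (rough y) =1 smooth y.
Proof. by move=> q; rewrite /= /rough /smooth -leNgt. Qed.

Definition countQ Q x : R := \sum_(g <- elts x) ind Q g.

Lemma countQ_ge0 Q x : 0 <= countQ Q x.
Proof. by apply: sumr_ge0 => g _; exact: ind_ge0. Qed.

Lemma ind_le1 Q g : ind (R := R) Q g <= 1.
Proof. by rewrite /ind lern1 leq_b1. Qed.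

Lemma countQ_le Q x : countQ Q x <= cnt x.
Proof. by apply: ler_sum => g _; exact: ind_le1. Qed.

Lemma countQE Q x : dact (ind Q) one x = countQ Q x.
Proof. by apply: eq_bigr => g _; rewrite mulr1. Qed.

(** ln x = ln (x/|g|) + L(g), and L is the convolution of 1 and Lam. Divisors of smooth elements are
    smooth, so only smooth prime powers enter, and the sum of Lam(d)/|d| over them is O(1 + ln y)
    instead of O(ln x). *)
Lemma smooth_count : exists2 C, 0 <= C & forall x y, 1 <= x -> 1 <= y ->
  countQ (smooth y) x * ln x <= C * (1 + ln y) * x.
Proof.
have [C1 C10 H1] := @dom_dact_ln _ _ _ asgN c eta K axA (fun=> 1) (fun=> eq_ler (normr1 R)).
have [C2 C20 H2] := dom_sum_smooth_vonM.
exists (C1 + (c + K) * C2); first by rewrite addr_ge0 // mulr_ge0 // addr_ge0 // ltW.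
move=> x y x1 y1; have x0 := ge1_gt0 x1.
rewrite mulrC -countQE (ln_dact _ _ x0).
have ly1 : 1 <= 1 + ln y by rewrite lerDl ln_ge0.
rewrite addrC -mulrA mulrDl; apply: lerD.
  apply: le_trans (_ : C1 * x <= _).
    apply: le_trans (le_trans (ler_norm _) (H1 x x1)).
    rewrite /dact big_seq [leRHS]big_seq; apply: ler_sum => g; rewrite mem_elts mulr1 => gx.
    apply: ler_wpM2r; last exact: ind_le1.
    by rewrite ln_ge0 // ler_pdivlMr ?asg_norm_gt0 // mul1r.
  by rewrite ler_wpM2l // ler_peMl // ltW.
have -> : dact (fun g => ind (smooth y) g * L g) one x =
    \sum_(d <- elts x) \sum_(k <- elts (x / nrm d)) ind (smooth y) d * Lam d * ind (smooth y) k.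
  rewrite (sum_pairs x (fun d k => ind (smooth y) d * Lam d * ind (smooth y) k)).
  apply: eq_bigr => g _; rewrite mulr1 -sum_vonM mulr_sumr big_seq [RHS]big_seq.
  apply: eq_bigr => d; rewrite mem_divs => dg.
  rewrite mulrAC; congr (_ * _); rewrite /ind -natrM mulnb -supp_inD.
  by rewrite msetBDKC.
apply: le_trans (_ : \sum_(d <- elts x) (c + K) * x * (ind (smooth y) d * Lam d / nrm d) <= _).
  rewrite big_seq [leRHS]big_seq; apply: ler_sum => d; rewrite mem_elts => dx.
  have d0 : 0 < nrm d by exact: asg_norm_gt0.
  rewrite -mulr_sumr [leRHS]mulrC -!mulrA; apply: ler_wpM2l; first exact: ind_ge0.
  apply: ler_wpM2l; first exact: vonM_ge0.
  apply: le_trans (countQ_le _ _) _; apply: le_trans (cnt_le _) _.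
    by rewrite divr_ge0 // ltW.
  by apply: eq_ler; ring.
rewrite -mulr_sumr [leRHS](_ : _ = (c + K) * x * (C2 * (1 + ln y))); last by ring.
apply: ler_wpM2l; last exact: H2.
by apply: mulr_ge0; [rewrite addr_ge0 // ltW|exact: ltW].
Qed.

Lemma sublinear_smooth_count y : 1 <= y -> sublinear (countQ (smooth y)).
Proof.
move=> y1; have [C C0 H] := smooth_count.
have : sublinear (fun x => C * (1 + ln y) * x / ln x).
  apply: sublin_mul_invln; exists (C * (1 + ln y)); first by rewrite mulr_ge0 // addr_ge0 // ln_ge0.
  move=> x x1; rewrite ger0_norm // !mulr_ge0 ?addr_ge0 ?ln_ge0 ?(ge1_ge0 x1) //.
move=> Hs e e0; have [X X1 HX] := Hs e e0.
exists (X + 1); first by rewrite lerDr (le_trans ler01).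
move=> x Xx; have x1 : 1 < x by apply: lt_le_trans Xx; rewrite ltrDr ge1_gt0.
have xX : X <= x by apply: le_trans Xx; rewrite lerDl.
apply: le_trans (HX x xX); apply: le_trans (ler_norm _).
rewrite ger0_norm ?countQ_ge0 // ler_pdivlMr ?ln_gt0 //.
by apply: H => //; exact: ltW.
Qed.

Lemma countQ_cons (l : seq P) p x : p \notin l ->
  countQ (predC (mem (p :: l))) x = countQ (predC (mem l)) x - countQ (predC (mem l)) (x / N p).
Proof.
move=> pl; rewrite {2}/countQ (sum_split_prime x p).
rewrite [X in _ = _ + X - _](_ : _ = countQ (predC (mem l)) (x / N p)) ?addrK; last first.
  by apply: eq_bigr => k _; rewrite indD1 /= pl mul1r.
rewrite /countQ [RHS]big_mkcond; apply: eq_bigr => g _.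
rewrite /ind; case: (posnP (g p)) => gp; last first.
  rewrite (_ : supp_in _ g = false) //; apply/supp_inP => /(_ p gp).
  by rewrite /= inE eqxx.
congr (_%:R); congr nat_of_bool.
apply/supp_inP/supp_inP => H q gq; have := H q gq; rewrite /= inE ?negb_or.
  by case/andP.
move=> ->; rewrite andbT; apply/eqP => qp; by rewrite qp gp in gq.
Qed.

(** Forbidding one more prime subtracts its multiples, which scales the density by 1 - 1/(N p). *)
Lemma countQ_density (l : seq P) : uniq l ->
  exists kap, sublinear (fun x => countQ (predC (mem l)) x - kap * x).
Proof.
elim: l => [_|p l IH /= /andP[pl /IH[kap Hk]]].
  exists c; apply: (@eq_sublin _ (fun x => cnt x - c * x)).
    move=> x _; congr (_ - _); apply: eq_bigr => g _.
    by rewrite /ind (_ : supp_in _ g = true) //; apply/supp_inP.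
  by apply: dom_sublin eta1 _; exists K => // x x1; exact: count_approx.
exists (kap * (1 - (N p)^-1)).
have Hp : sublinear (fun x => countQ (predC (mem l)) (x / N p) - kap * (x / N p)).
  move=> e e0; have [X X1 HX] := Hk e e0.
  have p1 : 1 < N p by exact: norm_prime_gt1.
  have p0 : 0 < N p by exact: norm_prime_gt0.
  exists (X * N p); first by rewrite mulr_ege1 // ltW.
  move=> x Xx; have xX : X <= x / N p by rewrite ler_pdivlMr.
  apply: le_trans (HX _ xX) _; rewrite ler_wpM2l ?(ltW e0) //.
  rewrite ler_pdivrMr // ler_peMr ?(ltW p1) //.
  by apply: le_trans Xx; rewrite mulr_ge0 ?(ltW p0) ?(ge1_ge0 X1).
apply: eq_sublin (sublinB Hk Hp) => x x1; rewrite countQ_cons //; ring.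
Qed.

Lemma harm_unbounded B : exists2 y, 1 <= y & B <= harm y.
Proof.
have [g [C C0 H]] := harm_asymp (asgN := asgN) (axA := axA).
pose l := (`|B| + `|g| + C) / c.
have l0 : 0 <= l by rewrite divr_ge0 ?addr_ge0 // ltW.
have y1 : 1 <= expR l by rewrite -expR0 ler_expR.
exists (expR l) => //; have := H _ y1; rewrite expRK ler_norml => /andP[h _].
have : expR l `^ (eta - 1) <= 1 by rewrite -[leRHS](powRr0 (expR l)) ler_powR // subr_le0 ltW.
move=> h2; have {}h2 : C * expR l `^ (eta - 1) <= C by rewrite -[leRHS]mulr1 ler_wpM2l.
have h3 : c * l = `|B| + `|g| + C by rewrite /l; field; rewrite gt_eqF.
have := ler_norm B; have := lerNnormlW (lexx `|g|); rewrite h3 in h; lra.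
Qed.

Lemma rough_countE y x : countQ (rough y) x = countQ (predC (mem (primes_le y))) x.
Proof.
apply: eq_bigr => g _; apply: eq_ind => q.
by rewrite /= mem_primes_le /rough ltNge.
Qed.

(* If rough numbers had density [kap], decomposing by smooth part gives
   [cnt x >= kap x \sum_(s <= y) 1/s]. *)
Lemma rough_count_small e : 0 < e -> exists2 y, 1 <= y &
  exists2 X, 1 <= X & forall x, X <= x -> countQ (rough y) x <= e * x.
Proof.
(* harm y >= 1 + B forces (e/2) harm y > c + K, which will contradict [cnt_le]. *)
move=> e0; pose B := 2 * (c + K) / e.
have B0 : 0 <= B by rewrite divr_ge0 ?mulr_ge0 ?addr_ge0 // ltW.
have [y y1 Hy] := harm_unbounded (1 + B); exists y => //.
have h0 : 0 < harm y by apply: lt_le_trans Hy; rewrite ltr_pwDl.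
have [kap Hk] := countQ_density (primes_le_uniq y).
have e20 : 0 < e / 4 by rewrite divr_gt0.
have [X X1 HX] := Hk _ e20.
have Hr x : X <= x -> `|countQ (rough y) x - kap * x| <= e / 4 * x.
  by move=> Xx; rewrite rough_countE; exact: HX.
have y0 := ge1_gt0 y1.
suff kap_small : kap <= 3 / 4 * e.
  exists X => // x Xx; have x0 := lt_le_trans (ge1_gt0 X1) Xx.
  have := Hr x Xx; rewrite ler_norml => /andP[_ h].
  have := ler_wpM2r (ltW x0) kap_small; lra.
rewrite leNgt; apply/negP => kap_big.
(* Every |h| <= y then leaves x/|h| >= X. *)
pose x := X * y; have x1 : 1 <= x by rewrite mulr_ege1.
have x0 := ge1_gt0 x1.
have yx : y <= x by rewrite ler_peMl // ltW.
have h1 : \sum_(h <- elts y) countQ (rough y) (x / nrm h) <= cnt x.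
  apply: le_trans (_ : \sum_(h <- elts x) \sum_(k <- elts (x / nrm h)) (ind (smooth y) h * ind (rough y) k) <= _).
    rewrite [leRHS](sum_elts_split _ yx) ler_wpDr //.
      by apply: sumr_ge0 => h _; apply: sumr_ge0 => k _; rewrite mulr_ge0 ?ind_ge0.
    rewrite big_seq [leRHS]big_seq; apply: ler_sum => h; rewrite mem_elts => sy.
    have -> : ind (smooth y) h = 1 :> R.
      rewrite /ind (_ : supp_in _ h = true) //; apply/supp_inP => q sq.
      rewrite /smooth; apply: le_trans sy; rewrite -asg_norm1.
      by apply: asg_norm_dvd; rewrite dvd1E.
    by apply: ler_sum => k _; rewrite mul1r.
  rewrite (sum_pairs x (fun h k => ind (smooth y) h * ind (rough y) k)).
  apply: ler_sum => g _.
  have gg : (g `<=` g)%mset by exact: msubset_refl.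
  (* The part of [g] made of primes up to [y] is its only smooth divisor with rough cofactor, so
     each [g] is counted at most once. *)
  pose s0 : {mset P} := [mset[msetn_key] q in finsupp g => if N q <= y then g q else 0%N].
  have s0E q : s0 q = if N q <= y then g q else 0%N.
    rewrite fsfun_fun mem_gt0; case: (posnP (g q)) => [->|//]; by case: ifP.
  have s0g : (s0 `<=` g)%mset by apply/msubsetP => q; rewrite s0E; case: ifP.
  rewrite (bigD1_seq s0) ?divs_uniq ?mem_divs //= big_seq_cond big1 ?addr0.
    have := ler_pM (ind_ge0 _ _) (ind_ge0 _ _) (ind_le1 (smooth y) s0) (ind_le1 (rough y) (g `\` s0)).
    by rewrite mulr1.
  move=> d /andP[]; rewrite mem_divs => /msubsetP dg ds0.
  rewrite /ind -natrM mulnb; case: andP => // -[/supp_inP ds /supp_inP dr].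
  case/eqP: ds0; apply/msetP => q; rewrite s0E; case: leP => qy.
    have := dr q; rewrite msetE2 subn_gt0 /rough ltNge qy.
    by case: ltngtP (dg q) => // _ _ /(_ isT).
  by have := ds q; rewrite /smooth leNgt qy; case: (d q) => // n /(_ isT).
have h2 : (kap - e / 4) * x * harm y <= \sum_(h <- elts y) countQ (rough y) (x / nrm h).
  rewrite mulr_sumr big_seq [leRHS]big_seq; apply: ler_sum => h; rewrite mem_elts => sy.
  have Xs : X <= x / nrm h.
    by rewrite ler_pdivlMr ?asg_norm_gt0 // ler_wpM2l // (ge1_ge0 X1).
  by have := Hr _ Xs; rewrite ler_norml => /andP[hl _]; rewrite -mulrA mulrBl; lra.
have h3 : (kap - e / 4) * x * harm y <= (c + K) * x.
  exact: le_trans (le_trans h2 h1) (cnt_le (ltW x0)).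
have {}h3 : (kap - e / 4) * harm y <= c + K by rewrite -(ler_pM2r x0); apply: le_trans h3; apply: eq_ler; ring.
have h4 : e / 2 * (1 + B) <= (kap - e / 4) * harm y.
  by apply: ler_pM => //; [rewrite divr_ge0 // ltW|rewrite addr_ge0|move: kap_big; lra].
have h5 : e / 2 * (1 + B) = e / 2 + (c + K) by rewrite /B; field; rewrite gt_eqF.
by move: e0 h3 h4; rewrite h5; lra.
Qed.

(** A finite Euler product: splitting off [p] gives T <= B + T/(N p), because shortening the range
    to x/(N p) only decreases the sum. *)
Lemma sum_smooth_bounded (l : seq P) : uniq l ->
  exists2 B, 0 <= B & forall x, \sum_(g <- elts x) ind (mem l) g / nrm g <= B.
Proof.
elim: l => [_|p l IH /= /andP[pl /IH[B B0 HB]]].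
  exists 1 => // x; have [x1|x1] := ltP x 1; first by rewrite elts_lt1 // big_nil.
  rewrite (bigD1_seq mset0) ?elts_uniq ?mem_elts ?asg_norm0 //= big1 ?addr0.
    by rewrite ind0 divr1.
  move=> g g0; rewrite (@eq_ind _ pred0) // /ind supp_in_pred0 (negPf g0) mul0r //.
have p1 : 1 < N p by exact: norm_prime_gt1.
have p0 : 0 < N p by exact: norm_prime_gt0.
have r0 : 0 < 1 - (N p)^-1 by rewrite subr_gt0 invf_lt1.
exists (B / (1 - (N p)^-1)); first by rewrite divr_ge0 // ltW.
move=> x; have [x1|x1] := ltP x 1.
  by rewrite elts_lt1 // big_nil divr_ge0 // ltW.
set T := \sum_(g <- elts x) _.
have TE : T <= B + (N p)^-1 * T.
  rewrite {1}/T (sum_split_prime x p); apply: lerD.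
    apply: le_trans (HB x); rewrite big_mkcond; apply: ler_sum => g _.
    case: eqP => gp; last by rewrite divr_ge0 ?ind_ge0 ?asg_norm_ge0.
    rewrite ler_wpM2r ?invr_ge0 ?asg_norm_ge0 // /ind ler_nat.
    case: (boolP (supp_in _ g)) => //= /supp_inP H.
    rewrite (_ : supp_in (mem l) g) //; apply/supp_inP => q gq.
    by have := H q gq; rewrite inE => /orP[/eqP qp|//]; rewrite qp gp in gq.
  apply: le_trans (_ : (N p)^-1 * \sum_(g <- elts (x / N p)) ind (mem (p :: l)) g / nrm g <= _).
    rewrite mulr_sumr; apply: ler_sum => g _.
    have hp : mem (p :: l) p by exact: mem_head.
    by rewrite indD1 hp mul1r asg_normD asg_norm1 invfM mulrCA.
  rewrite ler_wpM2l ?invr_ge0 ?(ltW p0) //; apply: le_sum_elts.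
    by rewrite ler_pdivrMr // ler_peMr ?(ge1_ge0 x1) // ltW.
  by move=> g; rewrite divr_ge0 ?ind_ge0 ?asg_norm_ge0.
rewrite ler_pdivlMr // mulrBr mulr1 mulrC; lra.
Qed.

Lemma sublinear_affine f C : sublinear f -> 0 <= C -> (forall t, 1 <= t -> `|f t| <= C * t) ->
  forall e, 0 < e -> exists2 D, 0 <= D & forall t, 1 <= t -> `|f t| <= e * t + D.
Proof.
move=> Hf C0 HC e e0; have [X X1 HX] := Hf e e0.
exists (C * X); first by rewrite mulr_ge0 // ge1_ge0.
move=> t t1; have [tX|/ltW Xt] := leP t X.
  apply: le_trans (HC t t1) _; rewrite ler_wpDl ?mulr_ge0 ?(ltW e0) ?ge1_ge0 //.
  by rewrite ler_wpM2l.
by apply: le_trans (HX t Xt) _; rewrite lerDl mulr_ge0 // ge1_ge0.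
Qed.

(** [mob (rough y)] is the convolution of mu with the indicator of the smooth elements: the Euler
    factors at the small primes are put back. *)
Lemma mob_rough_sum y x : 1 <= x ->
  dact (mob (rough y)) one x = dact (ind (smooth y)) mertens x.
Proof.
move=> x1; transitivity (dact (mob (rough y)) (dact one mertens) x).
  apply: eq_dact => // t /andP[t1 _].
  by rewrite /mertens dactC dact_mob_inv.
rewrite dact_mob_one; apply: eq_dactl => g; apply: eq_ind; exact: predC_rough.
Qed.

(** With |M(t)| <= e' t + D for all t >= 1, the first part meets the bounded sum of 1/|g| over
    smooth g, the second the o(x) count of smooth elements. *)
Lemma sublinear_mob_rough y : 1 <= y -> sublinear (dact (mob (rough y)) one).
Proof.
move=> y1; have [B B0 HB] := sum_smooth_bounded (primes_le_uniq y).
have HB' x : \sum_(g <- elts x) ind (smooth y) g / nrm g <= B.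
  apply: le_trans (HB x); apply: eq_ler; apply: eq_bigr => g _; congr (_ / _).
  by apply: eq_ind => q; rewrite /= mem_primes_le.
have ck0 : 0 <= c + K by rewrite addr_ge0 // ltW.
have HM t : 1 <= t -> `|mertens t| <= (c + K) * t.
  by move=> t1; exact: le_trans (norm_mertens t) (cnt_le (ge1_ge0 t1)).
have aff := sublinear_affine (mertens_sublinear (asgN := asgN) (axA := axA)) ck0 HM.
move=> e e0; pose e' := e / 2 / (B + 1).
have B10 : 0 < B + 1 by rewrite ltr_wpDl.
have e'0 : 0 < e' by rewrite !divr_gt0.
have [D D0 HD] := aff e' e'0.
have [X X1 HX] := sublinZ D (sublinear_smooth_count y1) (divr_gt0 e0 (ltr0Sn _ 1)).
exists X => // x Xx; have x1 := le_trans X1 Xx; have x0 := ge1_gt0 x1.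
rewrite mob_rough_sum //.
apply: le_trans (@ler_dact _ _ _ _ _ (ind (smooth y)) _ (fun t => e' * t + D) x _ _) _.
- by move=> g; rewrite norm_ind.
- by move=> t /andP[t1 _]; exact: HD.
rewrite dactDr dactZr dact_id [e in leRHS](splitr e) mulrDl; apply: lerD.
  apply: le_trans (_ : e' * (x * (B + 1)) <= _).
    apply: ler_wpM2l; first exact: ltW.
    apply: ler_wpM2l; first exact: ltW.
    by apply: le_trans (HB' x) _; rewrite lerDl.
  by apply: eq_ler; rewrite /e'; field; rewrite gt_eqF.
have -> : dact (ind (smooth y)) (fun=> D) x = D * countQ (smooth y) x.
  by rewrite mulr_sumr; apply: eq_bigr => g _; rewrite mulrC.
exact: le_trans (ler_norm _) (HX x Xx).
Qed.

End Sieve.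

(** * Smallest primes *)

Section AxerAndSmallestPrime.
Context {R : realType} {P : countType} {N : P -> R} {asgN : arith_semigroup N}.
Context {c eta K : R} {axA : axiom_A N c eta K}.
Local Notation nrm := (asg_norm N).
Local Notation elts := (elts N).
Local Notation dact := (dact (N := N)).
Local Notation cnt := (cnt N).
Local Notation one := (fun=> 1).
Local Notation primes_le := (primes_le (N := N)).
Local Notation rough := (rough (N := N)).
Local Notation countQ := (countQ (N := N)).
Implicit Types (x y s t A B : R) (g h d k : {mset P}) (p q : P) (Q : pred P).

Let c0 : 0 < c. Proof. exact: density_gt0. Qed.
Let K0 : 0 <= K. Proof. exact: error_ge0. Qed.
Let eta0 : 0 < eta. Proof. exact: exponent_gt0. Qed.
Let eta1 : eta < 1. Proof. exact: exponent_lt1. Qed.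

(** For |g| <= x/B the errors of Axiom A add up to O(B^(eta - 1) x), small for large [B]. For |g| >
    x/B both cnt(x/|g|) and c x/|g| are monotone and O(B), so partial summation against the o(x)
    sums of [f] suffices. *)
Lemma axer (f : {mset P} -> R) : (forall g, `|f g| <= 1) ->
  sublinear (fun x => \sum_(g <- elts x) f g) ->
  sublinear (fun x => \sum_(g <- elts x) f g * (cnt (x / nrm g) - c * (x / nrm g))).
Proof.
move=> f1 Hf e e0.
have [C C0 HC] := @dom_sum_powR _ _ _ asgN c eta K axA eta (ltW eta0) eta1.
have KC0 : 0 < K * C + 1 by rewrite ltr_wpDl // mulr_ge0.
have [B B1 HB] : exists2 X : R, 1 <= X & forall x, X <= x -> x `^ (eta - 1) <= e / 2 / (K * C + 1).
  by apply: powR_small; rewrite ?subr_lt0 // !divr_gt0.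
have {}HB := HB B (lexx _); have Bp := ge1_gt0 B1.
pose D := 2 * (c + K + c) * B.
have D0 : 0 < D by rewrite !mulr_gt0 // ltr_wpDl // addr_ge0 // ltW.
have [X X1 HX] := Hf (e / 2 / D) (divr_gt0 (divr_gt0 e0 (ltr0Sn _ 1)) D0).
exists (X * B); first by rewrite mulr_ege1.
move=> x Xx; have Xz : X <= x / B by rewrite ler_pdivlMr.
have z1 := le_trans X1 Xz; have x1 : 1 <= x by apply: le_trans Xx; rewrite mulr_ege1.
have x0 := ge1_gt0 x1; have zp := ge1_gt0 z1.
have zx : x / B <= x by rewrite ler_pdivrMr // ler_peMr // ltW.
set z := x / B in Xz z1 zx zp *.
have xE : x = B * z by rewrite /z mulrC divfK // gt_eqF.
rewrite (sum_elts_split _ zx) [e](splitr e) mulrDl; apply: le_trans (ler_normD _ _) _.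
apply: lerD.
  apply: le_trans (ler_norm_sum _ _ _) _.
  apply: le_trans (_ : \sum_(g <- elts z) K * B `^ eta * (1 * (z / nrm g) `^ eta) <= _).
    rewrite big_seq [leRHS]big_seq; apply: ler_sum => g; rewrite mem_elts => gz.
    have g0 : 0 < nrm g by exact: asg_norm_gt0.
    rewrite normrM; apply: le_trans (_ : 1 * (K * (x / nrm g) `^ eta) <= _).
      apply: ler_pM => //; apply: count_approx.
      by rewrite ler_pdivlMr // mul1r (le_trans gz).
    rewrite !mul1r -mulrA ler_wpM2l // {1}xE -mulrA powRM ?(ltW Bp) //.
    by rewrite divr_ge0 // ltW.
  rewrite -mulr_sumr; apply: le_trans (_ : K * B `^ eta * (C * z) <= _).
    rewrite ler_wpM2l ?mulr_ge0 ?powR_ge0 //; exact: le_trans (ler_norm _) (HC z z1).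
  have -> : K * B `^ eta * (C * z) = (K * C) * B `^ (eta - 1) * x.
    rewrite powRD ?(gt_eqF Bp) ?implybT // powR_inv1 ?(ltW Bp) // xE.
    by field; rewrite gt_eqF.
  rewrite ler_wpM2r ?(ltW x0) //; apply: le_trans (_ : (K * C + 1) * B `^ (eta - 1) <= _).
    by rewrite ler_wpM2r ?powR_ge0 // lerDl.
  by rewrite mulrC -ler_pdivlMr.
(* [f'] drops the elements up to z. Freezing the weights on [1, z] by [m] below keeps them
   nonincreasing and bounded from 1 on, as [abel_mono] requires. *)
pose f' g : R := if z < nrm g then f g else 0.
have F'E t : 1 <= t -> t <= x -> `|\sum_(g <- elts t) f' g| <= 2 * (e / 2 / D) * x.
  move=> t1 tx; have ed0 : 0 <= e / 2 / D by rewrite !divr_ge0 // ltW.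
  have B0 : 0 <= 2 * (e / 2 / D) * x by exact: mulr_ge0 (mulr_ge0 (ler0n _ 2) ed0) (ltW x0).
  have [tz|/ltW zt] := leP t z.
    rewrite big_seq big1 ?normr0 // => g; rewrite mem_elts => gt.
    by rewrite /f' ltNge (le_trans gt tz).
  have -> : \sum_(g <- elts t) f' g = \sum_(g <- elts t) f g - \sum_(g <- elts z) f g.
    transitivity (\sum_(g <- elts t | z < nrm g) f g); first by rewrite [RHS]big_mkcond.
    by rewrite [X in _ = X - _](sum_elts_split _ zt) addrAC subrr add0r.
  apply: le_trans (ler_normB _ _) _; rewrite -mulrA [leRHS]mulr_natl mulr2n; apply: lerD.
    by apply: le_trans (HX t (le_trans Xz zt)) _; rewrite ler_wpM2l.
  by apply: le_trans (HX z Xz) _; rewrite ler_wpM2l.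
pose m t := Num.max t z.
have mz t : z <= m t by rewrite /m le_max lexx orbT.
have m_mono s t : s <= t -> m s <= m t.
  by move=> st; rewrite /m ge_max le_max st /= le_max lexx orbT.
have mp t : 0 < m t by exact: lt_le_trans zp (mz t).
have xm_mono s t : s <= t -> x / m t <= x / m s.
  by move=> st; rewrite ler_wpM2l ?(ltW x0) // lef_pV2 ?posrE // m_mono.
have m1 : m 1 = z by rewrite /m max_r.
have -> : \sum_(g <- elts x | z < nrm g) f g * (cnt (x / nrm g) - c * (x / nrm g)) =
    \sum_(g <- elts x) f' g * cnt (x / m (nrm g)) - \sum_(g <- elts x) f' g * (c * (x / m (nrm g))).
  rewrite -sumrB big_mkcond; apply: eq_bigr => g _; rewrite /f'; case: ltP => zg.
    by rewrite /m max_l ?(ltW zg) // mulrBr.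
  by rewrite !mul0r subrr.
have a1 := @abel_mono _ _ _ asgN f' (fun t => cnt (x / m t)) x _ x1 F'E _.
have {}a1 : `|\sum_(g <- elts x) f' g * cnt (x / m (nrm g))| <= 2 * (e / 2 / D) * x * cnt (x / m 1).
  by apply: a1 => s t s1 st tx; split; [exact: cnt_ge0|apply: le_cnt; exact: xm_mono].
have a2 := @abel_mono _ _ _ asgN f' (fun t => c * (x / m t)) x _ x1 F'E _.
have {}a2 : `|\sum_(g <- elts x) f' g * (c * (x / m (nrm g)))| <= 2 * (e / 2 / D) * x * (c * (x / m 1)).
  apply: a2 => s t s1 st tx; split; first by rewrite mulr_ge0 ?divr_ge0 // ltW.
  by rewrite ler_wpM2l ?(ltW c0) // xm_mono.
apply: le_trans (ler_normB _ _) _; apply: le_trans (lerD a1 a2) _.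
have xzB : x / m 1 = B by rewrite m1 {1}xE mulfK // gt_eqF.
rewrite xzB -mulrDr; apply: le_trans (_ : 2 * (e / 2 / D) * x * ((c + K) * B + c * B) <= _).
  apply: ler_wpM2l; last by rewrite lerD2r cnt_le // ltW.
  apply: mulr_ge0 (ltW x0); apply: mulr_ge0 => //.
  by apply: divr_ge0 (ltW D0); exact: divr_ge0 (ltW e0) _.
apply: eq_ler; rewrite /D; field.
by rewrite !gt_eqF // ltr_wpDl // addr_ge0 // ltW.
Qed.

Lemma bigD1_seq_cond (V : nmodType) (I : eqType) (l : seq I) (j : I) (T : pred I) (F : I -> V) :
  j \in l -> uniq l -> T j ->
  \sum_(i <- l | T i) F i = F j + \sum_(i <- l | T i && (i != j)) F i.
Proof.
move=> jl ul Tj; rewrite big_mkcond (bigD1_seq j) //= Tj; congr (_ + _).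
by rewrite -big_mkcondr; apply: eq_bigl => i; rewrite andbC.
Qed.

Lemma prime_pairs (V : nmodType) x (T : pred P) (H : P -> {mset P} -> V) :
  \sum_(p <- primes_le x | T p) \sum_(k <- elts (x / N p)) H p (p +` k) =
  \sum_(g <- elts x) \sum_(p <- primes_le x | T p && (0 < g p)%N) H p g.
Proof.
rewrite [RHS](exchange_big_dep T) => [|g p _ /andP[]] //=.
apply: eq_bigr => p Tp; rewrite -(asg_norm1 p) -sum_multiples.
by apply: eq_bigl => g; rewrite dvd1E Tp.
Qed.

Lemma is_Pmin_unique g p q : is_Pmin N g p -> is_Pmin N g q -> p = q.
Proof.
move=> [gp Hp] [gq Hq]; apply/eqP; apply/negPn/negP => /eqP pq.
have h1 := Hp q gq (fun e => pq (esym e)); have h2 := Hq p gp pq.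
by have := lt_trans h1 h2; rewrite ltxx.
Qed.

Lemma rough_Pmin p k : supp_in (rough (N p)) k -> is_Pmin N (p +` k) p.
Proof.
move=> /supp_inP H; split=> [|q]; first by rewrite mset1DE eqxx.
by rewrite mset1DE; case: eqP => // _; rewrite add0n => /H.
Qed.

(** If p divides k, both sides vanish: p k is not squarefree and k is not rough. *)
Lemma mob_Pmin p k : is_Pmin N (p +` k) p ->
  mob (R := R) xpredT (p +` k) = - mob (rough (N p)) k.
Proof.
move=> [_ Hp]; rewrite mobD1 andbT; have [kp|kp] := eqVneq (k p) 0%N.
  have sr : supp_in (rough (N p)) k.
    apply/supp_inP => q kq; apply: Hp; first by rewrite mset1DE addn_gt0 kq orbT.
    by move=> qp; rewrite qp kp in kq.
  have sT : supp_in xpredT k by exact/supp_inP.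
  by rewrite /mob sr sT.
have sr : supp_in (rough (N p)) k = false.
  by apply/supp_inP => /(_ p); rewrite lt0n kp /rough ltxx => /(_ isT).
by rewrite /mob sr oppr0.
Qed.

(** When k is rough beyond p, the unique smallest prime of p k is p; all other pairs (p, k) have
    weight 0. So each [g] receives weight from one p at most. *)
Lemma sum_Pmin x (T : P -> Prop) (F : {mset P} -> R) :
  \sum_(g <- elts x | `[< exists p, is_Pmin N g p /\ T p >]) mob xpredT g * F g =
  - \sum_(p <- primes_le x | `[< T p >]) \sum_(k <- elts (x / N p)) mob (rough (N p)) k * F (p +` k).
Proof.
pose H p g : R := mob (rough (N p)) (g `\ p) * F g.
have -> : \sum_(p <- primes_le x | `[< T p >]) \sum_(k <- elts (x / N p)) mob (rough (N p)) k * F (p +` k)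
    = \sum_(p <- primes_le x | `[< T p >]) \sum_(k <- elts (x / N p)) H p (p +` k).
  by apply: eq_bigr => p _; apply: eq_bigr => k _; rewrite /H msetD1K.
rewrite prime_pairs -sumrN big_mkcond big_seq [RHS]big_seq; apply: eq_bigr => g.
rewrite mem_elts => gx.
have Hneq p : (0 < g p)%N -> ~ is_Pmin N g p -> H p g = 0.
  move=> gp nP; have gE : p +` (g `\ p) = g by rewrite msetB1K // in_mset.
  rewrite /H /mob; case: ifP => [/andP[s _]|_]; last by rewrite mul0r.
  by case: nP; rewrite -gE; exact: rough_Pmin.
case: asboolP => [[p [Pp Tp]]|nP].
  have gp : (0 < g p)%N by case: Pp.
  have gE : p +` (g `\ p) = g by rewrite msetB1K // in_mset.
  have px : p \in primes_le x.
    rewrite mem_primes_le; apply: le_trans gx; rewrite -asg_norm1; apply: asg_norm_dvd.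
    by rewrite dvd1E.
  rewrite (bigD1_seq_cond _ px) ?primes_le_uniq //=; last by rewrite gp andbT; exact/asboolP.
  rewrite big1 ?addr0 => [|q /andP[/andP[_ gq] /eqP qp]]; last first.
    by apply: Hneq => // Pq; apply: qp; exact: is_Pmin_unique Pq Pp.
  by rewrite /H -mulNr -mob_Pmin gE.
rewrite big1 ?oppr0 // => p /andP[/asboolP Tp gp]; apply: Hneq => // Pp.
by apply: nP; exists p.
Qed.

Lemma count_Pmin x y :
  \sum_(p <- primes_le x | rough y p) \sum_(k <- elts (x / N p)) ind (rough (N p)) k <=
  countQ (rough y) x.
Proof.
pose H p g : R := ind (rough (N p)) (g `\ p).
have -> : \sum_(p <- primes_le x | rough y p) \sum_(k <- elts (x / N p)) ind (rough (N p)) k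
    = \sum_(p <- primes_le x | rough y p) \sum_(k <- elts (x / N p)) H p (p +` k).
  by apply: eq_bigr => p _; apply: eq_bigr => k _; rewrite /H msetD1K.
rewrite prime_pairs; apply: ler_sum => g _.
have HP p : (0 < g p)%N -> H p g != 0 -> is_Pmin N g p /\ supp_in (rough (N p)) (g `\ p).
  move=> gp; have gE : p +` (g `\ p) = g by rewrite msetB1K // in_mset.
  rewrite /H /ind; case: (boolP (supp_in _ _)) => [s _|_]; last by rewrite eqxx.
  by split=> //; rewrite -gE; exact: rough_Pmin.
have [[p [px yp gp Hp]]|none] := pselect (exists p, [/\ p \in primes_le x, rough y p, (0 < g p)%N & H p g != 0]).
  rewrite (bigD1_seq_cond _ px) ?primes_le_uniq ?yp ?gp //= big1 ?addr0 => [|q /andP[/andP[_ gq] /eqP qp]].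
    have gE : p +` (g `\ p) = g by rewrite msetB1K // in_mset.
    have [_ /supp_inP s] := HP p gp Hp.
    have -> : ind (rough y) g = 1 :> R.
      rewrite /ind (_ : supp_in _ g = true) // -gE supp_inD supp_in1 yp /=.
      by apply/supp_inP => q /s; rewrite /rough; exact: lt_trans.
    exact: ind_le1.
  apply/eqP; apply/negPn/negP => Hq; apply: qp.
  have [P1 _] := HP q gq Hq; have [P2 _] := HP p gp Hp.
  exact: is_Pmin_unique P1 P2.
rewrite big_seq_cond big1 ?ind_ge0 // => p /andP[px /andP[yp gp]].
by apply/eqP; apply/negPn/negP => Hp; apply: none; exists p.
Qed.

Lemma sublinear_div f p : sublinear f -> sublinear (fun x => f (x / N p)).
Proof. exact/sublin_scale/norm_prime_ge1. Qed.

Lemma sublinear_sum (I : Type) (l : seq I) (T : pred I) (f : I -> R -> R) :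
  (forall i, T i -> sublinear (f i)) -> sublinear (fun x => \sum_(i <- l | T i) f i x).
Proof.
move=> H; elim: l => [|i l IH].
  by apply: eq_sublin (sublin_const (0 : R)) => x _; rewrite big_nil.
case Ti : (T i); last by apply: eq_sublin IH => x _; rewrite big_cons Ti.
by apply: eq_sublin (sublinD (H i Ti) IH) => x _; rewrite big_cons Ti.
Qed.

(** The identity has no prime and gets the value 0, so this is mu on the index set of the sums in
    the theorem. *)
Definition mobD (S : P -> Prop) g : R :=
  if `[< exists p, is_Pmin N g p /\ S p >] then mob xpredT g else 0.

Lemma norm_mobD S g : `|mobD S g| <= 1.
Proof. by rewrite /mobD; case: ifP => _; [exact: norm_mob|rewrite normr0]. Qed.

Lemma sublinear_mobD (S : P -> Prop) : sublinear (fun x => \sum_(g <- elts x) mobD S g).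
Proof.
have E x : \sum_(g <- elts x) mobD S g =
    - \sum_(p <- primes_le x | `[< S p >]) dact (mob (rough (N p))) one (x / N p).
  rewrite -big_mkcond (eq_bigr (fun g => mob xpredT g * 1)); last by move=> g _; rewrite mulr1.
  exact: (@sum_Pmin x S (fun=> 1)).
move=> e e0; have e20 : 0 < e / 2 by rewrite divr_gt0.
have [y y1 [X X1 HX]] := rough_count_small (asgN := asgN) (axA := axA) e20.
have fin : sublinear (fun x => \sum_(p <- primes_le y | `[< S p >]) dact (mob (rough (N p))) one (x / N p)).
  apply: sublinear_sum => p _; apply: (@sublinear_div (dact (mob (rough (N p))) one) p).
  exact/sublinear_mob_rough/norm_prime_ge1.
have [Y Y1 HY] := fin _ e20.
exists (Num.max (Num.max X Y) y); first by rewrite !le_max X1.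
move=> x; rewrite !ge_max => /andP[/andP[Xx Yx] yx].
rewrite E normrN (bigID (rough y)) /= addrC [e](splitr e) mulrDl.
apply: le_trans (ler_normD _ _) _; apply: lerD.
  have -> : \sum_(p <- primes_le x | `[< S p >] && ~~ rough y p) dact (mob (rough (N p))) one (x / N p)
     = \sum_(p <- primes_le y | `[< S p >]) dact (mob (rough (N p))) one (x / N p).
    rewrite -[LHS]big_filter -[RHS]big_filter; apply: perm_big; apply: uniq_perm.
    - exact/filter_uniq/primes_le_uniq.
    - exact/filter_uniq/primes_le_uniq.
    move=> p; rewrite !mem_filter !mem_primes_le /rough -leNgt -andbA; congr andb.
    by case: (leP (N p) y) => //= /le_trans ->.
  exact: HY.
apply: le_trans (HX x Xx); apply: le_trans (count_Pmin x y).
apply: le_trans (ler_norm_sum _ _ _) _.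
rewrite big_mkcondl; apply: ler_sum => p _; case: ifP => _; last first.
  by apply: sumr_ge0 => k _; exact: ind_ge0.
apply: le_trans (ler_norm_sum _ _ _) _; apply: ler_sum => k _.
by rewrite mulr1; exact: norm_mob_ind.
Qed.

End AxerAndSmallestPrime.

(** * Largest primes *)

Section LargestPrime.
Context {R : realType} {P : countType} {N : P -> R} {asgN : arith_semigroup N}.
Context {c eta K : R} {axA : axiom_A N c eta K}.
Local Notation nrm := (asg_norm N).
Local Notation elts := (elts N).
Local Notation dact := (dact (N := N)).
Local Notation cnt := (cnt N).
Local Notation harm := (harm N).
Local Notation one := (fun=> 1).
Local Notation primes_le := (primes_le (N := N)).
Local Notation rough := (rough (N := N)).
Local Notation smooth := (smooth (N := N)).
Local Notation countQ := (countQ (N := N)).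
Local Notation Lam := (vonM (N := N)).
Implicit Types (x y s t A B : R) (g h d k : {mset P}) (p q : P) (Q T : pred P).

Let c0 : 0 < c. Proof. exact: density_gt0. Qed.
Let K0 : 0 <= K. Proof. exact: error_ge0. Qed.
Let eta0 : 0 < eta. Proof. exact: exponent_gt0. Qed.
Let eta1 : eta < 1. Proof. exact: exponent_lt1. Qed.

Definition pi_count T x : R := \sum_(p <- primes_le x | T p) 1.

Lemma pi_count_ge0 T x : 0 <= pi_count T x. Proof. exact: sumr_ge0. Qed.

Lemma sum_primes_split (V : nmodType) x y T (F : P -> V) : x <= y ->
  \sum_(p <- primes_le y | T p) F p =
  \sum_(p <- primes_le x | T p) F p + \sum_(p <- primes_le y | T p && (x < N p)) F p.
Proof.
move=> xy; rewrite (bigID (fun p => N p <= x)) /=; congr (_ + _).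
  rewrite -[LHS]big_filter -[RHS]big_filter; apply: perm_big; apply: uniq_perm.
  - exact/filter_uniq/primes_le_uniq.
  - exact/filter_uniq/primes_le_uniq.
  move=> p; rewrite !mem_filter !mem_primes_le -andbA; congr andb.
  by case: (leP (N p) x) => //= /le_trans ->.
by apply: eq_bigl => p; rewrite -ltNge.
Qed.

Lemma le_pi_count T x y : x <= y -> pi_count T x <= pi_count T y.
Proof. by move=> xy; rewrite /pi_count (sum_primes_split _ _ xy) lerDl sumr_ge0. Qed.

(** Primes up to the square root of x are bounded trivially by cnt; for the others ln x <= 2 ln (N
    p), which brings in psi. *)
Lemma chebyshev : exists2 C, 0 <= C & forall x, 1 <= x -> pi_count xpredT x * ln x <= C * x.
Proof.
have [C1 C10 H1] := dom_psi (asgN := asgN) (axA := axA).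
have [C2 C20 H2] : dominated (fun x : R => x `^ 2^-1 * ln x) (fun x => x `^ 1).
  by apply: dom_powR_ln; lra.
exists ((c + K) * C2 + 2 * C1); first by rewrite addr_ge0 ?mulr_ge0 ?addr_ge0 // ltW.
move=> x x1; have x0 := ge1_gt0 x1; have lx0 := ln_ge0 x1.
set z := x `^ 2^-1.
have zx : z <= x by rewrite /z ler1_powR // invf_le1 // ler1n.
have z1 : 1 <= z by rewrite /z powR_ge1 // invr_ge0.
rewrite /pi_count (sum_primes_split _ _ zx) [leLHS]mulrDl [leRHS]mulrDl; apply: lerD.
  apply: le_trans (_ : (c + K) * z * ln x <= _).
    rewrite ler_wpM2r //; apply: le_trans (cnt_le (ge1_ge0 z1)).
    exact: (@le_sum_primes _ _ _ _ z (fun=> 1) (fun=> 1)).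
  rewrite -!mulrA; apply: ler_wpM2l; first by rewrite addr_ge0 // ltW.
  by have := H2 x x1; rewrite powRr1 ?(ltW x0) //; apply: le_trans; exact: ler_norm.
apply: le_trans (_ : 2 * psi (N := N) x <= _); last first.
  by rewrite -mulrA ler_wpM2l //; exact: le_trans (ler_norm _) (H1 x x1).
rewrite mulr_suml /= psiE.
apply: le_trans (_ : 2 * \sum_(p <- primes_le x) ln (N p) <= _); last first.
  rewrite ler_wpM2l //; apply: (@le_sum_primes _ _ _ _ x _ Lam) => [p|g]; last exact: vonM_ge0.
  by rewrite vonM1.
rewrite mulr_sumr big_mkcond; apply: ler_sum => p _; rewrite mul1r.
have lp : 0 <= ln (N p) by rewrite ln_ge0 // norm_prime_ge1.
case: ltP => zp; last by rewrite mulr_ge0.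
have : ln z <= ln (N p) by rewrite ler_ln ?posrE ?norm_prime_gt0 ?ge1_gt0 // ltW.
by rewrite /z ln_powR; lra.
Qed.

(** Dyadic blocks: the one starting at y contributes at most 2 (c + K) y^(- sg), and doubling y
    multiplies this by 2^(- sg) < 1. *)
Lemma sum_tail (sg : R) : 0 < sg -> exists2 C, 0 <= C & forall x y, 1 <= y ->
  \sum_(g <- elts x | y < nrm g) nrm g `^ (- 1 - sg) <= C * y `^ (- sg).
Proof.
move=> sg0; pose r := 2 `^ (- sg).
have r1 : r < 1 by rewrite /r -[ltRHS](powRr0 2) ltr_powR ?ltr1n // oppr_lt0.
pose C := 2 * (c + K) / (1 - r).
have ck0 : 0 <= c + K by rewrite addr_ge0 // ltW.
have C0 : 0 <= C.
  by apply: divr_ge0; [exact: mulr_ge0|rewrite subr_ge0 ltW].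
have CE : 2 * (c + K) + C * r = C by rewrite /C; field; rewrite gt_eqF // subr_gt0.
exists C => // x y y1.
have [n] : exists n : nat, x <= 2 ^+ n * y.
  exists (Num.trunc x).+1; apply: ltW; apply: lt_le_trans (truncnS_gt x) _.
  by rewrite -[leLHS]mulr1 ler_pM // -natrX ler_nat ltnW // ltn_expl.
elim: n y y1 => [|n IH] y y1.
  rewrite expr0 mul1r => xy; rewrite big_seq_cond big1 ?(mulr_ge0 C0 (powR_ge0 _ _)) // => g.
  by rewrite mem_elts => /andP[gx]; rewrite ltNge (le_trans gx).
move=> xn; have y0 := ge1_gt0 y1; have y21 : 1 <= 2 * y by lra.
have h1 := IH (2 * y) y21 _; have {}h1 := h1 ltac:(by rewrite mulrA -exprSr).
rewrite (bigID (fun g => nrm g <= 2 * y)) /= -[in leRHS]CE [leRHS]mulrDl; apply: lerD.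
  apply: le_trans (_ : \sum_(g <- elts (2 * y)) y `^ (- 1 - sg) <= _).
    rewrite -big_filter.
    pose l := [seq g <- elts (2 * y) | (y < nrm g) && (nrm g <= x)].
    have -> : \sum_(g <- [seq g <- elts x | (y < nrm g) && (nrm g <= 2 * y)]) nrm g `^ (- 1 - sg) =
       \sum_(g <- l) nrm g `^ (- 1 - sg).
      apply: perm_big; apply: uniq_perm.
      - exact/filter_uniq/elts_uniq.
      - exact/filter_uniq/elts_uniq.
      by move=> g; rewrite !mem_filter !mem_elts -!andbA; congr andb; rewrite andbC.
    rewrite big_filter big_mkcond; apply: ler_sum => g _; case: ifP => [/andP[yg _]|_]; last exact: powR_ge0.
    have -> : - 1 - sg = - (1 + sg) by ring.
    rewrite !powRN lef_pV2 ?posrE ?powR_gt0 ?(lt_trans y0 yg) //.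
    by rewrite ge0_ler_powR ?nnegrE ?addr_ge0 ?(ltW sg0) ?(ltW y0) ?asg_norm_ge0 // ltW.
  have -> : \sum_(g <- elts (2 * y)) y `^ (- 1 - sg) = cnt (2 * y) * y `^ (- 1 - sg).
    by rewrite /cnt mulr_suml; apply: eq_bigr => g _; rewrite mul1r.
  apply: le_trans (_ : (c + K) * (2 * y) * y `^ (- 1 - sg) <= _).
    by rewrite ler_wpM2r ?powR_ge0 // cnt_le // ge1_ge0.
  rewrite powRD ?(gt_eqF y0) ?implybT // powR_inv1 ?(ltW y0) //.
  by apply: eq_ler; field; rewrite gt_eqF.
have -> : C * r * y `^ (- sg) = C * (2 * y) `^ (- sg) by rewrite powRM ?(ltW y0) // /r mulrA.
apply: le_trans h1; rewrite le_eqVlt; apply/orP; left; apply/eqP; apply: eq_bigl => g.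
by rewrite -ltNge; case: (ltP (2 * y)) => [h|]; rewrite ?andbF // andbT; lra.
Qed.

Definition ssmooth y : pred P := fun q => N q < y.

Lemma exists_max_prime k : exists2 u, 0 <= u & forall t, 0 < t -> supp_in (ssmooth t) k = (u < t).
Proof.
have [k0|k0] := eqVneq (enum_fset (finsupp k)) [::].
  exists 0 => // t ->; apply/supp_inP => p; rewrite -mem_gt0.
  by rewrite -[p \in _]/(p \in enum_fset (finsupp k)) k0.
have [m mk mP] := @exists_max_seq _ _ _ N k0.
exists (N m) => [|t t0]; first exact/ltW/norm_prime_gt0.
apply/supp_inP/idP => [H|mt p kp]; first by apply: H; rewrite -mem_gt0.
by apply: le_lt_trans mt; apply: mP; rewrite -[p \in _]/(p \in finsupp k) mem_gt0.
Qed.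

Lemma primes_swap (V : nmodType) x T (F : P -> {mset P} -> V) :
  \sum_(p <- primes_le x | T p) \sum_(k <- elts (x / N p)) F p k =
  \sum_(k <- elts x) \sum_(p <- primes_le (x / nrm k) | T p) F p k.
Proof.
transitivity (\sum_(p <- primes_le x | T p) \sum_(k <- elts x | N p * nrm k <= x) F p k).
  apply: eq_bigr => p _; rewrite -[RHS]big_filter; apply: perm_big; apply: uniq_perm.
  - exact: elts_uniq.
  - exact/filter_uniq/elts_uniq.
  move=> k; rewrite mem_filter !mem_elts ler_pdivlMr ?norm_prime_gt0 // mulrC.
  case: (boolP (N p * nrm k <= x)) => //= h; symmetry; apply: le_trans h.
  by rewrite ler_peMl ?asg_norm_ge0 // norm_prime_ge1.
rewrite (exchange_big_dep xpredT) //=; apply: eq_bigr => k _.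
rewrite -[LHS]big_filter -[RHS]big_filter; apply: perm_big; apply: uniq_perm.
- exact/filter_uniq/primes_le_uniq.
- exact/filter_uniq/primes_le_uniq.
move=> p; rewrite !mem_filter !mem_primes_le ler_pdivlMr ?asg_norm_gt0 // -andbA; congr andb.
case: (boolP (N p * nrm k <= x)) => //= h; apply: le_trans h.
by rewrite ler_peMr ?asg_norm_ge1 // ltW // norm_prime_gt0.
Qed.

(** Products p k with p in [T] are counted. Here an element occurs once for each of its primes of
    largest norm in [T]; in [smax_count] it occurs at most once, when its largest prime is unique
    and simple. [excess] bounds the difference through products p q k with N q = N p. *)
Definition max_count T x : R := \sum_(p <- primes_le x | T p) countQ (smooth (N p)) (x / N p).
Definition smax_count T x : R := \sum_(p <- primes_le x | T p) countQ (ssmooth (N p)) (x / N p).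
Definition excess x : R := \sum_(p <- primes_le x) \sum_(q <- primes_le x | N q == N p)
  countQ (smooth (N p)) (x / N p / N q).

Lemma countQ_sub Q T x : {subset Q <= T} -> countQ Q x <= countQ T x.
Proof.
move=> QT; apply: ler_sum => g _; rewrite /ind ler_nat.
case: (boolP (supp_in Q g)) => //= /supp_inP H.
by rewrite (_ : supp_in T g = true) //; apply/supp_inP => p /H; exact: QT.
Qed.

Lemma ssmooth_smooth y : {subset ssmooth y <= smooth y}.
Proof. by move=> q; rewrite !unfold_in /ssmooth /smooth; exact: ltW. Qed.

Lemma smax_le_max T x : smax_count T x <= max_count T x.
Proof. by apply: ler_sum => p _; exact/countQ_sub/ssmooth_smooth. Qed.

(** A cofactor that is smooth but not strictly smooth has a prime q with N q = N p; divide by it. *)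
Lemma max_sub_smax T x : max_count T x - smax_count T x <= excess x.
Proof.
rewrite /max_count /smax_count -sumrB big_mkcond /excess big_seq [leRHS]big_seq.
apply: ler_sum => p; rewrite mem_primes_le => px; set y := N p; set z := x / y.
apply: le_trans (_ : countQ (smooth y) z - countQ (ssmooth y) z <= _).
  by case: ifP => // _; rewrite subr_ge0; exact/countQ_sub/ssmooth_smooth.
rewrite /countQ -sumrB.
apply: le_trans (_ : \sum_(h <- elts z) \sum_(q <- primes_le x | N q == y)
   (if (0 < h q)%N then ind (smooth y) h else 0) <= _).
  rewrite big_seq [leRHS]big_seq; apply: ler_sum => h; rewrite mem_elts => hz.
  have rhs0 : 0 <= \sum_(q <- primes_le x | N q == y) (if (0 < h q)%N then ind (smooth y) h else 0 : R).
    by apply: sumr_ge0 => q _; case: ifP => // _; exact: ind_ge0.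
  rewrite /ind; case: (boolP (supp_in (ssmooth y) h)) => [s|/allPn[q]].
    apply: le_trans rhs0; rewrite subr_le0 ler_nat; exact: leq_b1.
  rewrite mem_gt0 /ssmooth -leNgt subr0 => hq yq.
  case: (boolP (supp_in (smooth y) h)) => [s|_]; last by apply: sumr_ge0 => q' _; case: ifP.
  have Nq : N q = y by apply/eqP; rewrite eq_le yq andbT; exact: (supp_inP _ _ s).
  have qx : q \in primes_le x by rewrite mem_primes_le Nq.
  rewrite (bigD1_seq_cond _ qx) ?primes_le_uniq ?Nq ?eqxx //= hq lerDl.
  by apply: sumr_ge0 => q' _; case: ifP.
rewrite exchange_big /=; apply: ler_sum => q _; rewrite -big_mkcond /=.
rewrite (eq_bigl (fun h => ([mset q] `<=` h)%mset)); last by move=> h; rewrite dvd1E.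
rewrite sum_multiples asg_norm1; apply: ler_sum => k _.
by rewrite indD1; case: (smooth y q); rewrite ?mul1r ?mul0r ?ind_ge0.
Qed.

Lemma cnt_le_max x : cnt x - 1 <= max_count xpredT x.
Proof.
pose H p g : R := ind (smooth (N p)) (g `\ p).
have -> : max_count xpredT x = \sum_(p <- primes_le x | xpredT p) \sum_(k <- elts (x / N p)) H p (p +` k).
  by apply: eq_bigr => p _; apply: eq_bigr => k _; rewrite /H msetD1K.
have H0 p g : 0 <= H p g by exact: ind_ge0.
have [x1|x1] := ltP x 1.
  rewrite /cnt elts_lt1 // big_nil sub0r; apply: (@le_trans _ _ 0); first by rewrite lerN10.
  by apply: sumr_ge0 => p _; apply: sumr_ge0 => k _.
rewrite prime_pairs lerBlDr.
rewrite /cnt (bigD1_seq mset0) ?elts_uniq ?mem_elts ?asg_norm0 //= addrC lerD2r.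
rewrite [leRHS](bigD1_seq mset0) ?elts_uniq ?mem_elts ?asg_norm0 //=.
rewrite ler_wpDl //; first by apply: sumr_ge0 => p _; exact: H0.
rewrite big_seq_cond [leRHS]big_seq_cond; apply: ler_sum => g; rewrite mem_elts => /andP[gx g0].
have s0 : enum_fset (finsupp g) != [::].
  apply: contra g0 => /eqP s0; rewrite -supp_in_pred0.
  by apply/allP => p; rewrite -[p \in _]/(p \in enum_fset (finsupp g)) s0.
have [p pg pP] := @exists_max_seq _ _ _ N s0.
have gp : (0 < g p)%N by rewrite -mem_gt0.
have px : p \in primes_le x.
  rewrite mem_primes_le; apply: le_trans gx; rewrite -asg_norm1; apply: asg_norm_dvd.
  by rewrite dvd1E.
rewrite (bigD1_seq_cond _ px) ?primes_le_uniq //=.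
have -> : H p g = 1.
  rewrite /H /ind (_ : supp_in _ _ = true) //; apply/supp_inP => q qg.
  rewrite /smooth; apply: pP; rewrite -[q \in _]/(q \in finsupp g) mem_gt0.
  by apply: leq_trans qg _; rewrite msetB1E leq_subr.
by rewrite lerDl; apply: sumr_ge0 => q _; exact: H0.
Qed.

Lemma smax_le_smooth x y :
  \sum_(p <- primes_le x | smooth y p) countQ (ssmooth (N p)) (x / N p) <= countQ (smooth y) x.
Proof.
pose H p g : R := ind (ssmooth (N p)) (g `\ p).
have -> : \sum_(p <- primes_le x | smooth y p) countQ (ssmooth (N p)) (x / N p)
    = \sum_(p <- primes_le x | smooth y p) \sum_(k <- elts (x / N p)) H p (p +` k).
  by apply: eq_bigr => p _; apply: eq_bigr => k _; rewrite /H msetD1K.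
rewrite prime_pairs; apply: ler_sum => g _.
have HP p : (0 < g p)%N -> H p g != 0 -> forall q, (0 < g q)%N -> q <> p -> N q < N p.
  move=> gp; rewrite /H /ind; case: (boolP (supp_in _ _)) => [/supp_inP s _|_]; last by rewrite eqxx.
  by move=> q gq /eqP/negPf qp; apply: s; rewrite msetB1E qp subn0.
have [[p [px yp gp Hp]]|none] := pselect (exists p, [/\ p \in primes_le x, smooth y p, (0 < g p)%N & H p g != 0]).
  have Hpq := HP p gp Hp.
  rewrite (bigD1_seq_cond _ px) ?primes_le_uniq ?yp ?gp //= big1 ?addr0 => [|q /andP[/andP[_ gq] /eqP qp]].
    have -> : ind (smooth y) g = 1 :> R.
      rewrite /ind (_ : supp_in _ g = true) //; apply/supp_inP => q gq.
      have [->//|/eqP qp] := eqVneq q p.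
      by rewrite /smooth; apply: le_trans yp; apply/ltW/Hpq.
    exact: ind_le1.
  apply/eqP; apply/negPn/negP => Hq.
  have h1 := Hpq q gq qp; have h2 := HP q gq Hq p gp (fun e => qp (esym e)).
  by have := lt_trans h1 h2; rewrite ltxx.
rewrite big_seq_cond big1 ?ind_ge0 // => p /andP[px /andP[yp gp]].
by apply/eqP; apply/negPn/negP => Hp; apply: none; exists p.
Qed.

Lemma smax_le_cnt x : smax_count xpredT x <= cnt x.
Proof.
apply: le_trans (countQ_le (smooth x) x); apply: le_trans (smax_le_smooth x x).
rewrite /smax_count big_seq [leRHS]big_seq_cond le_eqVlt; apply/orP; left; apply/eqP.
apply: eq_bigl => p; rewrite mem_primes_le /smooth; by case: (N p <= x).
Qed.

(** Elements of norm exactly t lie in (t - 1, t], where Axiom A leaves c + 2 K t^eta; 2 <= t keeps t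
    - 1 in its range. *)
Lemma primes_of_norm_le t x : 2 <= t ->
  \sum_(q <- primes_le x | N q == t) 1 <= (c + 2 * K) * t `^ eta.
Proof.
move=> t2; have t1 : 1 <= t by lra.
rewrite big_mkcond /=.
pose F g : R := if nrm g == t then 1 else 0.
have F0 g : 0 <= F g by rewrite /F; case: ifP.
apply: le_trans (_ : \sum_(g <- elts x) F g <= _).
  by apply: (@le_sum_primes _ _ _ _ x _ F) => // p; rewrite /F asg_norm1.
apply: le_trans (_ : \sum_(g <- elts (Num.max t x)) F g <= _).
  by apply: le_sum_elts => //; rewrite le_max lexx orbT.
rewrite (@sum_elts_split _ _ _ _ _ t); last by rewrite le_max lexx.
rewrite [X in _ + X]big1 ?addr0 => [|g tg]; last by rewrite /F gt_eqF.
have s1 : 1 <= t - 1 by lra.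
have st : t - 1 <= t by lra.
rewrite (sum_elts_split _ st) [X in X + _]big_seq [X in X + _]big1 ?add0r => [|g]; last first.
  by rewrite mem_elts /F => gt; rewrite lt_eqF // (le_lt_trans gt) //; lra.
apply: le_trans (_ : cnt t - cnt (t - 1) <= _).
  rewrite /cnt (sum_elts_split _ st) addrAC subrr add0r; apply: ler_sum => g _.
  by rewrite /F; case: ifP.
have cd : `|cnt t - cnt (t - 1) - c * (t - (t - 1))| <= 2 * K * t `^ eta by exact: cnt_diff.
move: cd; rewrite ler_norml => /andP[_].
have te := powR_ge1 (ltW eta0) t1.
have : c <= c * t `^ eta by rewrite ler_peMr // ltW.
by rewrite mulrDl (_ : t - (t - 1) = 1) ?mulr1; [lra|ring].
Qed.

(** Up to constants, p contributes x (N p)^(-2) for each of the O((N p)^eta) primes of equal norm,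
    which gives small tails since eta < 1. The finitely many p up to a cut contribute smooth counts,
    which are o(x). *)
Lemma excess_sublinear : sublinear excess.
Proof.
have sg0 : 0 < 1 - eta by rewrite subr_gt0.
have [C C0 HC] := sum_tail sg0.
have ck0 : 0 <= c + K by rewrite addr_ge0 // ltW.
pose D := (c + K) * (c + 2 * K) * C.
have D0 : 0 <= D by rewrite !mulr_ge0 ?addr_ge0 ?mulr_ge0 // ltW.
move=> e e0; have e20 : 0 < e / 2 by rewrite divr_gt0.
have D10 : 0 < D + 1 by rewrite ltr_wpDl.
have [y0 y01 Hy0] : exists2 X : R, 1 <= X & forall x, X <= x -> x `^ (- (1 - eta)) <= e / 2 / (D + 1).
  by apply: powR_small; rewrite ?oppr_lt0 // divr_gt0.
pose y := Num.max y0 2.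
have y2 : 2 <= y by rewrite le_max lexx orbT.
have y1 : 1 <= y by lra.
have {}Hy0 : D * y `^ (- (1 - eta)) <= e / 2.
  apply: le_trans (_ : (D + 1) * y `^ (- (1 - eta)) <= _).
    by rewrite ler_wpM2r ?powR_ge0 // lerDl.
  by rewrite mulrC -ler_pdivlMr //; apply: Hy0; rewrite le_max lexx.
have fin : sublinear (fun x => \sum_(p <- primes_le y) \sum_(q <- primes_le y | N q == N p)
    countQ (smooth (N p)) (x / N p / N q)).
  apply: sublinear_sum => p _; apply: sublinear_sum => q _.
  apply: (@sublinear_div _ _ _ _ (fun x => countQ (smooth (N p)) (x / N q)) p _) => //.
  apply: (@sublinear_div _ _ _ _ (countQ (smooth (N p))) q).
  exact/sublinear_smooth_count/norm_prime_ge1.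
have [X X1 HX] := fin _ e20.
exists (Num.max X y); first by rewrite le_max X1.
move=> x; rewrite ge_max => /andP[Xx yx]; have x1 := le_trans X1 Xx.
have x0 := ge1_gt0 x1.
have exc0 : 0 <= excess x.
  by apply: sumr_ge0 => p _; apply: sumr_ge0 => q _; exact: countQ_ge0.
rewrite ger0_norm // /excess (sum_primes_split xpredT _ yx) [e](splitr e) mulrDl; apply: lerD.
  apply: le_trans (HX x Xx); apply: le_trans (ler_norm _).
  rewrite big_seq [leRHS]big_seq; apply: ler_sum => p; rewrite mem_primes_le => py.
  rewrite (sum_primes_split _ _ yx) [X in _ + X]big1 ?addr0 // => q /andP[/eqP ->].
  by rewrite ltNge py.
have term p : y < N p -> \sum_(q <- primes_le x | N q == N p) countQ (smooth (N p)) (x / N p / N q) <=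
    (c + K) * (c + 2 * K) * x * N p `^ (- 1 - (1 - eta)).
  move=> yp; have p0 : 0 < N p by exact: norm_prime_gt0.
  apply: le_trans (_ : \sum_(q <- primes_le x | N q == N p) (c + K) * (x / N p / N p) * 1 <= _).
    apply: ler_sum => q /eqP ->; rewrite mulr1; apply: le_trans (countQ_le _ _) (cnt_le _).
    by rewrite !divr_ge0 // ltW.
  rewrite -mulr_sumr.
  apply: le_trans (_ : (c + K) * (x / N p / N p) * ((c + 2 * K) * N p `^ eta) <= _).
    apply: ler_wpM2l; first by rewrite mulr_ge0 // !divr_ge0 // ltW.
    by apply: primes_of_norm_le; apply: le_trans y2 _; exact: ltW.
  have -> : - 1 - (1 - eta) = eta - 1 - 1 by ring.
  rewrite !powRD ?(gt_eqF p0) ?implybT // !powR_inv1 ?(ltW p0) //.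
  by apply: eq_ler; field; rewrite gt_eqF.
apply: le_trans (_ : \sum_(p <- primes_le x | y < N p) (c + K) * (c + 2 * K) * x * N p `^ (- 1 - (1 - eta)) <= _).
  by apply: ler_sum => p; exact: term.
rewrite -mulr_sumr big_mkcond /=.
apply: le_trans (_ : (c + K) * (c + 2 * K) * x * (C * y `^ (- (1 - eta))) <= _).
  apply: ler_wpM2l.
    by apply: mulr_ge0 (ltW x0); apply: mulr_ge0 => //; rewrite addr_ge0 ?mulr_ge0 // ltW.
  apply: le_trans (HC x y y1); rewrite [leRHS]big_mkcond.
  apply: (@le_sum_primes _ _ _ _ x _ (fun g => if y < nrm g then nrm g `^ (- 1 - (1 - eta)) else 0)).
    by move=> p; rewrite asg_norm1.
  by move=> g; case: ifP => // _; exact: powR_ge0.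
rewrite (_ : _ * _ * x * _ = D * y `^ (- (1 - eta)) * x); last by rewrite /D; ring.
by rewrite ler_wpM2r // ltW.
Qed.

(** * Elements with largest prime in a set of given density *)

Section PrimeDensity.
Variables (S : P -> Prop) (delta : R).
Let Sb : pred P := fun p => `[< S p >].
Hypothesis S_density : forall e, 0 < e -> exists2 X, 1 <= X &
  forall x, X <= x -> `|pi_count Sb x - delta * pi_count xpredT x| <= e * pi_count xpredT x.

Let w p : R := (Sb p)%:R - delta.
Let E x : R := pi_count Sb x - delta * pi_count xpredT x.

Let EE x : E x = \sum_(p <- primes_le x) w p.
Proof.
rewrite /E /pi_count mulr_sumr big_mkcond -sumrB; apply: eq_bigr => p _.
by rewrite /w mulr1; case: (Sb p).
Qed.

Let norm_w p : `|w p| <= 1 + `|delta|.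
Proof.
apply: le_trans (ler_normB _ _) _; rewrite lerD2r.
by case: (Sb p); rewrite ?normr1 ?normr0.
Qed.

(** Primes up to x^e1 produce smooth elements, O(e1 x) of them for large x. For larger primes sum
    over p first, at fixed k: p runs over an interval, so the sum is a difference of two values of
    [E], each at most e2 C2 t/(e1 ln x) with t = x/|k|. Summing 1/|k| costs O(ln x) and cancels the
    logarithm. *)
Lemma smax_density : sublinear (fun x => smax_count Sb x - delta * smax_count xpredT x).
Proof.
have [C1 C10 H1] := smooth_count (asgN := asgN) (axA := axA).
have [C2 C20 H2] := chebyshev.
have [C3 C30 H3] := harm_le (asgN := asgN) (axA := axA).
move=> e e0.
pose a := (1 + `|delta|) * C1.
have a0 : 0 <= a by rewrite mulr_ge0 // addr_ge0.
pose e1 := Num.min 1 (e / (8 * (a + 1))).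
have a10 : 0 < a + 1 by rewrite ltr_wpDl.
have a80 : 0 < 8 * (a + 1) by rewrite mulr_gt0.
have e10 : 0 < e1 by rewrite lt_min ltr01 divr_gt0.
have e11 : e1 <= 1 by rewrite ge_min lexx.
have ae1 : a * e1 <= e / 8.
  apply: le_trans (_ : (a + 1) * (e / (8 * (a + 1))) <= _).
    by apply: ler_pM => //; [exact: ltW|rewrite lerDl|rewrite ge_min lexx orbT].
  by apply: eq_ler; field; rewrite gt_eqF.
pose b := 4 * (C2 / e1) * C3.
have b0 : 0 <= b by apply: mulr_ge0 => //; apply: mulr_ge0 => //; exact: divr_ge0 C20 (ltW e10).
have b10 : 0 < b + 1 by rewrite ltr_wpDl.
(* [e2] comes after [e1]: the lower bound ln t >= e1 ln x costs a factor 1/e1 in Chebyshev's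
   bound. *)
pose e2 := e / 2 / (b + 1).
have e20 : 0 < e2 by rewrite !divr_gt0.
have be2 : b * e2 <= e / 2.
  apply: le_trans (_ : (b + 1) * e2 <= _); first by rewrite ler_wpM2r ?(ltW e20) // lerDl.
  by apply: eq_ler; rewrite /e2; field; rewrite gt_eqF.
have [X X1 HX] := S_density e20.
(* The first entry ensures X <= x^e1, the second absorbs the 1 in 1 + ln y. *)
pose l0 := Num.max (ln X / e1) (1 + 8 * a / e).
have l01 : 1 <= l0 by rewrite le_max lerDl divr_ge0 ?orbT ?mulr_ge0 // ltW.
exists (expR l0); first by rewrite -expR0 ler_expR (le_trans ler01).
move=> x Xx.
have x1 : 1 <= x by apply: le_trans Xx; rewrite -expR0 ler_expR (le_trans ler01).
have x0 := ge1_gt0 x1.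
have lx : l0 <= ln x by rewrite -[leLHS]expRK ler_ln ?posrE ?expR_gt0.
have lx1 := le_trans l01 lx; have lx0 := ge1_gt0 lx1.
pose y := x `^ e1.
have y1 : 1 <= y by exact: powR_ge1 (ltW e10) x1.
have y0 := ge1_gt0 y1.
have lny : ln y = e1 * ln x by rewrite /y ln_powR.
have Xy : X <= y.
  rewrite -ler_ln ?posrE ?ge1_gt0 // lny mulrC -ler_pdivrMr //.
  by apply: le_trans lx; rewrite le_max lexx.
have -> : smax_count Sb x - delta * smax_count xpredT x =
   \sum_(p <- primes_le x) w p * countQ (ssmooth (N p)) (x / N p).
  rewrite /smax_count mulr_sumr big_mkcond -sumrB; apply: eq_bigr => p _.
  by rewrite /w mulrBl; case: (Sb p); rewrite ?mul1r ?mul0r.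
rewrite (bigID (smooth y)) /= [e](splitr e) mulrDl.
apply: le_trans (ler_normD _ _) _; apply: lerD.
  apply: le_trans (ler_norm_sum _ _ _) _.
  apply: le_trans (_ : (1 + `|delta|) * countQ (smooth y) x <= _).
    apply: le_trans (ler_wpM2l _ (smax_le_smooth x y)); last by rewrite addr_ge0.
    rewrite mulr_sumr; apply: ler_sum => p _.
    by rewrite normrM [X in _ * X]ger0_norm ?countQ_ge0 // ler_wpM2r ?countQ_ge0.
  have h := H1 x y x1 y1; rewrite lny in h.
  rewrite -(ler_pM2r lx0) -mulrA.
  apply: le_trans (_ : (1 + `|delta|) * (C1 * (1 + e1 * ln x) * x) <= _).
    by rewrite ler_wpM2l // addr_ge0.
  have -> : (1 + `|delta|) * (C1 * (1 + e1 * ln x) * x) = (a + a * e1 * ln x) * x by rewrite /a; ring.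
  have -> : e / 2 * x * ln x = (e / 2 * ln x) * x by ring.
  rewrite ler_wpM2r ?(ltW x0) //.
  have h1 : a * e1 * ln x <= e / 8 * ln x by rewrite ler_wpM2r // ltW.
  have h2 : a <= e / 8 * ln x.
    have : 8 * a / e <= ln x.
      by apply: le_trans (le_trans _ lx); last by []; rewrite le_max; apply/orP; right; rewrite lerDr.
    rewrite ler_pdivrMr // => h2; lra.
  have : 0 <= e * ln x by rewrite mulr_ge0 // ltW.
  by move: h1 h2; lra.
have -> : \sum_(p <- primes_le x | ~~ smooth y p) w p * countQ (ssmooth (N p)) (x / N p) =
  \sum_(p <- primes_le x | ~~ smooth y p) \sum_(k <- elts (x / N p)) w p * ind (ssmooth (N p)) k.
  by apply: eq_bigr => p _; rewrite mulr_sumr.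
rewrite primes_swap.
have inner k : nrm k <= x -> `|\sum_(p <- primes_le (x / nrm k) | ~~ smooth y p) w p * ind (ssmooth (N p)) k| <=
    2 * e2 * (C2 / e1) * x / ln x * (nrm k)^-1.
  move=> kx; have [u u0 Hu] := exists_max_prime k.
  have k0 : 0 < nrm k by exact: asg_norm_gt0.
  pose v := Num.max y u; set t := x / nrm k.
  have -> : \sum_(p <- primes_le t | ~~ smooth y p) w p * ind (ssmooth (N p)) k =
      \sum_(p <- primes_le t | v < N p) w p.
    rewrite big_mkcond [RHS]big_mkcond; apply: eq_bigr => p _.
    rewrite /ind Hu ?norm_prime_gt0 // /smooth -ltNge gt_max.
    by case: (ltP y) => //= _; case: ltP => _; rewrite ?mulr1 ?mulr0.
  have rhs0 : 0 <= 2 * e2 * (C2 / e1) * x / ln x * (nrm k)^-1.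
    apply: mulr_ge0; last by rewrite invr_ge0 ltW.
    apply: divr_ge0 (ltW lx0); apply: mulr_ge0 (ltW x0); apply: mulr_ge0; last exact: divr_ge0 C20 (ltW e10).
    by apply: mulr_ge0 => //; exact: ltW.
  have [tv|vt] := ltP t v.
    rewrite big_seq_cond big1 ?normr0 // => p; rewrite mem_primes_le => /andP[pt].
    by rewrite ltNge (ltW (le_lt_trans pt tv)).
  have yv : y <= v by rewrite le_max lexx.
  have -> : \sum_(p <- primes_le t | v < N p) w p = E t - E v.
    by rewrite !EE (sum_primes_split xpredT _ vt) addrAC subrr add0r.
  have yt := le_trans yv vt; have t1 := le_trans y1 yt; have t0 := ge1_gt0 t1.
  have Et : `|E t| <= e2 * pi_count xpredT t by apply: HX; exact: le_trans Xy yt.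
  have Ev : `|E v| <= e2 * pi_count xpredT t.
    apply: le_trans (HX v (le_trans Xy yv)) _.
    by rewrite ler_wpM2l ?(ltW e20) // le_pi_count.
  apply: le_trans (ler_normB _ _) _; apply: le_trans (lerD Et Ev) _.
  have lt : e1 * ln x <= ln t by rewrite -lny ler_ln ?posrE.
  have el0 : 0 < e1 * ln x by rewrite mulr_gt0.
  have pit : pi_count xpredT t <= C2 * t / (e1 * ln x).
    rewrite ler_pdivlMr //; apply: le_trans (H2 t t1).
    by rewrite ler_wpM2l ?pi_count_ge0.
  have -> : 2 * e2 * (C2 / e1) * x / ln x * (nrm k)^-1 = 2 * e2 * (C2 * t / (e1 * ln x)).
    by rewrite /t; field; rewrite !gt_eqF.
  by have := ler_wpM2l (ltW e20) pit; lra.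
apply: le_trans (ler_norm_sum _ _ _) _.
apply: le_trans (_ : 2 * e2 * (C2 / e1) * x / ln x * harm x <= _).
  by rewrite mulr_sumr big_seq [leRHS]big_seq; apply: ler_sum => k; rewrite mem_elts; exact: inner.
apply: le_trans (_ : 2 * e2 * (C2 / e1) * x / ln x * (C3 * (2 * ln x)) <= _).
  apply: ler_wpM2l.
    apply: divr_ge0 (ltW lx0); apply: mulr_ge0 (ltW x0); apply: mulr_ge0; last exact: divr_ge0 C20 (ltW e10).
    by apply: mulr_ge0 => //; exact: ltW.
  by apply: le_trans (H3 x x1) _; rewrite ler_wpM2l //; lra.
have -> : 2 * e2 * (C2 / e1) * x / ln x * (C3 * (2 * ln x)) = b * e2 * x.
  by rewrite /b; field; rewrite !gt_eqF.
by rewrite ler_wpM2r // ltW.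
Qed.

(** Over all primes, [smax_count] lies between cnt - 1 - excess and cnt, hence is c x + o(x). *)
Lemma max_density : sublinear (fun x => max_count Sb x - c * delta * x).
Proof.
have Hexc T : sublinear (fun x => max_count T x - smax_count T x).
  apply: le_sublin excess_sublinear => x x1.
  rewrite ger0_norm ?subr_ge0 ?smax_le_max // (le_trans (max_sub_smax T x)) //.
  exact: ler_norm.
have HP : sublinear (fun x => smax_count xpredT x - cnt x).
  apply: le_sublin (sublinD (sublin_const (1 : R)) excess_sublinear) => x x1.
  rewrite ler0_norm ?subr_le0 ?smax_le_cnt // opprB; apply: le_trans (ler_norm _).
  have := cnt_le_max x; have := max_sub_smax xpredT x; lra.
have Hc : sublinear (fun x => cnt x - c * x).
  by apply: dom_sublin eta1 _; exists K => // x x1; exact: count_approx.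
apply: eq_sublin (sublinD (sublinD (Hexc Sb) smax_density) (sublinZ delta (sublinD HP Hc))) => x x1.
ring.
Qed.

(** Convolving [mob (rough (N p))] with 1 gives the indicator of the elements made of primes up to N
    p: in [maxE] this turns smallest primes into largest ones. *)
Lemma mobD_density : forall e, 0 < e -> exists2 X, 1 <= X & forall x, X <= x ->
  `|\sum_(g <- elts x) mobD (N := N) S g / nrm g + delta| <= e.
Proof.
have maxE x : \sum_(g <- elts x) mobD (N := N) S g * cnt (x / nrm g) = - max_count Sb x.
  transitivity (\sum_(g <- elts x | `[< exists p, is_Pmin N g p /\ S p >])
     mob xpredT g * cnt (x / nrm g)).
    rewrite [RHS]big_mkcond; apply: eq_bigr => g _; rewrite /mobD.
    by case: ifP => // _; rewrite mul0r.
  rewrite (sum_Pmin x S (fun g => cnt (x / nrm g))); congr (- _); apply: eq_bigr => p _.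
  transitivity (dact (mob (rough (N p))) cnt (x / N p)).
    by apply: eq_bigr => k _; rewrite asg_normD asg_norm1 invfM mulrA.
  rewrite dact_mob_cnt -countQE; apply: eq_dactl => g; apply: eq_ind; exact: predC_rough.
have H := sublinD max_density (axer (asgN := asgN) (axA := axA) (norm_mobD (N := N) S) (sublinear_mobD (asgN := asgN) (axA := axA) S)).
move=> e e0; have [X X1 HX] := H (c * e) (mulr_gt0 c0 e0).
exists X => // x Xx; have x1 := le_trans X1 Xx; have x0 := ge1_gt0 x1.
have := HX x Xx.
have -> : max_count Sb x - c * delta * x +
    \sum_(g <- elts x) mobD (N := N) S g * (cnt (x / nrm g) - c * (x / nrm g)) =
    - (c * x * (\sum_(g <- elts x) mobD (N := N) S g / nrm g + delta)).
  transitivity (max_count Sb x - c * delta * x + (\sum_(g <- elts x) mobD (N := N) S g * cnt (x / nrm g)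
     - c * x * \sum_(g <- elts x) mobD (N := N) S g / nrm g)).
    congr (_ + _); rewrite mulr_sumr -sumrB; apply: eq_bigr => g _; ring.
  rewrite maxE; ring.
rewrite normrN normrM (gtr0_norm (mulr_gt0 c0 x0)).
by rewrite [c * e * x]mulrAC ler_pM2l // mulr_gt0.
Qed.

End PrimeDensity.
End LargestPrime.

(** * Dominated convergence over the cofactor *)

Section DominatedConvergence.
Context {R : realType} {P : countType} {N : P -> R} {asgN : arith_semigroup N}.
Context {c eta K : R} {axA : axiom_A N c eta K}.
Local Notation nrm := (asg_norm N).
Local Notation elts := (elts N).
Local Notation dact := (dact (N := N)).
Local Notation cnt := (cnt N).
Local Notation primes_le := (primes_le (N := N)).
Local Notation rough := (rough (N := N)).
Local Notation smooth := (smooth (N := N)).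
Local Notation countQ := (countQ (N := N)).
Local Notation Lam := (vonM (N := N)).
Local Notation mobsum := (mobsum (N := N)).
Implicit Types (x y s t A B : R) (g h d k : {mset P}) (p q : P) (Q T : pred P).

Let c0 : 0 < c. Proof. exact: density_gt0. Qed.
Let K0 : 0 <= K. Proof. exact: error_ge0. Qed.

Definition prime_harm x : R := \sum_(p <- primes_le x) (N p)^-1.

Lemma prime_harm_ge0 x : 0 <= prime_harm x.
Proof. by apply: sumr_ge0 => p _; rewrite invr_ge0 ltW // norm_prime_gt0. Qed.

Lemma le_prime_harm x y : x <= y -> prime_harm x <= prime_harm y.
Proof.
move=> xy; rewrite /prime_harm (sum_primes_split xpredT _ xy) lerDl.
by apply: sumr_ge0 => p _; rewrite invr_ge0 ltW // norm_prime_gt0.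
Qed.

(* Between sqrt x and x the weights ln p are comparable to ln x, so the prime
   reciprocals there contribute O(1). *)
Lemma prime_harm_le : exists2 C, 0 <= C & forall x, expR 1 <= x ->
  prime_harm x <= C * (1 + ln (ln x)).
Proof.
have [C C0 HC] := dom_mertens (asgN := asgN) (axA := axA).
have step x : 1 < x -> prime_harm x <= prime_harm (x `^ 2^-1) + 2 * C.
  move=> x1; have x0 : 0 < x by exact: lt_trans x1.
  have l0 : 0 < ln x by exact: ln_gt0.
  have zx : x `^ 2^-1 <= x by rewrite ler1_powR ?(ltW x1) // invf_le1 // ler1n.
  rewrite /prime_harm (sum_primes_split xpredT _ zx) lerD2l.
  apply: le_trans (_ : 2 / ln x * \sum_(p <- primes_le x) ln (N p) / N p <= _).
    rewrite mulr_sumr big_mkcond; apply: ler_sum => p _ /=.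
    have p0 : 0 < N p by exact: norm_prime_gt0.
    have lp : 0 <= ln (N p) by rewrite ln_ge0 // norm_prime_ge1.
    case: ltP => zp; last by rewrite mulr_ge0 ?divr_ge0 // ltW.
    have : ln (x `^ 2^-1) <= ln (N p) by rewrite ler_ln ?posrE ?powR_gt0 // ltW.
    rewrite ln_powR => h; rewrite mulrA -[leLHS]mul1r ler_wpM2r ?invr_ge0 ?(ltW p0) //.
    by rewrite mulrAC ler_pdivlMr //; lra.
  apply: le_trans (_ : 2 / ln x * (C * ln x) <= _); last by apply: eq_ler; field; rewrite gt_eqF.
  apply: ler_wpM2l; first by rewrite divr_ge0 // ltW.
  apply: le_trans (HC x (ltW x1)).
  apply: (@le_sum_primes _ _ _ _ x _ (fun g => Lam g / nrm g)) => [p|g].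
    by rewrite vonM1 asg_norm1.
  by rewrite divr_ge0 ?vonM_ge0 ?asg_norm_ge0.
have main n x : 1 < x -> ln x <= 2 ^+ n -> prime_harm x <= prime_harm (expR 1) + 2 * C * n%:R.
  elim: n x => [|n IH] x x1.
    rewrite expr0 mulr0 addr0 => lx; apply: le_prime_harm.
    by rewrite -[leLHS]lnK ?posrE ?(lt_trans ltr01 x1) // ler_expR.
  move=> lx; apply: le_trans (step x x1) _.
  have z1 : 1 < x `^ 2^-1 by rewrite -[ltLHS](powRr0 x) ltr_powR // invr_gt0.
  have h : prime_harm (x `^ 2^-1) <= prime_harm (expR 1) + 2 * C * n%:R.
    by apply: IH => //; rewrite ln_powR mulrC ler_pdivrMr // -exprSr.
  have -> : n.+1%:R = n%:R + 1 :> R by rewrite natr1.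
  by move: h; rewrite [2 * C * (_ + _)]mulrDr mulr1; lra.
have l20 : 0 < ln 2 :> R by rewrite ln_gt0 // ltr1n.
pose D := prime_harm (expR 1) + 2 * C + 2 * C / ln 2.
exists D; first by rewrite !addr_ge0 ?prime_harm_ge0 ?divr_ge0 ?mulr_ge0 // ltW.
move=> x ex; have e1 : 1 < expR 1 :> R by rewrite expR_gt1.
have x1 := lt_le_trans e1 ex; have x0 := lt_trans ltr01 x1.
have lx1 : 1 <= ln x by rewrite -[leLHS]expRK ler_ln ?posrE ?expR_gt0.
have lx0 := ge1_gt0 lx1; have llx := ln_ge0 lx1.
(* A number of square roots sufficient to bring [x] down to at most e. *)
pose n := (Num.trunc (ln (ln x) / ln 2)).+1.
have n1 : ln x <= 2 ^+ n.
  rewrite -ler_ln ?posrE ?exprn_gt0 // lnXn // -[leRHS]mulr_natl -ler_pdivrMr //.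
  exact/ltW/truncnS_gt.
have n2 : n%:R <= ln (ln x) / ln 2 + 1.
  have -> : n%:R = (Num.trunc (ln (ln x) / ln 2))%:R + 1 :> R by rewrite natr1.
  by rewrite lerD2r truncn_le // divr_ge0 // ltW.
apply: le_trans (main n x x1 n1) _.
apply: le_trans (_ : prime_harm (expR 1) + 2 * C * (ln (ln x) / ln 2 + 1) <= _).
  by rewrite lerD2l ler_wpM2l // mulr_ge0.
have h1 : 0 <= prime_harm (expR 1) * ln (ln x) by rewrite mulr_ge0 ?prime_harm_ge0.
have h2 : 0 <= 2 * C * ln (ln x) by rewrite !mulr_ge0.
have h3 : 0 <= 2 * C / ln 2 by rewrite divr_ge0 ?mulr_ge0 // ltW.
rewrite -subr_ge0 (_ : _ - _ = prime_harm (expR 1) * ln (ln x) + 2 * C * ln (ln x) + 2 * C / ln 2).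
  by rewrite !addr_ge0.
by rewrite /D; field; rewrite gt_eqF.
Qed.

(** The sum of mob(g) cnt(x/|g|) counts smooth elements, so it is o(x); by [axer] it equals c x
    [mobsum] up to o(x). *)
Lemma mobsum_rough_vanish y : 1 <= y -> sublinear (fun x => x * mobsum (rough y) x).
Proof.
move=> y1.
have H1 : sublinear (fun x => \sum_(g <- elts x) mob (rough y) g).
  apply: eq_sublin (sublinear_mob_rough (asgN := asgN) (axA := axA) y1) => x _.
  by apply: eq_bigr => g _; rewrite mulr1.
have H2 := axer (asgN := asgN) (axA := axA) (@norm_mob _ _ (rough y)) H1.
apply: eq_sublin (sublinZ c^-1 (sublinB (sublinear_smooth_count (asgN := asgN) (axA := axA) y1) H2)) => x x1.
have -> : countQ (smooth y) x = dact (mob (rough y)) cnt x.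
  rewrite dact_mob_cnt -countQE; apply: eq_dactl => g; apply: eq_ind => q.
  by rewrite predC_rough.
rewrite /dact -sumrB /mobsum !mulr_sumr; apply: eq_bigr => g _.
by field; rewrite asg_norm_neq0 gt_eqF.
Qed.

Lemma sublin_scaled_div f p : sublinear (fun x => x * f x) -> sublinear (fun x => x * f (x / N p)).
Proof.
move=> H; apply: eq_sublin (sublinZ (N p) (@sublinear_div _ _ _ _ (fun x => x * f x) p H)) => x _.
by field; rewrite gt_eqF // norm_prime_gt0.
Qed.

(** * Weights of the cofactors *)

Section Cofactor.
Variable S : P -> Prop.
Definition inD0 g : bool := `[< exists p, is_Pmin N g p /\ S p >].

(** Taken at x/|k|, this is the coefficient of a(k)/|k| once the convolution of mu and a at g is
    expanded with g = k h. *)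
Definition cofactor_sum k x : R := \sum_(h <- elts x | inD0 (k `+` h)) mob xpredT h / nrm h.

Lemma mobsum_add_prime Q p x : ~~ Q p ->
  mobsum (fun q => (q == p) || Q q) x = mobsum Q x - (N p)^-1 * mobsum Q (x / N p).
Proof.
move=> Qp; set T := fun q => _.
have TQ k : k p = 0%N -> mob (R := R) T k = mob Q k.
  move=> kp; rewrite /mob (_ : supp_in T k = supp_in Q k) //.
  apply/supp_inP/supp_inP => H q kq; last by rewrite /T H ?orbT.
  by have := H q kq; rewrite /T => /orP[/eqP qp|//]; rewrite qp kp in kq.
have Q0 k : (0 < k p)%N -> mob (R := R) Q k = 0.
  move=> kp; rewrite /mob (_ : supp_in Q k = false) //.
  by apply/supp_inP => /(_ p kp); rewrite (negPf Qp).
rewrite {1}/mobsum (sum_split_prime x p); congr (_ + _).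
  rewrite /mobsum big_mkcond; apply: eq_bigr => k _; case: eqP => [/TQ ->//|/eqP kp].
  by rewrite Q0 ?mul0r // lt0n.
rewrite /mobsum mulr_sumr -sumrN; apply: eq_bigr => k _.
rewrite mobD1 /T eqxx /= andbT asg_normD asg_norm1 invfM -/T.
have [kp|kp] := eqVneq (k p) 0%N; last by rewrite Q0 ?lt0n // !mul0r mulr0 oppr0.
by rewrite TQ // mulNr mulrCA.
Qed.

(** Either h has only p and primes of larger norm, and the smallest prime of k h stays p; or h must
    bring its own unique smallest prime q, in S and of norm below N p. The two cases exclude each
    other, hence the exclusive or in [dich]. *)
Lemma cofactor_sumE k p x : is_Pmin N k p -> S p ->
  cofactor_sum k x = mobsum (rough (N p)) x - (N p)^-1 * mobsum (rough (N p)) (x / N p)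
   - \sum_(q <- primes_le x | `[< S q /\ N q < N p >]) (N q)^-1 * mobsum (rough (N q)) (x / N q).
Proof.
move=> kP Sp; have [kp Hk] := kP.
pose T q := (q == p) || rough (N p) q.
pose U h := `[< exists q, is_Pmin N h q /\ (S q /\ N q < N p) >].
have dich h : inD0 (k `+` h) = supp_in T h (+) U h.
  have kh q : (0 < (k `+` h) q)%N = (0 < k q)%N || (0 < h q)%N by rewrite msetE2 addn_gt0.
  case: (boolP (supp_in T h)) => [/supp_inP hT|/allPn[r]] /=.
    have -> : U h = false.
      apply/asboolP => -[q [[hq _] [_ qp]]]; have := hT q hq.
      by rewrite /T /rough ltNge (ltW qp) orbF => /eqP qE; rewrite qE ltxx in qp.
    apply/asboolP; exists p; split=> //; split=> [|q]; first by rewrite kh kp.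
    rewrite kh => /orP[kq qp|hq qp]; first exact: Hk.
    by have := hT q hq; rewrite /T => /orP[/eqP|].
  rewrite mem_gt0 /T negb_or /rough -leNgt => hr /andP[/eqP rp rNp].
  apply/asboolP/asboolP => -[q [[hq Hq] Sq]].
    have qp : q <> p.
      move=> qE; have := Hq r; rewrite kh hr orbT qE => /(_ isT rp).
      by rewrite ltNge rNp.
    have Nqp : N q < N p by apply: Hq => [|/esym//]; rewrite kh kp.
    have khq : k q = 0%N.
      by case: (posnP (k q)) => // kq; have := lt_trans Nqp (Hk q kq qp); rewrite ltxx.
    exists q; split=> //; split=> [|s hs sq]; first by move: hq; rewrite kh khq.
    by apply: Hq => //; rewrite kh hs orbT.
  have [Sq' qp] := Sq.
  exists q; split=> //; split=> [|s]; first by rewrite kh hq orbT.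
  rewrite kh => /orP[ks sq|hs sq]; last exact: Hq.
  have [->//|/eqP sp] := eqVneq s p.
  exact: lt_trans qp (Hk s ks sp).
have -> : cofactor_sum k x = mobsum T x + \sum_(h <- elts x | U h) mob xpredT h * (nrm h)^-1.
  rewrite /cofactor_sum /mobsum [X in _ + X]big_mkcond -big_split big_mkcond /=.
  apply: eq_bigr => h _; rewrite dich /mob.
  have sT : supp_in xpredT h by exact/supp_inP.
  have TU : supp_in T h -> U h = false.
    move=> /supp_inP hT; apply/asboolP => -[q [[hq _] [_ qp]]]; have := hT q hq.
    by rewrite /T /rough ltNge (ltW qp) orbF => /eqP qE; rewrite qE ltxx in qp.
  rewrite sT; case: (boolP (supp_in T h)) => [/TU ->|_] /=; first by rewrite addr0.
  by rewrite mul0r add0r; case: (U h).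
rewrite mobsum_add_prime; last by rewrite /rough ltxx.
rewrite /U (sum_Pmin x (fun q => S q /\ N q < N p) (fun h => (nrm h)^-1)); congr (_ - _).
apply: eq_bigr => q _; rewrite /mobsum mulr_sumr; apply: eq_bigr => h _.
by rewrite asg_normD asg_norm1 invfM mulrCA.
Qed.

Lemma norm_prime_le_dvd k p : (0 < k p)%N -> N p <= nrm k.
Proof. by move=> kp; rewrite -asg_norm1; apply: asg_norm_dvd; rewrite dvd1E. Qed.

(** By [cofactor_sumE] there are two bounded terms, plus one of size O(1/(N q)) for primes q below
    the smallest prime of k. Their sum is O(log log |k|), the weight in the hypothesis on a. *)
Lemma cofactor_sum_bounded : exists2 C, 0 <= C & forall k x, inD0 k ->
  `|cofactor_sum k x| <= C * (2 + prime_harm (nrm k)).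
Proof.
have [C C0 HC] := mobsum_bounded (asgN := asgN) (axA := axA).
exists C => // k x /asboolP[p [kP Sp]]; rewrite (cofactor_sumE _ kP Sp).
have [kp _] := kP.
have p1 : (N p)^-1 <= 1 by rewrite invf_le1 ?norm_prime_gt0 ?norm_prime_ge1.
have p0 : 0 <= (N p)^-1 by rewrite invr_ge0 ltW // norm_prime_gt0.
apply: le_trans (ler_normB _ _) _; rewrite mulrDr; apply: lerD.
  apply: le_trans (ler_normB _ _) _; rewrite [leRHS]mulr_natr mulr2n; apply: lerD => //.
  by rewrite normrM (ger0_norm p0) -[leRHS]mul1r ler_pM.
apply: le_trans (ler_norm_sum _ _ _) _.
rewrite mulrC /prime_harm mulr_suml.
apply: le_trans (_ : \sum_(q <- primes_le (nrm k) | `[< S q /\ N q < N p >]) (N q)^-1 * C <= _).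
  apply: le_trans (_ : \sum_(q <- primes_le x | `[< S q /\ N q < N p >]) (N q)^-1 * C <= _).
    apply: ler_sum => q _; rewrite normrM ger0_norm ?invr_ge0 ?(ltW (norm_prime_gt0 _)) //.
    by rewrite ler_wpM2l // invr_ge0 ltW // norm_prime_gt0.
  pose M := Num.max x (nrm k).
  apply: le_trans (_ : \sum_(q <- primes_le M | `[< S q /\ N q < N p >]) (N q)^-1 * C <= _).
    rewrite (@sum_primes_split _ _ _ _ _ x M) ?lerDl ?le_max ?lexx //.
    by apply: sumr_ge0 => q _; rewrite mulr_ge0 // invr_ge0 ltW // norm_prime_gt0.
  rewrite (@sum_primes_split _ _ _ _ _ (nrm k) M) ?le_max ?lexx ?orbT //.
  rewrite [X in _ + X]big1 ?addr0 // => q /andP[/asboolP[_ qp]].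
  by rewrite ltNge (le_trans (ltW qp)) // norm_prime_le_dvd.
rewrite big_mkcond; apply: ler_sum => q _; case: ifP => // _.
by rewrite mulr_ge0 // invr_ge0 ltW // norm_prime_gt0.
Qed.

(** Once x >= N p the range of q no longer depends on x, and each of the finitely many terms tends
    to 0. *)
Lemma cofactor_sum_vanish k : inD0 k -> sublinear (fun x => x * cofactor_sum k x).
Proof.
move=> /asboolP[p [kP Sp]].
have H q : sublinear (fun x => x * mobsum (rough (N q)) x) by exact/mobsum_rough_vanish/norm_prime_ge1.
have H1 := sublinB (H p) (sublinZ (N p)^-1 (@sublin_scaled_div (mobsum (rough (N p))) p (H p))).
have H2 : sublinear (fun x => \sum_(q <- primes_le (N p) | `[< S q /\ N q < N p >])
    (N q)^-1 * (x * mobsum (rough (N q)) (x / N q))).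
  by apply: sublinear_sum => q _; apply: sublinZ; exact: (@sublin_scaled_div (mobsum (rough (N q))) q (H q)).
move=> e e0; have [X X1 HX] := sublinB H1 H2 e0.
exists (Num.max X (N p)); first by rewrite le_max X1.
move=> x; rewrite ge_max => /andP[Xx px]; have := HX x Xx.
rewrite (cofactor_sumE _ kP Sp).
have -> : \sum_(q <- primes_le x | `[< S q /\ N q < N p >]) (N q)^-1 * mobsum (rough (N q)) (x / N q) =
    \sum_(q <- primes_le (N p) | `[< S q /\ N q < N p >]) (N q)^-1 * mobsum (rough (N q)) (x / N q).
  rewrite (sum_primes_split _ _ px) [X in _ + X]big1 ?addr0 // => q /andP[/asboolP[_ qp]].
  by rewrite ltNge (ltW qp).
have -> : \sum_(q <- primes_le (N p) | `[< S q /\ N q < N p >]) (N q)^-1 * (x * mobsum (rough (N q)) (x / N q)) =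
    x * \sum_(q <- primes_le (N p) | `[< S q /\ N q < N p >]) (N q)^-1 * mobsum (rough (N q)) (x / N q).
  by rewrite mulr_sumr; apply: eq_bigr => q _; rewrite mulrCA.
by apply: le_trans; apply: eq_ler; congr `|_|; ring.
Qed.

Variable alpha : {mset P} -> R.
Hypotheses (alpha_ge0 : forall k, 0 <= alpha k)
  (alpha_supp : forall k, k != mset0 -> ~~ inD0 k -> alpha k = 0)
  (alpha_cauchy : forall e, 0 < e -> exists2 X, 2 <= X & forall x z, X <= z -> z <= x ->
     `|\sum_(k <- elts x | z < nrm k) alpha k / nrm k * ln (ln (nrm k))| <= e).

Lemma cofactor_dominated : forall e, 0 < e -> exists2 X, 1 <= X & forall x, X <= x ->
  \sum_(k <- elts x | k != mset0) alpha k / nrm k * `|cofactor_sum k (x / nrm k)| <= e.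
Proof.
have [C1 C10 H1] := cofactor_sum_bounded; have [C2 C20 H2] := prime_harm_le.
pose D := C1 * (2 + 2 * C2) + 1.
have D0 : 0 < D by rewrite /D ltr_wpDl // mulr_ge0 // addr_ge0 // mulr_ge0.
move=> e e0; have eD : 0 < e / 2 / D by rewrite !divr_gt0.
have [X X2 HX] := alpha_cauchy eD.
(* Up to [Z] there are finitely many k with vanishing weights. Beyond e^e the double logarithm is at
   least 1 and absorbs the constants of [H1] and [H2]. *)
pose Z := Num.max X (expR (expR 1)).
have XZ : X <= Z by rewrite le_max lexx.
have eZ : expR (expR 1) <= Z by rewrite le_max lexx orbT.
have Z1 : 1 <= Z by apply: le_trans XZ; lra.
have fin : sublinear (fun x => \sum_(k <- elts Z | inD0 k)
    alpha k * ((x / nrm k) * `|cofactor_sum k (x / nrm k)|)).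
  apply: sublinear_sum => k kD; apply: sublinZ.
  apply: (@sublin_scale _ (fun x => x * `|cofactor_sum k x|)); first exact: asg_norm_ge1.
  apply: le_sublin (cofactor_sum_vanish kD) => x _.
  by rewrite !normrM normr_id.
have e20 : 0 < e / 2 by rewrite divr_gt0.
have [Y Y1 HY] := fin _ e20.
exists (Num.max Y Z); first by rewrite le_max Y1.
move=> x; rewrite ge_max => /andP[Yx Zx].
have x1 := le_trans Y1 Yx; have x0 := ge1_gt0 x1.
rewrite big_mkcond (sum_elts_split _ Zx) [leRHS](splitr e); apply: lerD.
  rewrite -(ler_pM2l x0); apply: le_trans (_ : e / 2 * x <= _); last by rewrite mulrC.
  apply: le_trans (HY x Yx); apply: le_trans (ler_norm _).
  rewrite mulr_sumr [leRHS]big_mkcond; apply: ler_sum => k _.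
  case: (boolP (k != mset0)) => k0; last first.
    rewrite mulr0; case: ifP => // _; rewrite !mulr_ge0 ?invr_ge0 ?asg_norm_ge0 ?(ltW x0) //.
  case: (boolP (inD0 k)) => kD; last by rewrite (alpha_supp k0 kD) !mul0r mulr0.
  by apply: eq_ler; ring.
apply: le_trans (_ : D * (\sum_(k <- elts x | Z < nrm k) alpha k / nrm k * ln (ln (nrm k))) <= _).
  rewrite mulr_sumr; apply: ler_sum => k Zk.
  have kZ : expR (expR 1) < nrm k := le_lt_trans eZ Zk.
  have k1 : expR 1 <= ln (nrm k).
    by rewrite -[leLHS]expRK ler_ln ?posrE ?expR_gt0 ?asg_norm_gt0 // ltW.
  have l0 : 0 < ln (nrm k) by apply: lt_le_trans k1; exact: expR_gt0.
  have ll1 : 1 <= ln (ln (nrm k)) by rewrite -[leLHS]expRK ler_ln ?posrE ?expR_gt0.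
  have kE : expR 1 <= nrm k.
    apply: le_trans (ltW kZ); rewrite ler_expR; apply: ltW; apply: lt_trans (expR_gt1Dx _); lra.
  have ak0 : 0 <= alpha k / nrm k by rewrite divr_ge0 ?asg_norm_ge0.
  case: ifP => [k0|_]; last by rewrite !mulr_ge0 ?(ltW D0) ?(le_trans ler01 ll1) ?invr_ge0 ?asg_norm_ge0.
  case: (boolP (inD0 k)) => kD; last by rewrite (alpha_supp k0 kD) !mul0r mulr0.
  rewrite [leRHS]mulrCA; apply: ler_wpM2l => //; apply: le_trans (H1 k _ kD) _.
  have h1 := H2 _ kE.
  have h2 : C1 * (2 + prime_harm (nrm k)) <= C1 * (2 + C2 * (1 + ln (ln (nrm k)))).
    by rewrite ler_wpM2l // lerD2l.
  apply: le_trans h2 _; set l := ln (ln _) in ll1 *.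
  apply: le_trans (_ : C1 * ((2 + 2 * C2) * l) <= _).
    apply: ler_wpM2l => //; have : C2 * (1 + l) <= C2 * (2 * l) by rewrite ler_wpM2l //; lra.
    by move: ll1; lra.
  rewrite mulrA ler_wpM2r ?(le_trans ler01 ll1) // /D lerDl //.
rewrite mulrC -ler_pdivlMr //; apply: le_trans (HX x Z XZ Zx); exact: ler_norm.
Qed.

End Cofactor.
End DominatedConvergence.

(** * Passage to the complex-valued statement *)

Section Bridge.
Context {R : realType}.
Implicit Types (x y e : R).

Lemma near_pinfty_ge (f : R -> R) (l : R) : f x @[x --> +oo] --> l ->
  forall e, 0 < e -> exists2 X, 1 <= X & forall x, X <= x -> `|f x - l| <= e.
Proof.
move=> /cvgrPdist_le Hf e e0; have [M [_ HM]] := Hf e e0.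
exists (Num.max 1 (M + 1)); first by rewrite le_max lexx.
move=> x; rewrite ge_max => /andP[_ Mx]; rewrite distrC; apply: HM.
by apply: lt_le_trans Mx; rewrite ltrDl.
Qed.

Lemma real_complexP (z : R[i]) : 0 < z -> z = (complex.Re z)%:C /\ 0 < complex.Re z.
Proof.
case: z => a b; rewrite ltcE /= => /andP[/eqP b0 a0]; split=> //.
by rewrite b0.
Qed.

Lemma normc_real (z : R[i]) : `|z| = (complex.Re `|z|)%:C.
Proof. by rewrite normc_def. Qed.

Lemma Re_norm_ge0 (z : R[i]) : 0 <= complex.Re `|z|.
Proof. by rewrite normc_def /= sqrtr_ge0. Qed.

Lemma cvg_complex_pinfty (f : R -> R[i]) (l : R[i]) :
  (forall e, 0 < e -> exists2 X, 1 <= X & forall x, X <= x -> `|f x - l| <= e%:C) ->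
  (fun x => (f x : R[i]^o)) @ +oo --> (l : R[i]^o).
Proof.
move=> H; apply/cvgrPdist_le => e /real_complexP[-> e0].
have [X X1 HX] := H _ e0; exists X; split; first exact: num_real.
by move=> x Xx /=; rewrite distrC; apply: HX; exact: ltW.
Qed.

Lemma axiomA_axiom_A (P : countType) (N : P -> R) (asgN : arith_semigroup N) :
  axiomA N -> exists c eta K, axiom_A N c eta K.
Proof.
move=> [c [eta [K [x0 [c0 [/andP[eta0 eta1] H]]]]]].
pose x1 := Num.max 1 x0.
have x11 : 1 <= x1 by rewrite le_max lexx.
pose K' := `|K| + (cnt N x1 + c * x1).
have x10 : 0 <= x1 by exact: ge1_ge0.
have cx0 : 0 <= cnt N x1 + c * x1.
  by apply: addr_ge0; [exact: cnt_ge0|exact: mulr_ge0 (ltW c0) x10].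
have K'0 : 0 <= K' by exact: addr_ge0.
exists c, eta, K'; split=> // x xge1.
have xe := powR_ge1 (ltW eta0) xge1.
have [xx1|/ltW x1x] := leP x x1.
  apply: le_trans (ler_normB _ _) _; rewrite -/(cnt N x) (ger0_norm (cnt_ge0 x)).
  rewrite ger0_norm; last exact: mulr_ge0 (ltW c0) (ge1_ge0 xge1).
  apply: le_trans (_ : K' * 1 <= _); last by rewrite ler_wpM2l.
  rewrite mulr1 /K' ler_wpDl //; apply: lerD; first exact: le_cnt.
  by rewrite ler_wpM2l // ltW.
have NE : Ncount N x = \sum_(g <- elts N x) 1.
  rewrite /Ncount (@fsbig_elts _ _ _ _ _ x) // big_seq_cond [RHS]big_seq.
  apply: eq_bigl => g; rewrite mem_elts.
  by apply/andP/idP => [[]//|gx]; split=> //; apply/asboolP.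
have := H x; rewrite NE => Hx; apply: le_trans (Hx _) _.
  by apply: le_trans x1x; rewrite le_max lexx orbT.
rewrite ler_wpM2r ?(le_trans ler01) // (le_trans (ler_norm _)) // /K' lerDl //.
Qed.

Context {P : countType} {N : P -> R} {asgN : arith_semigroup N}.
Local Notation nrm := (asg_norm N).
Local Notation elts := (elts N).
Implicit Types (g h d k : {mset P}) (p q : P) (S : P -> Prop).

Lemma asg_muE g : asg_mu R g = (mob xpredT g)%:C.
Proof.
have sT : supp_in xpredT g by exact/supp_inP.
rewrite /asg_mu /mob sT /=; case: ifP => _; last by rewrite rmorph0.
by rewrite rmorphXn /= rmorphN1.
Qed.

Lemma piSE (S : set P) x : piS N S x = pi_count (N := N) (fun p => `[< S p >]) x.
Proof.
rewrite /piS /pi_count fsbig_finite /=; last first.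
  by apply: sub_finite_set (finite_primes_le x) => p [].
rewrite -[RHS]big_filter; apply: perm_big; apply: uniq_perm.
- exact: fset_uniq.
- exact/filter_uniq/primes_le_uniq.
move=> p; rewrite mem_filter mem_primes_le in_fset_set; last first.
  by apply: sub_finite_set (finite_primes_le x) => q [].
by apply/idP/andP => [/set_mem[Sp px]|[/asboolP Sp px]]; [split=> //; exact/asboolP|exact: mem_set].
Qed.

Lemma piS_density (S : set P) (delta : R) :
  piS N S x / piS N setT x @[x --> +oo] --> delta ->
  forall e, 0 < e -> exists2 X, 1 <= X & forall x, X <= x ->
   `|pi_count (N := N) (fun p => `[< S p >]) x - delta * pi_count (N := N) xpredT x| <=
     e * pi_count (N := N) xpredT x.
Proof.
move=> /near_pinfty_ge H e /H[X X1 HX]; exists X => // x Xx.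
have := HX x Xx; rewrite !piSE.
have -> : pi_count (N := N) (fun p => `[< setT p >]) x = pi_count (N := N) xpredT x.
  by apply: eq_bigl => p; apply/asboolP.
set a := pi_count _ _; set b := pi_count _ _.
have b0 : 0 <= b by exact: pi_count_ge0.
have ab : a <= b.
  by rewrite /a /b /pi_count big_mkcond; apply: ler_sum => p _; case: ifP.
have a0 : 0 <= a by exact: pi_count_ge0.
(* Without primes up to [x] the quotient is a division by 0 and carries no information, but both
   counts are 0. *)
have [bz|bnz] := eqVneq b 0.
  have -> : a = 0 by apply/eqP; rewrite eq_le a0 -bz ab.
  by rewrite bz !mulr0 subrr normr0.
have bp : 0 < b by rewrite lt_neqAle eq_sym bnz.
rewrite -(ler_pM2r bp); apply: le_trans.
have -> : a - delta * b = (a / b - delta) * b by rewrite mulrBl divfK.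
by rewrite normrM (gtr0_norm bp).
Qed.

Lemma inD_cond (S : set P) g : `[< inD N S g /\ g <> mset0 >] = inD0 (N := N) S g.
Proof.
apply/asboolP/asboolP => [[[-> //|//]]|[p [Pp Sp]]].
split; first by right; exists p.
by move=> g0; case: Pp => + _; rewrite g0 mset0E.
Qed.

Lemma mu_convE (a : {mset P} -> R[i]) g :
  mu_conv a g = \sum_(h <- divs N g) (mob xpredT h)%:C * a (g `\` h).
Proof.
have sub h : asg_dvd h g -> nrm h <= nrm g by exact: asg_norm_dvd.
rewrite /mu_conv (@fsbig_elts _ _ _ _ _ (nrm g)) // /divs big_filter.
apply: eq_big => [h|h _]; last by rewrite asg_muE.
by apply/asboolP/idP.
Qed.

Lemma sum_set_inD (S : set P) (F : {mset P} -> R[i]) x :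
  \sum_(g \in [set g : {mset P} | nrm g <= x /\ inD N S g /\ g <> mset0]) F g =
  \sum_(g <- elts x | inD0 (N := N) S g) F g.
Proof.
rewrite (@fsbig_elts _ _ _ _ _ x) => [|g [//]].
rewrite big_seq_cond [RHS]big_seq_cond; apply: eq_bigl => g; rewrite mem_elts.
case: (boolP (nrm g <= x)) => //= gx; rewrite -inD_cond.
by apply/asboolP/asboolP => [[]|].
Qed.

Lemma sum_mu_conv (S : P -> Prop) (a : {mset P} -> R[i]) x :
  \sum_(g <- elts x | inD0 (N := N) S g) mu_conv a g / (nrm g)%:C =
  \sum_(k <- elts x) a k / (nrm k)%:C * (cofactor_sum (N := N) S k (x / nrm k))%:C.
Proof.
pose F h k : R[i] := if inD0 (N := N) S (h `+` k)
  then (mob xpredT h)%:C * a k / (nrm (h `+` k))%:C else 0.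
transitivity (\sum_(h <- elts x) \sum_(k <- elts (x / nrm h)) F h k).
  rewrite sum_pairs big_mkcond; apply: eq_bigr => g _.
  rewrite mu_convE mulr_suml; case: ifP => gD.
    rewrite big_seq [RHS]big_seq; apply: eq_bigr => h; rewrite mem_divs => hg.
    by rewrite /F msetBDKC // gD.
  by rewrite big_seq big1 // => h; rewrite mem_divs => hg; rewrite /F msetBDKC // gD.
rewrite sum_pairsC; apply: eq_bigr => k _.
rewrite /cofactor_sum rmorph_sum mulr_sumr [RHS]big_mkcond; apply: eq_bigr => h _.
rewrite /F msetDC; case: ifP => // _.
rewrite asg_normD [_ * nrm h]mulrC rmorphM /= rmorphM /= fmorphV /=.
by rewrite invfM; ring.
Qed.

(** The identity as cofactor has weight a(e) = 1 and contributes the limit - delta; all other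
    cofactors are dominated in absolute value. *)
Lemma real_cvg_main (S : P -> Prop) (a : {mset P} -> R[i]) (delta : R) :
  a mset0 = 1 ->
  (forall e, 0 < e -> exists2 X, 1 <= X & forall x, X <= x ->
    `|\sum_(g <- elts x) mobD (N := N) S g / nrm g + delta| <= e) ->
  (forall e, 0 < e -> exists2 X, 1 <= X & forall x, X <= x ->
    \sum_(k <- elts x | k != mset0) complex.Re `|a k| / nrm k *
       `|cofactor_sum (N := N) S k (x / nrm k)| <= e) ->
  forall e, 0 < e -> exists2 X, 1 <= X & forall x, X <= x ->
    `|\sum_(g <- elts x | inD0 (N := N) S g) mu_conv a g / (nrm g)%:C - (- delta)%:C| <= e%:C.
Proof.
move=> a1 H1 H2 e e0; have e20 : 0 < e / 2 by rewrite divr_gt0.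
have [X X1 HX] := H1 _ e20; have [Y Y1 HY] := H2 _ e20.
exists (Num.max X Y); first by rewrite le_max X1.
move=> x; rewrite ge_max => /andP[Xx Yx]; have x1 := le_trans X1 Xx.
rewrite sum_mu_conv (bigD1_seq mset0) ?elts_uniq ?mem_elts ?asg_norm0 //=.
rewrite a1 ?asg_norm0 !divr1 mul1r.
have -> : cofactor_sum (N := N) S mset0 x = \sum_(g <- elts x) mobD (N := N) S g / nrm g.
  rewrite /cofactor_sum big_mkcond; apply: eq_bigr => g _; rewrite mset0D /mobD /inD0.
  by case: ifP => //; rewrite mul0r.
rewrite addrAC -rmorphB /= opprK; apply: le_trans (ler_normD _ _) _.
have -> : e%:C = (e / 2)%:C + (e / 2)%:C by rewrite -rmorphD /= -splitr.
apply: lerD.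
  by rewrite normc_def /= expr0n addr0 sqrtr_sqr lecR HX.
apply: le_trans (ler_norm_sum _ _ _) _; apply: le_trans (_ : (\sum_(k <- elts x | k != mset0) complex.Re `|a k| / nrm k *
       `|cofactor_sum (N := N) S k (x / nrm k)|)%:C <= _); last by rewrite lecR HY.
rewrite rmorph_sum; apply: ler_sum => k _ /=.
rewrite !normrM normfV normc_real rmorphM /= rmorphM /= fmorphV /=.
have nC (r : R) : `|r%:C| = `|r|%:C by rewrite normc_def /= expr0n addr0 sqrtr_sqr.
by rewrite !nC (ger0_norm (asg_norm_ge0 _)).
Qed.

End Bridge.

Theorem theorem1p1 (R : realType) (P : countType) (N : P -> R)
  (hN1 : forall p : P, 1 < N p)
  (hfin : forall x : R, finite_set [set g : {mset P} | asg_norm N g <= x])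
  (hA : axiomA N)
  (S : set P) (delta : R)
  (hdens : (fun x : R => piS N S x / piS N setT x) @ +oo --> delta)
  (a : {mset P} -> R[i])
  (hsupp : forall g : {mset P}, ~ inD N S g -> a g = 0)
  (ha1 : a mset0 = 1)
  (hsum : cvg ((fun x : R =>
       \sum_(g \in [set g : {mset P} | 2 <= asg_norm N g <= x /\ inD N S g])
         complex.Re `|a g| / asg_norm N g * ln (ln (asg_norm N g))) @ +oo)) :
  ((fun x : R =>
     (\sum_(g \in [set g : {mset P} | asg_norm N g <= x /\ inD N S g /\ g <> mset0])
        mu_conv a g / (asg_norm N g)%:C : (R[i])^o)) @ +oo --> ((- delta)%:C : (R[i])^o))
  /\
  ((fun x : R =>
     (\sum_(g \in [set g : {mset P} | asg_norm N g <= x /\ inD N S g /\ g <> mset0])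
        asg_mu R g / (asg_norm N g)%:C : (R[i])^o)) @ +oo --> ((- delta)%:C : (R[i])^o)).
Proof.
have asgN : arith_semigroup N by split.
have [c [eta [K axA]]] := axiomA_axiom_A asgN hA.
have Hmob e : 0 < e -> exists2 X, 1 <= X & forall x, X <= x ->
    `|\sum_(g <- elts N x) mobD (N := N) S g / asg_norm N g + delta| <= e.
  by apply: (mobD_density (axA := axA)) => e' e'0; exact: piS_density.
split; apply: cvg_complex_pinfty; last first.
  move=> e e0; have [X X1 HX] := Hmob e e0; exists X => // x Xx.
  rewrite sum_set_inD.
  have -> : \sum_(g <- elts N x | inD0 (N := N) S g) asg_mu R g / (asg_norm N g)%:C =
      (\sum_(g <- elts N x) mobD (N := N) S g / asg_norm N g)%:C.
    rewrite rmorph_sum big_mkcond; apply: eq_bigr => g _ /=.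
    rewrite asg_muE /mobD /inD0; case: ifP => _; last by rewrite mul0r.
    by rewrite rmorphM /= fmorphV.
  rewrite -rmorphB /= opprK normc_def /= expr0n addr0 sqrtr_sqr lecR.
  exact: HX.
pose alpha (g : {mset P}) : R := complex.Re `|a g|.
have a_supp k : k != mset0 -> ~~ inD0 (N := N) S k -> alpha k = 0.
  move=> k0 kD; rewrite /alpha hsupp ?normr0 // => -[k0'|kD'].
    by rewrite k0' eqxx in k0.
  by move/asboolP: kD.
have a_cauchy e : 0 < e -> exists2 X, 2 <= X & forall x z, X <= z -> z <= x ->
     `|\sum_(k <- elts N x | z < asg_norm N k) alpha k / asg_norm N k * ln (ln (asg_norm N k))| <= e.
  (* Convergence gives small tails; with z >= 2 the lower cut-off in the hypothesis does not affect
     them. *)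
  move=> e0; have /cvg_ex[l Hl] := hsum.
  have [X X1 HX] := near_pinfty_ge Hl (divr_gt0 e0 (ltr0Sn _ 1)).
  exists (Num.max X 2); first by rewrite le_max lexx orbT.
  move=> x z; rewrite ge_max => /andP[Xz z2] zx.
  have Xx := le_trans Xz zx.
  pose F g := alpha g / asg_norm N g * ln (ln (asg_norm N g)).
  pose s y := \sum_(g \in [set g : {mset P} | 2 <= asg_norm N g <= y /\ inD N S g]) F g.
  have sE y : s y = \sum_(g <- elts N y) (if `[< 2 <= asg_norm N g /\ inD N S g >] then F g else 0).
    rewrite /s (@fsbig_elts _ _ _ _ _ y) => [|g [/andP[]//]].
    rewrite big_mkcond big_seq [RHS]big_seq; apply: eq_bigr => g; rewrite mem_elts => gy.
    congr (if _ then _ else _); apply/asboolP/asboolP => -[]; first by move=> /andP[].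
    by move=> g2 gD; split=> //; rewrite g2.
  have E : \sum_(k <- elts N x | z < asg_norm N k) F k = (s x - l) - (s z - l).
    rewrite !sE (sum_elts_split _ zx) [RHS](_ : _ = \sum_(g <- elts N x | z < asg_norm N g)
      (if `[< 2 <= asg_norm N g /\ inD N S g >] then F g else 0)); last by ring.
    apply: eq_bigr => g zg; case: asboolP => // nD.
    rewrite /F /alpha hsupp ?normr0 ?mul0r // => gD; apply: nD; split=> //.
    exact: le_trans z2 (ltW zg).
  rewrite E; apply: le_trans (ler_normB _ _) _; rewrite (splitr e).
  by apply: lerD; [exact: HX|exact: HX].
move=> e e0.
have [X X1 HX] := @real_cvg_main _ _ _ asgN S a delta ha1 Hmob
  (@cofactor_dominated _ _ _ asgN c eta K axA S alpha (fun k => Re_norm_ge0 _) a_supp a_cauchy) e e0.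
by exists X => // x Xx; rewrite sum_set_inD; exact: HX.
Qed.
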